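(* Let $(A,\mathfrak m)$ be a Noetherian local ring with infinite residue field $A/\mathfrak m$, and let $J$ be an $\mathfrak m$-primary ideal of $A$. Let $\mathcal F=\{I_n\}_{n\ge 0}$ be a good filtration of ideals in $A$ with $\ell(\mathcal F)=\ell>0$. Let $x_1,x_2,\ldots,x_\ell$ be a weak-(FC)-sequence in $I_1$ with respect to $(J,\mathcal F)$. Set $\mathfrak I=(x_1,x_2,\ldots,x_\ell)$, $r=r_{\mathfrak I}(\mathcal F)$, and $Q=(x_1,x_2,\ldots,x_{\ell-1})$. Then $$e(F_J(\mathcal F))=l_A\left(\frac{I_n}{(Q:I_1^\infty)\cap I_n+JI_n}\right)\quad\text{for all } n\ge r.$$
   Context: Filtrations. A filtration $\mathcal F=\{I_n\}_{n\ge0}$ of ideals in $A$ is a chain of ideals with $I_0=A$, $I_1$ a proper ideal, $I_{n+1}\subseteq I_n$ and $I_nI_m\subseteq I_{n+m}$ for all $n,m\ge0$. For an ideal $I$ of $A$, $\mathcal F$ is an $I$-good filtration if $II_n\subseteq I_{n+1}$ for all $n\ge0$ and $I_{n+1}=II_n$ for all large $n$. $\mathcal F$ is good if it is $I$-good for some ideal $I$ of $A$ (equivalently, $I_1$-good). A good filtration is nilpotent if $I_n=0$ for all large $n$ (equivalently, $I_1$ is nilpotent). For an ideal $K$ of $A$, $\mathcal F/K=\{I_n(A/K)\}_{n\ge0}$, a filtration of ideals of $A/K$. Fiber cones. $F_J(\mathcal F)=\bigoplus_{n\ge0}(I_n/JI_n)t^n$ is the fiber cone of $\mathcal F$ with respect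 to the $\mathfrak m$-primary ideal $J$. The analytic spread of $\mathcal F$ is $\ell(\mathcal F)=\dim F_{\mathfrak m}(\mathcal F)$. Let $R(\mathcal F)=\bigoplus_{n\ge0}I_nt^n$ and let $\mathfrak M$ be its maximal homogeneous ideal. $e(F_J(\mathcal F))$ denotes the Hilbert–Samuel multiplicity of the local ring $F_J(\mathcal F)_{\mathfrak M}$. $l_A$ denotes length of $A$-modules, and $K:I_1^\infty=\bigcup_{n\ge 0}(K:I_1^n)$ for an ideal $K$. Reductions. An ideal $\mathfrak I$ is a reduction of a good filtration $\mathcal F$ if $\mathcal F$ is an $\mathfrak I$-good filtration; it is a minimal reduction if it does not properly contain any other reduction of $\mathcal F$. The reduction number $r_{\mathfrak I}(\mathcal F)$ of $\mathcal F$ with respect to a reduction $\mathfrak I$ is the least integer $n$ such that $\mathfrak I I_n=I_{n+1}$. (The ideal $\mathfrak I$ in the claim is a minimal reduction of $\mathcal F$.) Weak-(FC)-sequences. Let $I$ be an ideal of a Noetherian local ring $A$ and $\mathcal F$ a non-nilpotent good filtration. An element $x\in I_1$ is a weak-(FC)-element with respect to $(I,\mathcal F)$ if: (FC$_1$) $I^mI_n\cap(x)=I^mxI_{n-1}$ for all large $n$ and for all non-negative integers $m$; (FC$_2$) $0:x\subseteq 0:I_1^\infty$. A sequence $x_1,\ldots,x_s$ in $I_1$ is a weak-(FC)-sequence in $I_1$ with respect to $(I,\mathcal F)$ if for each $i=0,\ldots,s-1$, with $A_i=A/(x_1,\ldots,x_i)$ and $\mathcal F_i=\mathcal F/(x_1,\ldots,x_i)$,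 the image of $x_{i+1}$ in $A_i$ is a weak-(FC)-element with respect to $(IA_i,\mathcal F_i)$ (in particular $\mathcal F_i$ is non-nilpotent).
   Formalization: The reduction number r is taken as the least r with 𝔍I_n = I_{n+1} for all n ≥ r, not for a single n; with a single n the claim fails for A = k[[s²,s³]], J = m, I_1 = (s²), I_n = (s^{2n}, s^{2n+1}) for n ≥ 2, x_1 = s². *)

(* Defs.v *)
From HB Require Import structures.
From mathcomp Require Import all_boot all_order all_algebra.
From mathcomp Require Import boolp classical_sets functions cardinality.
From mathcomp Require Import ring.

Set Implicit Arguments.
Unset Strict Implicit.
Unset Printing Implicit Defensive.

Import GRing.Theory.
Local Open Scope ring_scope.
Local Open Scope quotient_scope.
Local Open Scope classical_set_scope.

(* Ideals are [set]s rather than MathComp's [idealr]s because the latter are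
   proper by definition, whereas a filtration starts with I_0 = A.  Similarly,
   quotients and localizations are [comPzRingType]s, i.e. possibly zero. *)

Section Ideals.
Variable A : comPzRingType.
Implicit Types (I J K S : set A) (x : A).

Definition is_ideal I :=
  [/\ I 0, (forall x y, I x -> I y -> I (x + y)) &
      (forall a x, I x -> I (a * x))].

Definition ideal_gen S : set A := smallest is_ideal S.

Definition ideal_add I J : set A := [set x + y | x in I & y in J].

Definition ideal_mul I J : set A := ideal_gen [set x * y | x in I & y in J].

Definition ideal_pow I n : set A := iter n (ideal_mul I) setT.

Definition colon K S : set A := [set a | forall x, S x -> K (a * x)].

Definition saturation K I : set A := \bigcup_n colon K (ideal_pow I n).

Definition is_proper I := ~ I 1.

Definition is_prime P :=
  [/\ is_ideal P, is_proper P & forall x y, P (x * y) -> P x \/ P y].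

Definition is_maximal I :=
  [/\ is_ideal I, is_proper I &
      forall K, is_ideal K -> is_proper K -> I `<=` K -> K = I].

Definition is_local I := is_maximal I /\ forall K, is_maximal K -> K = I.

Definition noetherian :=
  forall I, is_ideal I -> exists s : seq A, I = ideal_gen [set` s].

Definition radical I : set A := [set x | exists n, I (x ^+ n)].

Definition is_primary I :=
  [/\ is_ideal I, is_proper I & forall x y, I (x * y) -> I x \/ radical I y].

Definition primary_to I J := is_primary J /\ radical J = I.

(* [is_length I K k]: the A-module I / K has length k, for ideals K `<=` I.
   The submodules of I / K are the L / K with L an ideal and K `<=` L `<=` I. *)
Definition ideal_chain I K k :=
  exists L : nat -> set A,
    [/\ L 0%N = K, L k = I, (forall i, (i <= k)%N -> is_ideal (L i)) &
        forall i, (i < k)%N -> L i `<` L i.+1].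

Definition is_length I K k :=
  ideal_chain I K k /\ forall j, ideal_chain I K j -> (j <= k)%N.

Definition prime_chain k :=
  exists P : nat -> set A,
    (forall i, (i <= k)%N -> is_prime (P i)) /\
    (forall i, (i < k)%N -> P i `<` P i.+1).

Definition is_krull_dim d :=
  prime_chain d /\ forall j, prime_chain j -> (j <= d)%N.

End Ideals.

Arguments noetherian : clear implicits.
Arguments is_krull_dim : clear implicits.

(* Hilbert-Samuel multiplicity of a local ring (A, n): the length of A / n^k
   is a polynomial in k for large k, of degree d = dim A, with leading
   coefficient e / d!. *)
Definition is_multiplicity (A : comPzRingType) (e : nat) :=
  exists (n : set A) (d : nat) (P : {poly rat}),
    [/\ is_local n, is_krull_dim A d, size P = d.+1,
        (exists k0, forall k, (k0 <= k)%N ->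
           exists2 h, is_length setT (ideal_pow n k) h & P.[k%:R] = h%:R) &
        e%:R = (d`!)%:R * lead_coef P].

(* The quotient of A by the ideal generated by S; every set S is allowed, so
   that no proof that S is an ideal has to be carried around. *)
Section RingQuotient.
Variables (A : comPzRingType) (S : set A).

Lemma ideal_gen_is_ideal : is_ideal (ideal_gen S).
Proof.
split=> [K [[]//]|x y Sx Sy K|a x Sx K] [KI SK]; case: (KI) => _ KD KM.
  by apply: KD; [apply: Sx|apply: Sy].
by apply: KM; apply: Sx.
Qed.

Definition quot_equiv (x y : A) : bool := `[< ideal_gen S (x - y) >].

Fact quot_equiv_is_equiv : equiv_class_of quot_equiv.
Proof.
have [S0 SD SM] := ideal_gen_is_ideal.
have SN z : ideal_gen S z -> ideal_gen S (- z).
  by rewrite -[- z]mulN1r; apply: SM.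
split=> [x|x y|y x z]; first by apply/asboolP; rewrite subrr.
  by apply/asboolP/asboolP => /SN; rewrite opprB.
by move=> /asboolP xy /asboolP yz; apply/asboolP; rewrite -(subrKA y); apply: SD.
Qed.

Canonical quot_equiv_equiv := EquivRelPack quot_equiv_is_equiv.
Canonical quot_equiv_encModRel := defaultEncModRel quot_equiv.

Definition ring_quot := {eq_quot quot_equiv}.

HB.instance Definition _ : EqQuotient A quot_equiv ring_quot :=
  EqQuotient.on ring_quot.
HB.instance Definition _ := Choice.on ring_quot.

Lemma ring_quotP (x y : A) :
  \pi_ring_quot x = \pi_ring_quot y <-> ideal_gen S (x - y).
Proof. by split=> [/eqmodP/asboolP | Sxy]; last exact/eqmodP/asboolP. Qed.

Definition quot_zero : ring_quot := \pi_ring_quot 0.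
Definition quot_one : ring_quot := \pi_ring_quot 1.
Definition quot_opp (x : ring_quot) : ring_quot := \pi_ring_quot (- repr x).
Definition quot_add (x y : ring_quot) : ring_quot := \pi_ring_quot (repr x + repr y).
Definition quot_mul (x y : ring_quot) : ring_quot := \pi_ring_quot (repr x * repr y).

Lemma quot_pi_opp x : quot_opp (\pi x) = \pi_ring_quot (- x).
Proof.
have [_ _ SM] := ideal_gen_is_ideal.
apply/ring_quotP; rewrite -opprD -mulN1r; apply: SM.
by apply/ring_quotP; rewrite reprK.
Qed.

Lemma quot_pi_add x y : quot_add (\pi x) (\pi y) = \pi_ring_quot (x + y).
Proof.
have [_ SD _] := ideal_gen_is_ideal.
by apply/ring_quotP; rewrite opprD addrACA; apply: SD; apply/ring_quotP;
  rewrite reprK.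
Qed.

Lemma quot_pi_mul x y : quot_mul (\pi x) (\pi y) = \pi_ring_quot (x * y).
Proof.
have [_ SD SM] := ideal_gen_is_ideal.
apply/ring_quotP; set x' := repr _; set y' := repr _.
have -> : x' * y' - x * y = y' * (x' - x) + x * (y' - y).
  by rewrite !mulrBr [y' * x']mulrC [y' * x]mulrC addrA subrK.
by apply: SD; apply: SM; apply/ring_quotP; rewrite reprK.
Qed.

Fact quot_addA : associative quot_add.
Proof.
by elim/quotW=> x; elim/quotW=> y; elim/quotW=> z; rewrite !quot_pi_add addrA.
Qed.

Fact quot_addC : commutative quot_add.
Proof. by elim/quotW=> x; elim/quotW=> y; rewrite !quot_pi_add addrC. Qed.

Fact quot_add0 : left_id quot_zero quot_add.
Proof. by elim/quotW=> x; rewrite quot_pi_add add0r. Qed.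

Fact quot_addN : left_inverse quot_zero quot_opp quot_add.
Proof. by elim/quotW=> x; rewrite quot_pi_opp quot_pi_add addNr. Qed.

Fact quot_mulA : associative quot_mul.
Proof.
by elim/quotW=> x; elim/quotW=> y; elim/quotW=> z; rewrite !quot_pi_mul mulrA.
Qed.

Fact quot_mulC : commutative quot_mul.
Proof. by elim/quotW=> x; elim/quotW=> y; rewrite !quot_pi_mul mulrC. Qed.

Fact quot_mul1 : left_id quot_one quot_mul.
Proof. by elim/quotW=> x; rewrite quot_pi_mul mul1r. Qed.

Fact quot_mulD : left_distributive quot_mul quot_add.
Proof.
elim/quotW=> x; elim/quotW=> y; elim/quotW=> z.
by rewrite quot_pi_add !quot_pi_mul quot_pi_add mulrDl.
Qed.

HB.instance Definition _ := GRing.isZmodule.Build ring_quot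
  quot_addA quot_addC quot_add0 quot_addN.
HB.instance Definition _ := GRing.Zmodule_isComPzRing.Build ring_quot
  quot_mulA quot_mulC quot_mul1 quot_mulD.

End RingQuotient.

(* The ring of fractions of R whose denominators are the products of elements
   of S; for S the complement of a prime ideal p this is R_p. *)
Section Localization.
Variables (R : comPzRingType) (S : set R).

Definition is_mult_closed (T : set R) :=
  T 1 /\ forall x y, T x -> T y -> T (x * y).

Definition denominators : set R := smallest is_mult_closed S.

Fact denominators1 : denominators 1.
Proof. by move=> T [[]]. Qed.

Fact denominatorsM x y :
  denominators x -> denominators y -> denominators (x * y).
Proof. by move=> Dx Dy T [TM ST]; apply: TM.2; [apply: Dx|apply: Dy]. Qed.

Record pre_fraction := PreFraction {
  pre_frac : R * R;
  pre_fracP : `[< denominators pre_frac.2 >]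
}.

HB.instance Definition _ := [isSub for pre_frac].
HB.instance Definition _ := [Choice of pre_fraction by <:].

Definition num (x : pre_fraction) : R := (pre_frac x).1.
Definition den (x : pre_fraction) : R := (pre_frac x).2.

Fact denP x : denominators (den x).
Proof. exact/asboolP/pre_fracP. Qed.

Definition mk_frac a s (Ds : denominators s) : pre_fraction :=
  @PreFraction (a, s) (asboolT Ds).

Definition frac_rel (x y : pre_fraction) :=
  exists2 u, denominators u & u * (num x * den y) = u * (num y * den x).

Definition frac_equiv (x y : pre_fraction) : bool := `[< frac_rel x y >].

Fact frac_equiv_is_equiv : equiv_class_of frac_equiv.
Proof.
split=> [x|x y|y x z].
- by apply/asboolP; exists 1 => //; apply: denominators1.
- by apply/asboolP/asboolP => -[u Du e]; exists u.
- move=> /asboolP[u Du e] /asboolP[v Dv f]; apply/asboolP.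
  exists (u * v * den y).
    by do !apply: denominatorsM => //; apply: denP.
  transitivity (v * den z * (u * (num x * den y))); first by ring.
  rewrite e; transitivity (u * den x * (v * (num y * den z))); first by ring.
  by rewrite f; ring.
Qed.

Canonical frac_equiv_equiv := EquivRelPack frac_equiv_is_equiv.
Canonical frac_equiv_encModRel := defaultEncModRel frac_equiv.

Definition localization := {eq_quot frac_equiv}.

HB.instance Definition _ : EqQuotient pre_fraction frac_equiv localization :=
  EqQuotient.on localization.
HB.instance Definition _ := Choice.on localization.

Lemma localizationP (x y : pre_fraction) :
  \pi_localization x = \pi_localization y <-> frac_rel x y.
Proof. by split=> [/eqmodP/asboolP | xy]; last exact/eqmodP/asboolP. Qed.

Definition pre_zero := mk_frac 0 denominators1.
Definition pre_one := mk_frac 1 denominators1.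
Definition pre_opp x := mk_frac (- num x) (denP x).
Definition pre_add x y :=
  mk_frac (num x * den y + num y * den x) (denominatorsM (denP x) (denP y)).
Definition pre_mul x y :=
  mk_frac (num x * num y) (denominatorsM (denP x) (denP y)).

Definition loc_zero : localization := \pi_localization pre_zero.
Definition loc_one : localization := \pi_localization pre_one.
Definition loc_opp (x : localization) : localization :=
  \pi_localization (pre_opp (repr x)).
Definition loc_add (x y : localization) : localization :=
  \pi_localization (pre_add (repr x) (repr y)).
Definition loc_mul (x y : localization) : localization :=
  \pi_localization (pre_mul (repr x) (repr y)).

Fact repr_rel x : frac_rel (repr (\pi_localization x)) x.
Proof. by apply/localizationP; rewrite reprK. Qed.

Lemma loc_pi_opp x : loc_opp (\pi x) = \pi_localization (pre_opp x).
Proof.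
apply/localizationP; have [u Du e] := repr_rel x; exists u => //.
by rewrite /num /den /= !mulNr !mulrN e.
Qed.

Lemma loc_pi_add x y :
  loc_add (\pi x) (\pi y) = \pi_localization (pre_add x y).
Proof.
apply/localizationP; set x' := repr _; set y' := repr _.
have [u Du e] : frac_rel x' x := repr_rel x.
have [v Dv f] : frac_rel y' y := repr_rel y.
exists (u * v); first exact: denominatorsM.
rewrite /pre_add /mk_frac /num /den /= in e f *.
transitivity ((v * (pre_frac y).2 * (pre_frac y').2) *
              (u * ((pre_frac x').1 * (pre_frac x).2)) +
              (u * (pre_frac x).2 * (pre_frac x').2) *
              (v * ((pre_frac y').1 * (pre_frac y).2))); first by ring.
by rewrite e f; ring.
Qed.

Lemma loc_pi_mul x y :
  loc_mul (\pi x) (\pi y) = \pi_localization (pre_mul x y).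
Proof.
apply/localizationP; set x' := repr _; set y' := repr _.
have [u Du e] : frac_rel x' x := repr_rel x.
have [v Dv f] : frac_rel y' y := repr_rel y.
exists (u * v); first exact: denominatorsM.
rewrite /pre_mul /mk_frac /num /den /= in e f *.
transitivity ((u * ((pre_frac x').1 * (pre_frac x).2)) *
              (v * ((pre_frac y').1 * (pre_frac y).2))); first by ring.
by rewrite e f; ring.
Qed.

Fact eq_frac x y : num x * den y = num y * den x ->
  \pi_localization x = \pi_localization y.
Proof.
by move=> e; apply/localizationP; exists 1; [apply: denominators1|rewrite e].
Qed.

Fact loc_addA : associative loc_add.
Proof.
elim/quotW=> x; elim/quotW=> y; elim/quotW=> z; rewrite !loc_pi_add.
by apply: eq_frac; rewrite /pre_add /mk_frac /num /den /=; ring.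
Qed.

Fact loc_addC : commutative loc_add.
Proof.
elim/quotW=> x; elim/quotW=> y; rewrite !loc_pi_add.
by apply: eq_frac; rewrite /pre_add /mk_frac /num /den /=; ring.
Qed.

Fact loc_add0 : left_id loc_zero loc_add.
Proof.
elim/quotW=> x; rewrite loc_pi_add.
by apply: eq_frac; rewrite /pre_add /mk_frac /num /den /=; ring.
Qed.

Fact loc_addN : left_inverse loc_zero loc_opp loc_add.
Proof.
elim/quotW=> x; rewrite loc_pi_opp loc_pi_add.
by apply: eq_frac; rewrite /pre_add /pre_opp /mk_frac /num /den /=; ring.
Qed.

Fact loc_mulA : associative loc_mul.
Proof.
elim/quotW=> x; elim/quotW=> y; elim/quotW=> z; rewrite !loc_pi_mul.
by apply: eq_frac; rewrite /pre_mul /mk_frac /num /den /=; ring.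
Qed.

Fact loc_mulC : commutative loc_mul.
Proof.
elim/quotW=> x; elim/quotW=> y; rewrite !loc_pi_mul.
by apply: eq_frac; rewrite /pre_mul /mk_frac /num /den /=; ring.
Qed.

Fact loc_mul1 : left_id loc_one loc_mul.
Proof.
elim/quotW=> x; rewrite loc_pi_mul.
by apply: eq_frac; rewrite /pre_mul /mk_frac /num /den /=; ring.
Qed.

Fact loc_mulD : left_distributive loc_mul loc_add.
Proof.
elim/quotW=> x; elim/quotW=> y; elim/quotW=> z.
rewrite loc_pi_add !loc_pi_mul loc_pi_add.
by apply: eq_frac; rewrite /pre_add /pre_mul /mk_frac /num /den /=; ring.
Qed.

HB.instance Definition _ := GRing.isZmodule.Build localization
  loc_addA loc_addC loc_add0 loc_addN.
HB.instance Definition _ := GRing.Zmodule_isComPzRing.Build localization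
  loc_mulA loc_mulC loc_mul1 loc_mulD.

End Localization.

(* The extension I (A / K) of an ideal I of A. *)
Definition quot_set (A : comPzRingType) (K I : set A) : set (ring_quot K) :=
  [set \pi_(ring_quot K) a | a in I].
Arguments quot_set {A} K I.

Section Filtrations.
Variable A : comPzRingType.
Implicit Types (F : nat -> set A) (I K : set A) (x : A).

Definition is_filtration F :=
  [/\ forall n, is_ideal (F n), F 0%N = setT, is_proper (F 1%N),
      forall n, F n.+1 `<=` F n &
      forall n m, ideal_mul (F n) (F m) `<=` F (n + m)%N].

Definition is_good_for I F :=
  [/\ is_ideal I, forall n, ideal_mul I (F n) `<=` F n.+1 &
      exists n0, forall n, (n0 <= n)%N -> F n.+1 = ideal_mul I (F n)].

Definition is_good F := is_filtration F /\ exists I, is_good_for I F.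

Definition is_nilpotent F :=
  exists n0, forall n, (n0 <= n)%N -> F n = [set 0].

(* The reduction number of F with respect to a reduction I: the least r from
   which on I F_n = F_{n+1}.  For the filtrations considered here a single
   equality I F_n = F_{n+1} does not imply the next one; in k[[s^2,s^3]], take
   I = F_1 = (s^2) and F_n = (s^{2n}, s^{2n+1}) for n >= 2. *)
Definition stable_from I F r :=
  forall n, (r <= n)%N -> ideal_mul I (F n) = F n.+1.

Definition reduction_number I F : nat :=
  xget 0%N [set r | stable_from I F r /\
                    forall s, stable_from I F s -> (r <= s)%N].

Definition FC1 I F x :=
  exists n0, forall n, (n0 <= n)%N -> forall m,
    ideal_mul (ideal_pow I m) (F n.+1) `&` ideal_gen [set x] =
    ideal_mul (ideal_pow I m) (ideal_mul (ideal_gen [set x]) (F n)).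

Definition FC2 F x := colon [set 0] [set x] `<=` saturation [set 0] (F 1%N).

Definition weak_FC_element I F x :=
  [/\ is_good F, ~ is_nilpotent F, F 1%N x, FC1 I F x & FC2 F x].

End Filtrations.

Definition weak_FC_sequence (A : comPzRingType) (I : set A) (F : nat -> set A)
    (xs : seq A) :=
  (forall x, x \in xs -> F 1%N x) /\
  forall i, (i < size xs)%N ->
    let K := [set` take i xs] in
    weak_FC_element (quot_set K I) (fun n => quot_set K (F n))
                    (\pi_(ring_quot K) xs`_i).

Record filtration (A : comPzRingType) := Filtration {
  filt :> nat -> set A;
  filtP : is_filtration filt
}.

(* The Rees algebra, as the subring of A[t] of the polynomials whose
   coefficient in degree n lies in F_n. *)
Section FiberCone.
Variables (A : comNzRingType) (F : filtration A).

Definition rees_pred : {pred {poly A}} := fun p => `[< forall n, F n p`_n >].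

Fact rees_subring_closed : subring_closed rees_pred.
Proof.
have [FI F0 _ _ FM] := filtP F.
have F1 : 1 \in rees_pred.
  apply/asboolP => n; rewrite coef1; case: n => [|n]; first by rewrite F0.
  by case: (FI n.+1).
split=> // p q /asboolP Fp /asboolP Fq; apply/asboolP => n.
  have [_ FD FZ] := FI n; rewrite coefB; apply: (FD) => //.
  by rewrite -mulN1r; apply: FZ.
rewrite coefM; have [F0n FD _] := FI n; apply: big_ind => // i _.
rewrite -{1}(subnKC (ltn_ord i : i <= n)%N); apply: FM => K [_ sK]; apply: sK.
by exists p`_i => //; exists q`_(n - i).
Qed.

Record rees := Rees { rees_poly : {poly A}; _ : rees_poly \in rees_pred }.

HB.instance Definition _ := [isSub for rees_poly].
HB.instance Definition _ := [Choice of rees by <:].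
HB.instance Definition _ :=
  GRing.SubChoice_isSubComNzRing.Build {poly A} rees_pred rees
    rees_subring_closed.

(* The direct sum of the F_n / J F_n, as a quotient of the Rees algebra; the
   set on the right is already an ideal. *)
Definition fiber_cone (J : set A) :=
  ring_quot [set p : rees | forall n, ideal_mul J (F n) (rees_poly p)`_n].

(* The image in the fiber cone of the ideal m + F_1 t + F_2 t^2 + ... *)
Definition fiber_cone_max (m J : set A) : set (fiber_cone J) :=
  [set \pi_(fiber_cone J) p | p in [set p : rees | m (rees_poly p)`_0]].

Definition fiber_cone_local (m J : set A) :=
  localization (~` @fiber_cone_max m J).

Definition is_analytic_spread (m : set A) (l : nat) :=
  is_krull_dim (fiber_cone m) l.

Definition is_fiber_cone_multiplicity (m J : set A) (e : nat) :=
  is_multiplicity (fiber_cone_local m J) e.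

End FiberCone.

(* Main.v *)
(* Put K_i = (x_1, .., x_i).  The conditions (FC1) and (FC2), together with
   Artin-Rees, say that in large degrees multiplication by x_(i+1) embeds the
   fiber cone of F / K_i into itself with cokernel the fiber cone of F / K_(i+1).
   Hence the Hilbert function H_(i+1) of the latter is the difference of H_i, and
   x_(i+1) t lies in no minimal prime that fails to contain the irrelevant ideal,
   so that every step lowers the dimension.  Since l(F) = l, after l steps the
   fiber cone has finite length, and Nakayama's lemma shows that (x_1, .., x_l) is
   a reduction of F; as F / K_(l-1) is not nilpotent, it cannot happen earlier,
   and the local fiber cone has dimension exactly l.  Summing up, H_(l-1) is
   eventually a constant e > 0, and H_0 is eventually a polynomial of degree l-1
   and leading coefficient e / (l-1)!.  The Hilbert-Samuel function of the local
   fiber cone is eventually a polynomial, squeezed between shifts of the sums of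
   H_0, so that e is the multiplicity.  Finally, modulo Q : I_1^oo the element x_l
   is a nonzerodivisor and maps F_n onto F_(n+1) for n >= r, hence the length in
   the statement does not depend on n >= r; for large n it is H_(l-1)(n) = e. *)

(* Once the (FC)-conditions are pulled back to A, no quotient filtration and no module is formed.
   The fiber cone of F / K_i is represented by pairs of ideals of A, degree by degree, and by one
   ideal of the Rees algebra, so that all these cones and their primes are compared inside a fixed
   ring; an isomorphism of modules becomes an isomorphism of intervals of ideals. Quotient and
   localization return only at the end. Two mismatches shape the argument. The analytic spread is
   the dimension of the whole ring F_m(F), whereas the multiplicity belongs to a localization of
   F_J(F). Only the upper bound on chains of primes is carried over; the lower bound comes from the
   sequence, since with shorter chains only, F would be nilpotent modulo K_(l-1). The second
   mismatch is between degrees and powers of the maximal ideal. Squeezing determines the degree and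
   the leading coefficient of a polynomial, but cannot show that the Hilbert-Samuel function is one;
   this is why the Hilbert-Serre theorem is proved, and with it Hilbert's basis theorem, which makes
   the Rees algebra Noetherian. *)
Require Import Defs.
From mathcomp Require Import all_boot all_order all_algebra.
From mathcomp Require Import boolp classical_sets functions cardinality.
From mathcomp Require Import ring zify.

Set Implicit Arguments.
Unset Strict Implicit.
Unset Printing Implicit Defensive.

Import Order.TTheory GRing.Theory Num.Theory.
Local Open Scope ring_scope.
Local Open Scope quotient_scope.
Local Open Scope classical_set_scope.

(** * Ideals *)

Section IdealArithmetic.
Variable A : comPzRingType.
Implicit Types (I J K L S T : set A) (x y a b : A) (s : seq A).

Lemma ideal0 I : is_ideal I -> I 0. Proof. by case. Qed.

Lemma idealD I x y : is_ideal I -> I x -> I y -> I (x + y).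
Proof. by case=> _ ID _; apply: ID. Qed.

Lemma idealM I a x : is_ideal I -> I x -> I (a * x).
Proof. by case=> _ _; apply. Qed.

Lemma idealMr I a x : is_ideal I -> I x -> I (x * a).
Proof. by rewrite mulrC; apply: idealM. Qed.

Lemma idealN I x : is_ideal I -> I x -> I (- x).
Proof. by move=> II Ix; rewrite -mulN1r; apply: idealM. Qed.

Lemma idealB I x y : is_ideal I -> I x -> I y -> I (x - y).
Proof. by move=> II Ix Iy; apply: idealD => //; apply: idealN. Qed.

Lemma idealBC I x y : is_ideal I -> I (x - y) -> I (y - x).
Proof. by move=> II /(idealN II); rewrite opprB. Qed.

Lemma idealBr I x y : is_ideal I -> I (x - y) -> I y -> I x.
Proof. by move=> II Ixy Iy; rewrite -(subrK y x); apply: idealD. Qed.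

Lemma ideal_sum I (T : Type) (r : seq T) (P : pred T) (f : T -> A) :
  is_ideal I -> (forall i, P i -> I (f i)) -> I (\sum_(i <- r | P i) f i).
Proof.
by move=> II If; apply: big_ind => // [|x y]; [apply: ideal0|apply: idealD].
Qed.

Lemma idealT : is_ideal [set: A]. Proof. by []. Qed.

Lemma ideal1 I : is_ideal I -> I 1 -> I = setT.
Proof.
by move=> II I1; apply/seteqP; split=> // x _; rewrite -[x]mulr1; apply: idealM.
Qed.

Lemma idealI I J : is_ideal I -> is_ideal J -> is_ideal (I `&` J).
Proof.
move=> II IJ; split=> [|x y [? ?] [? ?]|a x [? ?]].
- by split; apply: ideal0.
- by split; apply: idealD.
- by split; apply: idealM.
Qed.

Lemma ideal_gen_sub S K : is_ideal K -> S `<=` K -> ideal_gen S `<=` K.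
Proof. exact: smallest_sub. Qed.

Lemma sub_ideal_gen S : S `<=` ideal_gen S.
Proof. exact: sub_gen_smallest. Qed.

Lemma ideal_gen_id I : is_ideal I -> ideal_gen I = I.
Proof. exact: smallest_id. Qed.

Lemma ideal_genS S T : S `<=` T -> ideal_gen S `<=` ideal_gen T.
Proof.
move=> ST; apply: ideal_gen_sub; first exact: ideal_gen_is_ideal.
exact: subset_trans ST (@sub_ideal_gen _).
Qed.

Lemma ideal_gen_nil : ideal_gen [set` [::]] = [set (0 : A)].
Proof.
apply/seteqP; split; last first.
  by move=> _ ->; apply: ideal0; apply: ideal_gen_is_ideal.
apply: ideal_gen_sub => // ; split=> // [x y -> ->|a x ->];
  by rewrite ?addr0 ?mulr0.
Qed.

Lemma ideal_colon K S : is_ideal K -> is_ideal (colon K S).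
Proof.
move=> IK; split=> [z _|x y Kx Ky z Sz|a x Kx z Sz].
- by rewrite mul0r; apply: ideal0.
- by rewrite mulrDl; apply: idealD; [|exact: Kx|exact: Ky].
- by rewrite -mulrA; apply: idealM => //; apply: Kx.
Qed.

Lemma ideal_pre K x : is_ideal K -> is_ideal [set a | K (x * a)].
Proof.
move=> IK; split=> [|a b /= Ka Kb|a b /= Kb]; first by rewrite /= mulr0;
  apply: ideal0.
  by rewrite mulrDr; apply: idealD.
by rewrite mulrCA; apply: idealM.
Qed.

(** Multiplication by [x] pulls [K] back to an ideal, so membership has to be tested on generators
    only. *)
Lemma ideal_genM S K x a : is_ideal K -> (forall y, S y -> K (x * y)) ->
  ideal_gen S a -> K (x * a).
Proof. by move=> IK SK; apply: (ideal_gen_sub (ideal_pre x IK) SK). Qed.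

Lemma ideal_gen_seq1 x a : ideal_gen [set` [:: x]] a <-> exists b, a = b * x.
Proof.
split=> [|[b ->]]; last first.
  apply: (idealM _ (ideal_gen_is_ideal _)).
  by apply: sub_ideal_gen; rewrite /= inE.
move: a; change (ideal_gen [set` [:: x]] `<=` [set a | exists b, a = b * x]).
apply: ideal_gen_sub.
  split=> [|_ _ [b ->] [c ->]|c _ [b ->]]; first by exists 0; rewrite mul0r.
    by exists (b + c); rewrite mulrDl.
  by exists (c * b); rewrite mulrA.
by move=> y /=; rewrite inE => /eqP ->; exists 1; rewrite mul1r.
Qed.

Lemma ideal_gen1 x a : ideal_gen [set x] a <-> exists b, a = b * x.
Proof.
rewrite -ideal_gen_seq1; suff -> : [set` [:: x]] = [set x] by [].
by apply/seteqP; split=> y /=; rewrite inE => /eqP.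
Qed.

Lemma ideal_gen_cat s t a : ideal_gen [set` s ++ t] a ->
  exists2 b, ideal_gen [set` t] b & ideal_gen [set` s] (a - b).
Proof.
have Is := ideal_gen_is_ideal [set` s]; have It := ideal_gen_is_ideal [set` t].
move: a; change (ideal_gen [set` s ++ t] `<=`
  [set a | exists2 b, ideal_gen [set` t] b & ideal_gen [set` s] (a - b)]).
apply: ideal_gen_sub.
  split=> [|x y [b tb sb] [c tc sc]|z x [b tb sb]].
  - by exists 0; [exact: ideal0 It|rewrite subrr; apply: ideal0 Is].
  - by exists (b + c); [exact: idealD It tb tc|rewrite opprD addrACA;
      apply: (idealD Is)].
  - by exists (z * b); [exact: idealM _ It tb|rewrite -mulrBr;
      apply: (idealM _ Is)].
move=> y /=; rewrite mem_cat => /orP[sy|ty].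
  by exists 0; [exact: ideal0 It|rewrite subr0; apply: sub_ideal_gen].
by exists y; [exact: sub_ideal_gen|rewrite subrr; apply: ideal0 Is].
Qed.

Lemma ideal_gen_cons x s a : ideal_gen [set` x :: s] a ->
  exists b, ideal_gen [set` s] (a - b * x).
Proof.
rewrite -cat1s => /ideal_gen_cat[b sb /ideal_gen_seq1[c e]].
by exists c; rewrite -e subKr.
Qed.

Lemma ideal_gen_rcons x s a : ideal_gen [set` rcons s x] a ->
  exists b, ideal_gen [set` s] (a - b * x).
Proof.
by rewrite -cats1 => /ideal_gen_cat[b /ideal_gen_seq1[c ->]]; exists c.
Qed.

Lemma ideal_ideal_mul I J : is_ideal (ideal_mul I J).
Proof. exact: ideal_gen_is_ideal. Qed.

Lemma mem_ideal_mul I J x y : I x -> J y -> ideal_mul I J (x * y).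
Proof. by move=> Ix Jy; apply: sub_ideal_gen; exists x => //; exists y. Qed.

Lemma ideal_mul_sub I J K : is_ideal K ->
  (forall x y, I x -> J y -> K (x * y)) -> ideal_mul I J `<=` K.
Proof.
by move=> IK IJK; apply: ideal_gen_sub => // _ [x Ix [y Jy <-]]; apply: IJK.
Qed.

Lemma ideal_mulS I J K L : I `<=` J -> K `<=` L ->
  ideal_mul I K `<=` ideal_mul J L.
Proof.
move=> IJ KL; apply: ideal_mul_sub; first exact: ideal_ideal_mul.
by move=> x y /IJ Jx /KL; apply: mem_ideal_mul.
Qed.

Lemma ideal_mul_subr I J : is_ideal J -> ideal_mul I J `<=` J.
Proof. by move=> IJ; apply: ideal_mul_sub => // x y _; apply: idealM. Qed.

Lemma ideal_mul_subl I J : is_ideal I -> ideal_mul I J `<=` I.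
Proof. by move=> IJ; apply: ideal_mul_sub => // x y Ix _; apply: idealMr. Qed.

Lemma ideal_mulC I J : ideal_mul I J = ideal_mul J I.
Proof.
by apply/seteqP; split; apply: ideal_mul_sub => [|x y Ix Jy];
  rewrite 1?mulrC; (exact: ideal_ideal_mul || exact: mem_ideal_mul).
Qed.

Lemma ideal_mulA I J K :
  ideal_mul I (ideal_mul J K) = ideal_mul (ideal_mul I J) K.
Proof.
apply/seteqP; split; apply: ideal_mul_sub; try exact: ideal_ideal_mul.
  move=> x y Ix; apply: ideal_genM; first exact: ideal_ideal_mul.
  move=> _ [u Ju [v Kv <-]]; rewrite mulrA.
  by apply: mem_ideal_mul => //; apply: mem_ideal_mul.
move=> x y Ix Ky; rewrite mulrC; apply: ideal_genM Ix;
  first exact: ideal_ideal_mul.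
move=> _ [u Ju [v Kv <-]]; rewrite mulrC -mulrA.
by apply: mem_ideal_mul => //; apply: mem_ideal_mul.
Qed.

Lemma ideal_mulT I : is_ideal I -> ideal_mul setT I = I.
Proof.
move=> II; apply/seteqP; split; first exact: ideal_mul_subr.
by move=> x Ix; rewrite -[x]mul1r; apply: mem_ideal_mul.
Qed.

Lemma ideal_mulIT I : is_ideal I -> ideal_mul I setT = I.
Proof. by rewrite ideal_mulC; apply: ideal_mulT. Qed.

Lemma ideal_ideal_pow I n : is_ideal (ideal_pow I n).
Proof. by case: n => // n; apply: ideal_ideal_mul. Qed.

Lemma ideal_powS I n : ideal_pow I n.+1 = ideal_mul I (ideal_pow I n).
Proof. by []. Qed.

Lemma ideal_pow1 I : is_ideal I -> ideal_pow I 1 = I.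
Proof. exact: ideal_mulIT. Qed.

Lemma ideal_powD I m n :
  ideal_pow I (m + n) = ideal_mul (ideal_pow I m) (ideal_pow I n).
Proof.
elim: m => [|m IHm]; first by rewrite ideal_mulT//; apply: ideal_ideal_pow.
by rewrite addSn !ideal_powS IHm ideal_mulA.
Qed.

Lemma ideal_pow_decr I m n : (m <= n)%N -> ideal_pow I n `<=` ideal_pow I m.
Proof.
move=> /subnK <-; rewrite ideal_powD.
by apply: ideal_mul_subr; apply: ideal_ideal_pow.
Qed.

Lemma mem_ideal_pow I x n : I x -> ideal_pow I n (x ^+ n).
Proof. by move=> Ix; elim: n => // n IHn; rewrite exprS ideal_powS;
  apply: mem_ideal_mul. Qed.

Lemma ideal_powSl I J n : I `<=` J -> ideal_pow I n `<=` ideal_pow J n.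
Proof. by move=> IJ; elim: n => // n IHn; apply: ideal_mulS. Qed.

Lemma ideal_ideal_add I J : is_ideal I -> is_ideal J ->
  is_ideal (ideal_add I J).
Proof.
move=> II IJ; split=> [|_ _ [x Ix [y Jy <-]] [u Iu [v Jv <-]]|a _ [x Ix [y Jy
  <-]]].
- by exists 0; [exact: ideal0|exists 0; [exact: ideal0|rewrite addr0]].
- exists (x + u); first exact: idealD.
  by exists (y + v); [exact: idealD|rewrite addrACA].
- exists (a * x); first exact: idealM.
  by exists (a * y); [exact: idealM|rewrite mulrDr].
Qed.

Lemma sub_ideal_addl I J : is_ideal J -> I `<=` ideal_add I J.
Proof. by move=> IJ x Ix; exists x => //; exists 0;
  [exact: ideal0|rewrite addr0]. Qed.

Lemma sub_ideal_addr I J : is_ideal I -> J `<=` ideal_add I J.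
Proof. by move=> II x Jx; exists 0; [exact: ideal0|exists x; rewrite ?add0r].
  Qed.

Lemma ideal_add_sub I J K : is_ideal K -> I `<=` K -> J `<=` K ->
  ideal_add I J `<=` K.
Proof.
by move=> IK IsK JsK _ [x Ix [y Jy <-]]; apply: idealD => //;
  [exact: IsK|exact: JsK].
Qed.

Lemma ideal_addS I J K L : I `<=` J -> K `<=` L ->
  ideal_add I K `<=` ideal_add J L.
Proof.
move=> IJ KL _ [x Ix [y Ky <-]]; exists x; first exact: IJ.
by exists y => //; apply: KL.
Qed.

Lemma ideal_addC I J : ideal_add I J = ideal_add J I.
Proof.
by apply/seteqP; split=> _ [x Ix [y Jy <-]]; exists y => //; exists x;
  rewrite // addrC.
Qed.

Lemma ideal_add_mod I J x y : I x -> J (y - x) -> ideal_add I J y.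
Proof. by move=> Ix Jyx; exists x => //; exists (y - x) => //;
  rewrite addrC subrK. Qed.

Lemma ideal_image_scale x I : is_ideal I -> is_ideal [set x * a | a in I].
Proof.
move=> II; split=> [|_ _ [a Ia <-] [b Ib <-]|b _ [a Ia <-]].
- by exists 0; [exact: ideal0|rewrite mulr0].
- by exists (a + b); [exact: idealD|rewrite mulrDr].
- by exists (b * a); [exact: idealM|rewrite mulrCA].
Qed.

Lemma ideal_scale x I K : is_ideal I -> is_ideal K ->
  is_ideal (ideal_add [set x * a | a in I] K).
Proof. by move=> II IK; apply: ideal_ideal_add => //; apply: ideal_image_scale.
  Qed.

Lemma ideal_saturation K I : is_ideal K -> is_ideal (saturation K I).
Proof.
move=> IK; have IC n : is_ideal (colon K (ideal_pow I n)) by apply: ideal_colon.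
split=> [|x y [n _ Kx] [k _ Ky]|a x [n _ Kx]].
- by exists 0%N => //; apply: (ideal0 (IC _)).
- exists (n + k)%N => //; apply: (idealD (IC _)).
    by move=> z Iz; apply: Kx; apply: ideal_pow_decr Iz; apply: leq_addr.
  by move=> z Iz; apply: Ky; apply: ideal_pow_decr Iz; apply: leq_addl.
- by exists n => //; apply: (idealM _ (IC _)).
Qed.

Lemma sub_saturation K I : is_ideal K -> K `<=` saturation K I.
Proof. by move=> IK x Kx; exists 0%N => // y _; apply: idealMr. Qed.

End IdealArithmetic.

(** * Noetherian and local rings *)

Section Noetherian.
Variable A : comPzRingType.
Implicit Types (I J K D : set A) (x y a b : A) (s : seq A).

Lemma chain_monotone (I : nat -> set A) :
  (forall n, I n `<=` I n.+1) -> forall m n, (m <= n)%N -> I m `<=` I n.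
Proof.
move=> IS m n /subnK <-; elim: (n - m)%N => // k IHk.
exact: subset_trans IHk (IS _).
Qed.

Lemma strict_chain_sub (P : nat -> set A) k :
  (forall i, (i < k)%N -> P i `<` P i.+1) ->
  forall i j, (i <= j)%N -> (j <= k)%N -> P i `<=` P j.
Proof.
move=> PS i j /subnKC <-; elim: (j - i)%N => [|d IHd].
  by rewrite addn0 => _; apply: subset_refl.
rewrite addnS => dk; apply: subset_trans (IHd (ltnW dk)) _.
by have [] := PS _ dk.
Qed.

(** For an ideal [K] inside a maximal ideal [L] these are the chains of primes of the localization
    at [L] of the quotient by [K], described without leaving the ambient ring. *)
Definition prime_chain_between (K L : set A) k := exists P : nat -> set A,
  [/\ forall i, (i <= k)%N -> is_prime (P i),
      forall i, (i < k)%N -> P i `<` P i.+1, K `<=` P 0%N & P k `<=` L].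

Lemma ideal_bigcup (I : nat -> set A) :
  (forall n, is_ideal (I n)) -> (forall n, I n `<=` I n.+1) ->
  is_ideal (\bigcup_n I n).
Proof.
move=> II /chain_monotone IS; split=> [|x y [m _ Ix] [n _ Iy]|a x [m _ Ix]].
- by exists 0%N => //; apply: (ideal0 (II _)).
- exists (maxn m n) => //; apply: (idealD (II _)).
    by apply: IS Ix; apply: leq_maxl.
  by apply: IS Iy; apply: leq_maxr.
- by exists m => //; apply: (idealM _ (II _)).
Qed.

Lemma seq_bounded (T : eqType) (P : T -> nat -> Prop) (s : seq T) :
  (forall (x : T) m n, (m <= n)%N -> P x m -> P x n) ->
  (forall x : T, x \in s -> exists n, P x n) ->
  exists n, forall x : T, x \in s -> P x n.
Proof.
move=> Pmono; elim: s => [_|x s IHs Ps]; first by exists 0%N.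
have [n Pn] : exists n, forall y : T, y \in s -> P y n.
  by apply: IHs => y ys; apply: Ps; rewrite inE ys orbT.
have [m Pm] := Ps x (mem_head x s); exists (maxn m n) => y.
rewrite inE => /predU1P[->|/Pn Py]; first exact: Pmono (leq_maxl m n) Pm.
exact: Pmono (leq_maxr m n) Py.
Qed.

Lemma noetherian_acc (I : nat -> set A) : noetherian A ->
  (forall n, is_ideal (I n)) -> (forall n, I n `<=` I n.+1) ->
  exists n0, forall n, I n `<=` I n0.
Proof.
move=> NA II IS; have [s Es] := NA _ (ideal_bigcup II IS).
have [n0 Hn0] : exists n, forall x, x \in s -> I n x.
  apply: (seq_bounded (P := fun x n => I n x)).
    by move=> x m n mn; apply: chain_monotone.
  move=> x xs; have [n _ Inx] : (\bigcup_n I n) x; last by exists n.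
  by rewrite Es; apply: sub_ideal_gen.
exists n0 => n x Ix; have : ideal_gen [set` s] x by rewrite -Es; exists n.
by apply: (ideal_gen_sub (II n0)).
Qed.

Lemma ideal_pow_cons_sub x s n :
  ideal_pow (ideal_gen [set` x :: s]) n `<=`
  ideal_add (ideal_pow (ideal_gen [set` s]) n) (ideal_gen [set x]).
Proof.
have Ig := ideal_gen_is_ideal [set x]; have Is := ideal_gen_is_ideal [set` s].
elim: n => [|n IHn]; first exact: sub_ideal_addl.
have Ia k : is_ideal (ideal_add (ideal_pow (ideal_gen [set` s]) k) (ideal_gen
  [set x])).
  by apply: ideal_ideal_add => //; apply: ideal_ideal_pow.
rewrite ideal_powS; apply: ideal_mul_sub => // y z.
move=> /ideal_gen_cons[b sb] /IHn[u su [v gv <-]].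
apply: (@ideal_add_mod _ _ _ ((y - b * x) * u)).
  by rewrite ideal_powS; apply: mem_ideal_mul.
have -> : y * (u + v) - (y - b * x) * u = y * v + (u * b) * x by ring.
by apply: (idealD Ig); apply: (idealM _ Ig) => //; apply: sub_ideal_gen.
Qed.

(** Induction on the generators and, for the first one [x], on the exponent that brings it into [D].
    The ideal [D] varies in the inner induction: passing to its colon ideal by [x] lowers the
    exponent by one and keeps the other generators in the radical. *)
Lemma ideal_pow_sub_radical I D : noetherian A -> is_ideal I -> is_ideal D ->
  I `<=` radical D -> exists n, ideal_pow I n `<=` D.
Proof.
move=> NA /NA[s ->] ID sD.
have {sD} : forall x, x \in s -> radical D x.
  by move=> x xs; apply: sD; apply: sub_ideal_gen.
elim: s D ID => [|x s IHs] D ID sD.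
  exists 1%N; rewrite ideal_gen_nil ideal_pow1 => [_ ->|]; first exact: ideal0.
  by rewrite -ideal_gen_nil; apply: ideal_gen_is_ideal.
have [k] := sD x (mem_head x s); elim: k D ID sD => [|k IHk] D ID sD Dx.
  by exists 0%N; rewrite (ideal1 ID).
have IC := ideal_colon [set x] ID.
have DC : D `<=` colon D [set x] by move=> y Dy _ ->; apply: idealMr.
have [||n1 Hn1] := IHk _ IC.
- by move=> y /sD[j Dy]; exists j; apply: DC.
- by move=> _ ->; rewrite -exprSr.
have [|n2 Hn2] := IHs _ ID.
  by move=> y ys; apply: sD; rewrite inE ys orbT.
exists (n1 + n2)%N; rewrite ideal_powD; apply: ideal_mul_sub => // y z Iy.
move=> /ideal_pow_cons_sub[u /Hn2 Du [_ /ideal_gen1[c ->] <-]].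
rewrite mulrDr; apply: idealD => //; first exact: idealM.
by rewrite mulrCA; apply: idealM => //; apply: (Hn1 y Iy).
Qed.

Lemma ideal_radical D : is_ideal D -> is_ideal (radical D).
Proof.
move=> ID; split=> [|x y [m Dx] [n Dy]|a x [m Dx]].
- by exists 1%N; rewrite expr1; apply: ideal0.
- exists (m + n)%N; rewrite exprDn; apply: ideal_sum => // -[i im] _ /=.
  rewrite -mulr_natr; apply: idealMr => //.
  have [ni|ni] := leqP n i; first by rewrite -(subnK ni) exprD mulrA;
    apply: idealM.
  apply: idealMr => //; rewrite -addnBA 1?ltnW // exprD; exact: idealMr.
- by exists m; rewrite exprMn; apply: idealM.
Qed.

Lemma prime_exp P x n : is_prime P -> P (x ^+ n) -> P x.
Proof.
move=> [IP P1 PM]; elim: n => [/P1//|n IHn].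
by rewrite exprS => /PM[|/IHn].
Qed.

(** The set [T] is arbitrary: when it consists of 1 alone, [P] is a maximal ideal, and when it is
    multiplicatively closed, [P] is prime. *)
Lemma ideal_avoiding (D T : set A) : is_ideal D -> D `&` T = set0 ->
  exists P, [/\ is_ideal P, D `<=` P, P `&` T = set0 &
    forall K, is_ideal K -> P `<=` K -> K `&` T = set0 -> K = P].
Proof.
move=> ID DT.
pose Z := [set X : set A | X = set0 \/ [/\ is_ideal X, D `<=` X & X `&` T =
  set0]].
(* [set0] belongs to [Z] only because [Zorn_bigcup] includes the empty chain. *)
have ZD : Z D by apply: or_intror; split.
have [C CZ totC|P [ZP maxP]] := @Zorn_bigcup _ Z.
  case: (pselect (exists X, C X /\ X <> set0)) => [[X0 [CX0 X0n]]|noX];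
    last first.
    left; apply/seteqP; split=> // x [X CX Xx]; case: noX.
    by exists X; split=> // Xe; rewrite Xe in Xx.
  have CI X x : C X -> X x -> is_ideal X.
    by move=> /CZ[->|[]].
  have [Xe|[IX0 DX0 _]] := CZ _ CX0; first by [].
  right; split.
  - split=> [|x y [X CX Xx] [Y CY Yy]|a x [X CX Xx]].
    + by exists X0 => //; apply: (ideal0 IX0).
    + have [XY|YX] := totC _ _ CX CY; [exists Y => //|exists X => //].
        by apply: (idealD (CI _ _ CY Yy)) => //; apply: XY.
      by apply: (idealD (CI _ _ CX Xx)) => //; apply: YX.
    + by exists X => //; apply: (idealM _ (CI _ _ CX Xx)).
  - by move=> x Dx; exists X0 => //; apply: DX0.
  - apply/seteqP; split=> // x [[X CX Xx] Tx].
    case: (CZ _ CX) => [Xe|[_ _ XT]]; first by rewrite Xe in Xx.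
    by rewrite -XT; split.
have [Pe|[IP DP PT]] := ZP.
  case: (maxP D) => //; rewrite Pe; split => //.
  by move=> /(_ 0 (ideal0 ID)).
exists P; split=> // K IK PK KT; apply: contrapT => KP.
apply: (maxP K); last by right; split=> //; apply: subset_trans PK.
by split=> // KsP; apply: KP; apply/seteqP.
Qed.

Lemma prime_avoiding (D T : set A) : is_ideal D -> is_mult_closed T ->
  D `&` T = set0 -> exists P, [/\ is_prime P, D `<=` P & P `&` T = set0].
Proof.
move=> ID [T1 TM] DT; have [P [IP DP PT maxP]] := ideal_avoiding ID DT.
exists P; split=> //; split=> // [P1|x y Pxy].
  by have : (P `&` T) 1 by []; rewrite PT.
apply: contrapT => /not_orP[nPx nPy].
(* By maximality, [P] and an element outside it generate an ideal that meets [T]. *)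
have key z : ~ P z -> exists p c, T (p + c * z) /\ P p.
  move=> nPz; apply: contrapT => no.
  have IK : is_ideal (ideal_add P (ideal_gen [set z])).
    by apply: ideal_ideal_add => //; apply: ideal_gen_is_ideal.
  apply: nPz; rewrite -(maxP _ IK).
  - by apply: sub_ideal_addr => //; apply: sub_ideal_gen.
  - by apply: sub_ideal_addl; apply: ideal_gen_is_ideal.
  - apply/seteqP; split=> // _ [[p Pp [_ /ideal_gen1[c ->] <-]] Tpc].
    by case: no; exists p, c.
have [p [c [Tpc Pp]]] := key x nPx; have [q [d [Tqd Pq]]] := key y nPy.
suff : (P `&` T) ((p + c * x) * (q + d * y)) by rewrite PT.
split; last exact: TM.
have -> : (p + c * x) * (q + d * y) = (q + d * y) * p + (c * x) * q + (c * d) *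
  (x * y).
  by ring.
by do 2?[apply: idealD => //]; apply: idealM.
Qed.

End Noetherian.

Section Local.
Variables (A : comPzRingType) (m : set A).
Hypothesis mloc : is_local m.

Lemma local_ideal : is_ideal m. Proof. by case: mloc => -[]. Qed.

Lemma maximal_inv (n : set A) x : is_maximal n -> ~ n x ->
  exists y, n (1 - y * x).
Proof.
move=> [In n1 maxn] nx; have Ix := ideal_gen_is_ideal [set x].
have IK := ideal_ideal_add In Ix.
have [[u nu [_ /ideal_gen1[y ->] e]]|K1] :=
    pselect (ideal_add n (ideal_gen [set x]) 1).
  by exists y; rewrite -e addrK.
case: nx; rewrite -(maxn _ IK K1) //; last exact: sub_ideal_addl.
by apply: sub_ideal_addr => //; apply: sub_ideal_gen.
Qed.

Lemma local_unit x : ~ m x -> exists y, y * x = 1.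
Proof.
move=> mx; apply: contrapT => nox; have Ix := ideal_gen_is_ideal [set x].
have Dx : ideal_gen [set x] `&` [set 1] = set0.
  by apply/seteqP; split=> // _ [/ideal_gen1[y ->] /= e]; apply: nox; exists y.
have [P [IP DP PT maxP]] := ideal_avoiding Ix Dx.
case: mloc => _ /(_ P) mP; apply: mx; rewrite -mP; first by apply: DP;
  apply: sub_ideal_gen.
split=> // [P1|K IK K1 PK]; first by have : (P `&` [set 1]) 1 by []; rewrite PT.
by apply: maxP => //; apply/seteqP; split=> // y [Ky /= yE]; apply: K1;
  rewrite -yE.
Qed.

Lemma maximal_prime (n : set A) : is_maximal n -> is_prime n.
Proof.
move=> Mn; have [In n1 _] := Mn; split=> // x y nxy.
apply: contrapT => /not_orP[nx ny].
have [z nz] := maximal_inv Mn nx; apply: ny;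
  rewrite -[y]mul1r -(subrK (z * x) 1).
by rewrite mulrDl; apply: (idealD In); [apply: idealMr|rewrite -mulrA;
  apply: idealM].
Qed.

(** The generators of [N] are discarded one at a time. Modulo [K] and the remaining ones, the first
    generator [g] satisfies g = b g with [b] in [m], and 1 - b is a unit. *)
Lemma nakayama (N K : set A) : noetherian A -> is_ideal N -> is_ideal K ->
  N `<=` ideal_add (ideal_mul m N) K -> N `<=` K.
Proof.
move=> NA IN IK NmN; have [s Es] := NA _ IN; have Im := local_ideal.
suff H (s1 : seq A) : {subset s1 <= s} ->
  N `<=` ideal_add (ideal_gen [set` s1]) K -> N `<=` K.
  by refine (H s _ _) => //; rewrite {1}Es; apply: sub_ideal_addl.
elim: s1 => [_|g s1 IHs ss] Ns.
  by move=> x /Ns[y]; rewrite ideal_gen_nil => -> [z Kz <-]; rewrite add0r.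
have Is1 := ideal_gen_is_ideal [set` s1].
have Ia := ideal_ideal_add Is1 IK.
apply: IHs => [x xs|]; first by apply: ss; rewrite inE xs orbT.
have Ng : N g by rewrite Es; apply: sub_ideal_gen; apply: ss; apply: mem_head.
have key : exists2 b, m b & ideal_add (ideal_gen [set` s1]) K (g - b * g).
  have [y mNy [z Kz eg]] := NmN _ Ng.
  have : exists2 b, m b & ideal_add (ideal_gen [set` s1]) K (y - b * g).
    move: y mNy {eg}; change (ideal_mul m N `<=`
      [set y | exists2 b, m b & ideal_add (ideal_gen [set` s1]) K (y - b * g)]).
    apply: ideal_mul_sub.
      split=> [|x y [b mb sb] [c mc sc]|a x [b mb sb]].
      - by exists 0; [exact: ideal0|rewrite mul0r subrr; apply: ideal0].
      - exists (b + c); first exact: idealD.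
        by rewrite mulrDl opprD addrACA; apply: idealD.
      - by exists (a * b); [exact: idealM|rewrite -mulrA -mulrBr;
          apply: idealM].
    move=> x y mx /Ns[u /ideal_gen_cons[c sc] [v Kv <-]].
    exists (x * c); first exact: idealMr.
    rewrite -mulrA -mulrBr addrAC; apply: idealM => //.
    by exists (u - c * g) => //; exists v.
  move=> [b mb sb]; exists b => //.
  rewrite -[X in X - _]eg; have -> : y + z - b * g = (y - b * g) + z by ring.
  by apply: (idealD Ia sb); apply: sub_ideal_addr.
have [b mb sb] := key.
have nb : ~ m (1 - b).
  by move=> m1; case: mloc => -[_ /(_ _)H _] _; apply: H; rewrite -(subrK b 1);
    apply: idealD.
have [c ce] := local_unit nb.
have sg : ideal_add (ideal_gen [set` s1]) K g.
  have -> : g = c * (g - b * g) by rewrite -[X in X - _]mul1r -mulrBl mulrA ce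
    mul1r.
  exact: idealM.
move=> x /Ns[u /ideal_gen_cons[d sd] [v Kv <-]].
have -> : u + v = (u - d * g + v) + d * g by ring.
apply: idealD => //; last exact: idealM.
by exists (u - d * g) => //; exists v.
Qed.

End Local.

(** * Hilbert's basis theorem and Artin-Rees *)

Section HilbertBasis.

Lemma seq_lift (T U : eqType) (P : T -> U -> Prop) (s : seq T) :
  (forall x : T, x \in s -> exists y, P x y) ->
  exists t : seq U, (forall y : U, y \in t -> exists x, P x y) /\
                    (forall x : T, x \in s -> exists2 y, y \in t & P x y).
Proof.
elim: s => [_|x s IHs Ps]; first by exists [::].
have [t [tP tQ]] : exists t : seq U, (forall y : U, y \in t ->
  exists x, P x y) /\
                    (forall x : T, x \in s -> exists2 y, y \in t & P x y).
  by apply: IHs => y ys; apply: Ps; rewrite inE ys orbT.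
have [y Pxy] := Ps x (mem_head x s); exists (y :: t); split=> z; rewrite inE.
  by move=> /predU1P[->|/tP//]; exists x.
move=> /predU1P[->|/tQ[u ut Pu]]; first by exists y; rewrite ?mem_head.
by exists u => //; rewrite inE ut orbT.
Qed.

Variable B : comNzRingType.
Implicit Types (p q : {poly B}) (U : set {poly B}).

(** Bounding the size instead of prescribing it admits zero, which makes the leading coefficients in
    degree [n] an ideal. *)
Definition coef_ideal U n : set B :=
  [set b | exists p, [/\ U p, (size p <= n.+1)%N & p`_n = b]].

Lemma ideal_coef_ideal U n : is_ideal U -> is_ideal (coef_ideal U n).
Proof.
move=> IU; split=> [|_ _ [p [Up sp <-]] [q [Uq sq <-]]|a _ [p [Up sp <-]]].
- by exists 0; rewrite size_poly0 coef0; split=> //; apply: ideal0.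
- exists (p + q); split; [exact: idealD| |by rewrite coefD].
  by apply: leq_trans (size_polyD _ _) _; rewrite geq_max sp.
- exists (a%:P * p); split; [exact: idealM| |by rewrite coefCM].
  by rewrite mul_polyC; apply: leq_trans (size_scale_leq _ _) _.
Qed.

Lemma coef_ideal_incr U n : is_ideal U -> coef_ideal U n `<=` coef_ideal U n.+1.
Proof.
move=> IU _ [p [Up sp <-]]; exists ('X * p); rewrite coefXM; split=> //.
  exact: idealM.
by rewrite mulrC; apply: leq_trans (size_polyMleq _ _) _;
  rewrite size_polyX addn2.
Qed.

(** Only the ideals [coef_ideal U n] up to the stable index [N] need generators: above [N], a
    polynomial that realizes a coefficient is obtained by shifting one from degree [N]. A descent on
    the size then removes leading terms. *)
Theorem hilbert_basis : noetherian B -> noetherian {poly B}.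
Proof.
move=> NB U IU.
have IL n : is_ideal (coef_ideal U n) by apply: ideal_coef_ideal.
have [N HN] := noetherian_acc NB IL (fun n => @coef_ideal_incr U n IU).
have IG (t : seq {poly B}) : is_ideal (ideal_gen [set` t]) by apply:
  ideal_gen_is_ideal.
have lift n : exists2 t : seq {poly B}, [set` t] `<=` U &
    coef_ideal U n `<=` coef_ideal (ideal_gen [set` t]) n.
  have [s Es] := NB _ (IL n).
  have [b|t [tU tP]] := @seq_lift _ _ (fun b p => [/\ U p, (size p <= n.+1)%N &
    p`_n = b]) s.
    by move=> bs; apply: (_ : coef_ideal U n b); rewrite Es;
      apply: sub_ideal_gen.
  exists t => [p /tU[b []]//|]; rewrite {1}Es.
  apply: ideal_gen_sub => [|b /tP[p pt [_ sp pb]]];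
    first exact: ideal_coef_ideal.
  by exists p; split=> //; apply: sub_ideal_gen.
have [t tU Ht] : exists2 t : seq {poly B}, [set` t] `<=` U & forall n, (n <=
  N)%N ->
    coef_ideal U n `<=` coef_ideal (ideal_gen [set` t]) n.
  elim: {HN} N => [|N [t tU Ht]].
    have [t tU Ht] := lift 0%N; exists t => // n; by rewrite leqn0 => /eqP ->.
  have [t1 t1U Ht1] := lift N.+1; exists (t1 ++ t).
    by move=> p /=; rewrite mem_cat => /orP[/t1U|/tU].
  move=> n; rewrite leq_eqVlt => /predU1P[->|/Ht nN] b.
    move=> /Ht1[p [gp sp pb]]; exists p; split=> //; apply: ideal_genS gp.
    by move=> q /= qt; rewrite mem_cat qt.
  move=> /nN[p [gp sp pb]]; exists p; split=> //; apply: ideal_genS gp.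
  by move=> q /= qt; rewrite mem_cat qt orbT.
have {}Ht n : coef_ideal U n `<=` coef_ideal (ideal_gen [set` t]) n.
  have [/Ht//|/ltnW Nn b /HN/(Ht _ (leqnn N))[p [gp sp pb]]] := leqP n N.
  exists ('X^(n - N) * p); rewrite coefXnM ltnNge leq_subr /= subKn //;
    split=> //.
    exact: (idealM _ (IG t)).
  apply: leq_trans (size_polyMleq _ _) _; rewrite size_polyXn /=.
  by rewrite -(leq_add2l (n - N)) in sp; apply: leq_trans sp _;
    rewrite addnS subnK.
exists t; apply/seteqP; split; last exact: ideal_gen_sub.
move=> p; move: {2}(size p) (leqnn (size p)) => n.
elim: n p => [|n IHn] p sp Up.
  by move: sp; rewrite leqn0 size_poly_eq0 => /eqP ->; apply: (ideal0 (IG t)).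
have [q [gq sq qp]] : coef_ideal (ideal_gen [set` t]) n p`_n.
  by apply: Ht; exists p.
have Uq : U q by apply: (ideal_gen_sub IU tU).
apply: (idealBr (IG t) _ gq); apply: IHn; last exact: idealB.
apply/leq_sizeP => j; rewrite leq_eqVlt => /predU1P[<-|nj].
  by rewrite coefB qp subrr.
by rewrite coefB !nth_default ?subr0 //; apply: leq_trans nj.
Qed.

End HilbertBasis.

(** * Finitely generated algebras over a Noetherian ring *)

Section Adjunction.
Variable S : comNzRingType.

Definition subring_set (T : set S) :=
  (forall x y, T x -> T y -> T (x + y)) /\ (forall x y, T x -> T y ->
    T (x * y)).

(** [B'] is a polynomial ring over [B] with one variable for each entry of [s]. The subalgebra
    generated by [s] is thus reached as an image, and the last clause says that this image is the
    smallest candidate. *)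
Lemma noetherian_adjoin (B : comNzRingType) (phi : {rmorphism B ->
  S}) (s : seq S) :
  noetherian B ->
  exists (B' : comNzRingType) (phi' : {rmorphism B' -> S}),
    [/\ noetherian B', range phi `<=` range phi', [set` s] `<=` range phi' &
      forall T, subring_set T -> range phi `<=` T -> [set` s] `<=` T ->
        range phi' `<=` T].
Proof.
elim: s B phi => [|y s IHs] B phi NB; first by exists B, phi;
  split=> // T _ BT _.
have cy : commr_rmorph phi y by move=> b; apply: mulrC.
have [B' [phi' [NB' pB sB HB]]] :=
  IHs {poly B} (horner_morph cy : {rmorphism {poly B} -> S}) (hilbert_basis NB).
exists B', phi'; split=> // [_ [b _ <-]|z /=|T ST BT sT].
- by apply: pB; exists b%:P => //=; rewrite horner_morphC.
- rewrite inE => /predU1P[->|/sB//]; apply: pB.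
  by exists 'X => //=; rewrite horner_morphX.
- have Tphi b : T (phi b) by apply: BT; exists b.
  apply: HB => // [_ [p _ <-]|z zs]; last by apply: sT;
    rewrite /= inE (zs : is_true (z \in s)) orbT.
  elim/poly_ind: p => [|p c IHp]; first by rewrite /= rmorph0 -(rmorph0 phi).
  rewrite rmorphD rmorphM /= horner_morphX horner_morphC.
  by apply: ST.1 => //; apply: ST.2 => //; apply: sT; rewrite /= mem_head.
Qed.

End Adjunction.

(** * Stability of graded families and the Artin-Rees lemma *)

Section GradedBasis.
Variable R : comNzRingType.

Lemma ideal_monomial (B : comNzRingType) (phi : {rmorphism B -> {poly R}}) j :
  (forall c, range phi c%:P) -> is_ideal [set x | range phi (x *: 'X^j)].
Proof.
move=> Ic; split=> [|y z [b _ eb] [c _ ec]|a y [b _ eb]] /=.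
- by rewrite scale0r -(rmorph0 phi); exists 0.
- by exists (b + c); rewrite // rmorphD eb ec scalerDl.
- have [c _ ec] := Ic a; exists (c * b) => //.
  by rewrite rmorphM eb ec mul_polyC scalerA.
Qed.

Implicit Types (I : set R) (W : nat -> set R).

Lemma graded_pow_mul I W : (forall k, is_ideal (W k)) ->
  (forall k x w, I x -> W k w -> W k.+1 (x * w)) ->
  forall i k x w, ideal_pow I i x -> W k w -> W (i + k)%N (x * w).
Proof.
move=> IW WS; elim=> [|i IHi] k x w; first by move=> _;
  apply: (idealM _ (IW k)).
move=> Ix Ww; rewrite mulrC.
apply: (ideal_genM (IW (i.+1 + k)%N)) Ix => _ [y Iy [z Iz <-]].
by rewrite mulrC -mulrA addSn; apply: WS => //; apply: IHi.
Qed.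

(** The sum of the W_k t^k is an ideal of the Rees algebra of [I], which is the image of a
    Noetherian ring [B]; [k0] bounds the degrees of finitely many generators. Both Artin-Rees and
    the Hilbert-Samuel polynomial rest on this. *)
Lemma graded_stable I W : noetherian R -> is_ideal I ->
  (forall k, is_ideal (W k)) -> (forall k, W k `<=` ideal_pow I k) ->
  (forall k x w, I x -> W k w -> W k.+1 (x * w)) ->
  exists k0, forall k, (k0 <= k)%N -> W k.+1 `<=` ideal_mul I (W k).
Proof.
move=> NR II IW WI WS; have [s Es] := NR _ II.
have IP k : is_ideal (ideal_pow I k) by apply: ideal_ideal_pow.
have [B [phi [NB cphi sphi phiT]]] :=
  @noetherian_adjoin {poly R} R (polyC : {rmorphism R -> {poly R}})
    [seq x *: 'X | x <- s] NR.
have {}phiT b k : ideal_pow I k (phi b)`_k.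
  suff : range phi `<=` [set p | forall k, ideal_pow I k p`_k] by apply;
    exists b.
  apply: phiT => [|_ [c _ <-] j /=|p /= /mapP[x xs ->] j].
  - split=> p q Tp Tq j; first by rewrite coefD; apply: (idealD (IP j)).
    rewrite coefM; apply: (ideal_sum _ (IP j)) => i _.
    rewrite -{1}(subnKC (ltn_ord i : i <= j)%N) ideal_powD.
    exact: mem_ideal_mul.
  - by rewrite coefC; case: j => [|j] //=; apply: (ideal0 (IP j.+1)).
  - rewrite coefZ coefX; case: eqP => [->|_]; last by rewrite mulr0;
      apply: (ideal0 (IP _)).
    by rewrite mulr1 ideal_pow1 // Es; apply: sub_ideal_gen.
have {cphi} Ic c : range phi c%:P by apply: cphi; exists c.
have ran k x : ideal_pow I k x -> range phi (x *: 'X^k).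
  have Iran j : is_ideal [set x | range phi (x *: 'X^j)] by exact:
    ideal_monomial.
  elim: k x => [|k IHk] x; first by rewrite expr0 alg_polyC.
  move: x; change (ideal_pow I k.+1 `<=` [set x : R | range phi (x *:
    'X^(k.+1))]).
  apply: ideal_mul_sub => // x y Ix /IHk[b _ eb].
  have [c _ ec] : range phi (x *: 'X^1).
    move: x Ix; rewrite Es; change (ideal_gen [set` s] `<=` [set x : R | range
      phi (x *: 'X^1)]).
    by apply: ideal_gen_sub => // x xs; apply: sphi; apply: map_f.
  exists (c * b) => //=; rewrite rmorphM eb ec.
  by rewrite -scalerAl -scalerAr -exprD scalerA.
have WM := graded_pow_mul IW WS.
pose U := [set b | forall k, W k (phi b)`_k].
have IU : is_ideal U.
  split=> [k|b c Ub Uc k|a b Ub k].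
  - by rewrite rmorph0 coef0; apply: (ideal0 (IW k)).
  - by rewrite rmorphD coefD; apply: (idealD (IW k)).
  - rewrite rmorphM coefM; apply: (ideal_sum _ (IW k)) => i _.
    rewrite -{1}(subnKC (ltn_ord i : i <= k)%N); exact: WM.
have [t Et] := NB _ IU.
have [k0 Hk0] : exists n, forall b : B, b \in t -> (size (phi b) <= n)%N.
  apply: (seq_bounded (P := fun b n => (size (phi b) <= n)%N)) => [b m n mn
    sb|b _].
    exact: leq_trans sb mn.
  by exists (size (phi b)).
exists k0 => k k0k w Ww.
have [b _ eb] := ran _ _ (WI _ _ Ww).
have -> : w = (phi b)`_k.+1 by rewrite eb coefZ coefXn eqxx mulr1.
have Ub : U b.
  move=> j; rewrite eb coefZ coefXn; case: eqP => [->|_];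
    first by rewrite mulr1.
  by rewrite mulr0; apply: (ideal0 (IW j)).
have IIW := ideal_ideal_mul I (W k).
(* Membership in [U] is carried along because the coefficient of degree [k.+1] of a product also
   involves the lower coefficients of the factor in [U], each multiplied by an element of a positive
   power of [I]. *)
suff : U `<=` [set b | U b /\ ideal_mul I (W k) (phi b)`_k.+1] by move=> /(_ _
  Ub)[].
rewrite {1}Et; apply: ideal_gen_sub => [|c ct /=]; last first.
  split; first by rewrite Et; apply: sub_ideal_gen.
  rewrite nth_default; first exact: (ideal0 IIW).
  by apply: leq_trans (Hk0 _ ct) _; apply: leqW.
split=> [|a c [Ua Ia] [Uc Ic']|a c [Uc Ic']].
- by split; [exact: (ideal0 IU)|rewrite rmorph0 coef0; apply: (ideal0 IIW)].
- by split; [exact: (idealD IU)|rewrite rmorphD coefD; apply: (idealD IIW)].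
- split; first exact: (idealM _ IU).
  rewrite rmorphM coefM big_ord_recl /= subn0; apply: (idealD IIW).
    exact: (idealM _ IIW).
  apply: (ideal_sum _ IIW) => i _; rewrite /bump /= add1n subSS.
  have := phiT a i.+1; rewrite ideal_powS => Ia.
  rewrite mulrC; apply: (ideal_genM IIW) Ia => _ [y Iy [z Iz <-]].
  rewrite mulrC -mulrA; apply: mem_ideal_mul => //.
  by rewrite -{1}(subnKC (ltn_ord i : i <= k)%N); apply: WM.
Qed.

(** The ideals K : I^n stabilize at some [N], so that the saturation is K : I^N. By [graded_stable],
    its intersection with I^n lies, for large n, in I^N times the saturation, hence in [K]. *)
Lemma artin_rees_saturation I K : noetherian R -> is_ideal I -> is_ideal K ->
  exists n0, forall n, (n0 <= n)%N ->
    saturation K I `&` ideal_pow I n `<=` K.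
Proof.
move=> NR II IK; have IS := ideal_saturation I IK.
have IC n : is_ideal (colon K (ideal_pow I n)) by apply: ideal_colon.
have [N HN] : exists N, forall n, colon K (ideal_pow I n) `<=` colon K
  (ideal_pow I N).
  apply: noetherian_acc NR IC _ => n x Kx y Iy; apply: Kx.
  exact: ideal_pow_decr (leqnSn n) _ Iy.
pose W k := saturation K I `&` ideal_pow I k.
have IW k : is_ideal (W k) by apply: idealI => //; apply: ideal_ideal_pow.
have [||k0 Hk0] := @graded_stable I W NR II IW.
- by move=> k x [].
- move=> k x w Ix [Sw Iw]; split; first exact: (idealM _ IS).
  by rewrite ideal_powS; apply: mem_ideal_mul.
have WN j : W (k0 + j)%N `<=` ideal_mul (ideal_pow I j) (W k0).
  elim: j => [|j IHj]; first by rewrite addn0 ideal_mulT.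
  rewrite addnS ideal_powS -ideal_mulA.
  apply: subset_trans (Hk0 _ (leq_addr j k0)) _.
  exact: ideal_mulS.
exists (k0 + N)%N => n nN x [Sx Ix].
have /WN : W (k0 + N)%N x by split=> //; apply: ideal_pow_decr Ix.
apply: ideal_mul_sub => // y z Iy [[j _ /HN Kz] _].
by rewrite mulrC; apply: Kz.
Qed.

End GradedBasis.

(** * Length *)

Section Length.
Variable A : comPzRingType.
Implicit Types (I J K L X Y : set A).

Lemma ideal_chain_props I K k : ideal_chain I K k ->
  [/\ is_ideal I, is_ideal K & K `<=` I].
Proof.
move=> [L [<- <- IL LS]]; split; [exact: IL|exact: IL|].
suff H j : (j <= k)%N -> L 0%N `<=` L j by exact: H.
elim: j => [|j IHj] jk; first by [].
apply: subset_trans (IHj (ltnW jk)) _.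
by have [] := LS j jk.
Qed.

Lemma ideal_chain0 I : is_ideal I -> ideal_chain I I 0.
Proof. by move=> II; exists (fun=> I). Qed.

Lemma ideal_chain0_eq I K : ideal_chain I K 0 -> I = K.
Proof. by move=> [L [<- <-]]. Qed.

Lemma ideal_chainS I J K k : is_ideal J -> I `<` J ->
  ideal_chain I K k -> ideal_chain J K k.+1.
Proof.
move=> IJ sIJ [L [L0 Lk IL LS]].
exists (fun i => if (i <= k)%N then L i else J); split=> //.
- by rewrite ltnn.
- by move=> i ik; case: ifP => // /IL.
- move=> i; rewrite ltnS => ik; rewrite ik; case: ltnP => [|ki];
    first exact: LS.
  by have -> : i = k by [apply/eqP; rewrite eqn_leq ik]; rewrite Lk.
Qed.

Lemma ideal_chain_inv J K k : ideal_chain J K k.+1 ->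
  exists I, [/\ is_ideal J, I `<` J & ideal_chain I K k].
Proof.
move=> [L [L0 Lk IL LS]]; exists (L k); rewrite -Lk; split;
  [exact: IL|exact: LS|].
by exists L; split=> // i ik; [apply: IL; apply: leqW|apply: LS; apply: leqW].
Qed.

Lemma ideal_chain_cat I L K a b :
  ideal_chain I L a -> ideal_chain L K b -> ideal_chain I K (a + b).
Proof.
elim: a I => [|a IHa] I; first by move=> /ideal_chain0_eq ->.
by move=> /ideal_chain_inv[J [II JI /IHa H]] /H; apply: ideal_chainS.
Qed.

Lemma ideal_chain_strict I K k : ideal_chain I K k.+1 -> ~ I `<=` K.
Proof.
move=> /ideal_chain_inv[J [II [JI nIJ] /ideal_chain_props[_ _ KJ]]] IK.
exact: nIJ (subset_trans IK KJ).
Qed.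

Lemma ideal_chain_extend I J K k : is_ideal J -> I `<=` J ->
  ideal_chain I K k ->
  exists k', [/\ (k <= k')%N, (~ J `<=` I -> k < k')%N & ideal_chain J K k'].
Proof.
move=> IJ sIJ Ck; have [JI|nJI] := pselect (J `<=` I).
  exists k; have <- : I = J by apply/seteqP.
  by split=> // /(_ (@subset_refl _ _)).
by exists k.+1; split=> //; apply: ideal_chainS Ck.
Qed.

(** By the modular law, an ideal X inside I with X + L = I + L and the same intersection with L
    equals I. Hence every strict step of the chain survives in at least one of the two new
    chains. *)
Lemma ideal_chain_split L I K j : is_ideal L -> K `<=` L -> ideal_chain I K j ->
  exists a b, [/\ ideal_chain (ideal_add I L) L a,
    ideal_chain (I `&` L) K b & (j <= a + b)%N].
Proof.
move=> IL KL; elim: j I => [|j IHj] I CI.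
  have [_ IK _] := ideal_chain_props CI; rewrite (ideal_chain0_eq CI).
  exists 0%N, 0%N; split=> //; last first.
    suff -> : K `&` L = K by exact: ideal_chain0.
    by apply/seteqP; split=> x; [case|split=> //; apply: KL].
  suff -> : ideal_add K L = L by exact: ideal_chain0.
  by apply/seteqP; split; [exact: ideal_add_sub|exact: sub_ideal_addr].
have [X [II [XI nIX] CX]] := ideal_chain_inv CI.
have [a [b [Ca Cb jab]]] := IHj _ CX.
have [IX _ _] := ideal_chain_props CX.
have [|a' [aa' sa Ca']] := ideal_chain_extend (ideal_ideal_add II IL) _ Ca.
  exact: ideal_addS.
have [|b' [bb' sb Cb']] := ideal_chain_extend (idealI II IL) _ Cb.
  by move=> x [/XI].
exists a', b'; split=> //.
have [IaX|/sa aa] := pselect (ideal_add I L `<=` ideal_add X L); last by lia.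
have [IbX|/sb bb] := pselect (I `&` L `<=` X `&` L); last by lia.
case: nIX => x Ix; have [y Xy [z Lz e]] := IaX x (sub_ideal_addl IL Ix).
have [|Xz _] := IbX z; last by rewrite -e; apply: (idealD IX).
split=> //; have -> : z = x - y by rewrite -e [y + z]addrC addrK.
by apply: idealB => //; apply: XI.
Qed.

Lemma is_length_props I K k : is_length I K k ->
  [/\ is_ideal I, is_ideal K & K `<=` I].
Proof. by move=> [/ideal_chain_props]. Qed.

Lemma is_length_uniq I K k j : is_length I K k -> is_length I K j -> k = j.
Proof.
by move=> [Ck mk] [Cj mj]; apply/eqP; rewrite eqn_leq mj // mk.
Qed.

Lemma is_length_add I L K a b :
  is_length I L a -> is_length L K b -> is_length I K (a + b).
Proof.
move=> [Ca ma] [Cb mb]; split; first exact: ideal_chain_cat Cb.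
have [II IL LI] := ideal_chain_props Ca.
have [_ IK KL] := ideal_chain_props Cb.
move=> j /(ideal_chain_split IL KL)[a' [b' [Ca' Cb' jab]]].
apply: leq_trans jab (leq_add _ _); [apply: ma|apply: mb].
  suff <- : ideal_add I L = I by [].
  by apply/seteqP; split; [exact: ideal_add_sub|exact: sub_ideal_addl].
by suff <- : I `&` L = L by []; apply/seteqP; split=> x; [case|split=> //;
  apply: LI].
Qed.

Lemma is_length_bounded I K N : is_ideal I -> is_ideal K -> K `<=` I ->
  (forall j, ideal_chain I K j -> (j <= N)%N) -> exists k, is_length I K k.
Proof.
move=> II IK KI bN; pose P j := `[< ideal_chain I K j >].
have [k0 [_ _ C0]] := ideal_chain_extend II KI (ideal_chain0 IK).
have exP : exists j, P j by exists k0; apply/asboolP.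
have bP j : P j -> (j <= N)%N by move=> /asboolP; apply: bN.
have [k /asboolP Ck mk] := ex_maxnP exP bP.
by exists k; split=> // j Cj; apply: mk; apply/asboolP.
Qed.

Lemma is_length_split I L K k : is_length I K k -> is_ideal L ->
  K `<=` L -> L `<=` I ->
  exists a b, [/\ is_length I L a, is_length L K b & k = (a + b)%N].
Proof.
move=> lk IL KL LI; have [Ck mk] := lk; have [II IK KI] := ideal_chain_props Ck.
have [a0 [_ _ C0]] := ideal_chain_extend II LI (ideal_chain0 IL).
have [b0 [_ _ C1]] := ideal_chain_extend IL KL (ideal_chain0 IK).
have [|a la] := @is_length_bounded I L k II IL LI.
  move=> j Cj; have := mk _ (ideal_chain_cat Cj C1); lia.
have [|b lb] := @is_length_bounded L K k IL IK KL.
  move=> j Cj; have := mk _ (ideal_chain_cat C0 Cj); lia.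
by exists a, b; split=> //; apply: is_length_uniq lk (is_length_add la lb).
Qed.

Lemma is_length_refl I : is_ideal I -> is_length I I 0.
Proof.
move=> II; split; first exact: ideal_chain0.
by case=> // j /ideal_chain_strict[].
Qed.

Lemma is_length_le I L K k a : is_length I K k -> is_length I L a ->
  K `<=` L -> (a <= k)%N.
Proof.
move=> lk la KL; have [_ IL LI] := is_length_props la.
have [a' [b [la' _ ->]]] := is_length_split lk IL KL LI.
by rewrite (is_length_uniq la la') leq_addr.
Qed.

Lemma is_length_maximal (n : set A) : is_maximal n -> is_length setT n 1.
Proof.
move=> [In n1 maxn]; split.
  by apply: ideal_chainS (ideal_chain0 In) => //; split=> // nT; apply: n1;
    apply: nT.
case=> [//|[//|j]] /ideal_chain_inv[I [_ [_ nTI] CI]].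
have [II _ nI] := ideal_chain_props CI.
case: (ideal_chain_strict CI); rewrite (maxn I) // => I1.
by apply: nTI; rewrite (ideal1 II I1).
Qed.

End Length.

Section LengthTransfer.
Variables (A B : comPzRingType).

Lemma ideal_chain_transfer (f : set A -> set B) (I K : set A) k :
  (forall X, is_ideal X -> K `<=` X -> X `<=` I -> is_ideal (f X)) ->
  (forall X Y, is_ideal X -> is_ideal Y -> K `<=` X -> Y `<=` I ->
     X `<` Y -> f X `<` f Y) ->
  ideal_chain I K k -> ideal_chain (f I) (f K) k.
Proof.
elim: k I => [|k IHk] I If fS CI.
  have [_ IK _] := ideal_chain_props CI.
  by rewrite (ideal_chain0_eq CI) in If *; apply: ideal_chain0; apply: If.
have [X [II XI CX]] := ideal_chain_inv CI; have [sXI _] := XI.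
have [IX IK KX] := ideal_chain_props CX.
apply: (ideal_chainS (I := f X)).
- exact: If _ (subset_trans KX sXI) _.
- exact: fS.
- apply: IHk CX => [Y IY KY YX|Y Z IY IZ KY ZX].
    exact: If _ _ (subset_trans YX sXI).
  exact: fS _ _ IY IZ KY (subset_trans ZX sXI).
Qed.

End LengthTransfer.

(** The intervals from [K] to [I] and from [K'] to [I'] are isomorphic as ordered sets, in rings
    that may differ; [f] and [g] have to be mutually inverse on these intervals only. Module
    isomorphisms enter the proof in this form. *)
Lemma is_length_transfer (A B : comPzRingType) (f : set A -> set B)
    (g : set B -> set A) I K I' K' k :
  (forall X, is_ideal X -> K `<=` X -> X `<=` I -> is_ideal (f X)) ->
  (forall Y, is_ideal Y -> K' `<=` Y -> Y `<=` I' -> is_ideal (g Y)) ->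
  (forall X Y, X `<=` Y -> f X `<=` f Y) ->
  (forall X Y, X `<=` Y -> g X `<=` g Y) ->
  (forall X, is_ideal X -> K `<=` X -> X `<=` I -> g (f X) = X) ->
  (forall Y, is_ideal Y -> K' `<=` Y -> Y `<=` I' -> f (g Y) = Y) ->
  f K = K' -> f I = I' ->
  is_ideal I -> is_ideal K -> K `<=` I ->
  is_length I K k -> is_length I' K' k.
Proof.
move=> If Ig fS gS gf fg fK fI II IK KI [Ck mk].
have gK : g K' = K by rewrite -fK gf.
have gI : g I' = I by rewrite -fI gf.
split=> [|j Cj].
  rewrite -fK -fI; apply: ideal_chain_transfer Ck => // X Y IX IY KX YI [XY
    nYX].
  split; first exact: fS.
  have gfX := gf X IX KX (subset_trans XY YI).
  have gfY := gf Y IY (subset_trans KX XY) YI.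
  by move=> /gS; rewrite gfX gfY.
apply: mk; rewrite -gK -gI.
apply: ideal_chain_transfer Cj => // X Y IX IY KX YI [XY nYX].
split; first exact: gS.
have fgX := fg X IX KX (subset_trans XY YI).
have fgY := fg Y IY (subset_trans KX XY) YI.
by move=> /fS; rewrite fgX fgY.
Qed.

Section LengthComputation.
Variable A : comPzRingType.
Implicit Types (I J K L X Y n : set A).

(* Multiplication by [x] induces an isomorphism from [I / K] onto [I' / K']. *)
Lemma is_length_scale x I K I' K' k : is_ideal I -> is_ideal K' ->
  I' = ideal_add [set x * a | a in I] K' -> K = [set a | I a /\ K' (x * a)] ->
  is_length I' K' k <-> is_length I K k.
Proof.
move=> II IK' -> KE.
pose f X := ideal_add [set x * a | a in X] K'.
pose g Y := [set a | I a /\ Y (x * a)].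
have fS X Y : X `<=` Y -> f X `<=` f Y.
  by move=> XY; apply: ideal_addS => // _ [a Xa <-]; exists a => //; apply: XY.
have gS X Y : X `<=` Y -> g X `<=` g Y by move=> XY a [Ia Xa]; split=> //;
  apply: XY.
have If X : is_ideal X -> is_ideal (f X) by move=> IX; apply: ideal_scale.
have Ig X : is_ideal X -> is_ideal (g X).
  by move=> IX; apply: (idealI II); apply: ideal_pre.
have IK : is_ideal K by rewrite KE; apply: Ig.
have gf X : is_ideal X -> K `<=` X -> X `<=` I -> g (f X) = X.
  move=> IX KX XI; apply/seteqP; split=> a.
    move=> [Ia [_ [b Xb <-] [c Kc e]]]; apply: (idealBr IX _ Xb); apply: KX.
    rewrite KE; split; first by apply: (idealB II) => //; apply: XI.
    by rewrite mulrBr -e addrC addKr.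
  move=> Xa; split; first exact: XI.
  by apply: sub_ideal_addl => //; exists a.
have fg X : is_ideal X -> K' `<=` X -> X `<=` f I -> f (g X) = X.
  move=> IX KX XI; apply/seteqP; split.
    by apply: ideal_add_sub => // _ [a [_ Xa] <-].
  move=> y Xy; have [_ [a Ia <-] [c Kc e]] := XI _ Xy.
  exists (x * a); last by exists c.
  exists a => //; split=> //; have -> : x * a = y - c by rewrite -e addrK.
  by apply: idealB => //; apply: KX.
have fK : f K = K'.
  apply/seteqP; split; last by apply: sub_ideal_addr; apply: ideal_image_scale.
  by apply: ideal_add_sub => // _ [a + <-]; rewrite KE => -[].
have KI : K `<=` I by rewrite KE => a [].
have K'I : K' `<=` f I by rewrite -fK; apply: fS.
split.
  apply: (is_length_transfer (f := g) (g := f)) => //; try exact: If.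
  - by move=> X IX _ _; apply: Ig.
  - by move=> X IX _ _; apply: If.
  - by apply/seteqP; split=> a; [case|move=> Ia; split=> //;
      apply: sub_ideal_addl => //; exists a].
apply: (is_length_transfer (f := f) (g := g)) => //.
- by move=> X IX _ _; apply: If.
- by move=> X IX _ _; apply: Ig.
Qed.

(** [I / K] is a finitely generated vector space over the residue field of [n]: adding a generator
    [g] to [K1] contributes the quotient of [A] by K1 : g, which contains [n], so the length grows
    by at most one. *)
Lemma is_length_killed n I K : noetherian A -> is_maximal n -> is_ideal I ->
  is_ideal K -> K `<=` I -> ideal_mul n I `<=` K -> exists k, is_length I K k.
Proof.
move=> NA Mn II IK KI nIK; have [s Es] := NA _ II; have [In _ maxn] := Mn.
have Ig (t : seq A) : is_ideal (ideal_gen [set` t]) by apply: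
  ideal_gen_is_ideal.
have Ia (t : seq A) : is_ideal (ideal_add (ideal_gen [set` t]) K) by apply:
  ideal_ideal_add.
have <- : ideal_add (ideal_gen [set` s]) K = I.
  by rewrite -Es; apply/seteqP; split; [exact: ideal_add_sub|exact:
    sub_ideal_addl].
have {Es} : [set` s] `<=` I by rewrite Es; apply: sub_ideal_gen.
elim: s => [|g s IHs] sI.
  exists 0%N; rewrite ideal_gen_nil; suff ->
    : ideal_add [set 0] K = K by exact: is_length_refl.
  apply/seteqP; split; first by apply: ideal_add_sub => // _ ->; apply: ideal0.
  by move=> x Kx; exists 0 => //; exists x; rewrite ?add0r.
have [|k lk] := IHs; first by move=> x xs; apply: sI;
  rewrite /= inE (xs : is_true (x \in s)) orbT.
set K1 := ideal_add (ideal_gen [set` s]) K in lk.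
have E : ideal_add (ideal_gen [set` g :: s]) K = ideal_add [set g * a | a in
  setT] K1.
  apply/seteqP; split.
    apply: ideal_add_sub; first exact: (ideal_scale g (@idealT A) (Ia s)).
      move=> x /ideal_gen_cons[b sb]; exists (g * b); first by exists b.
      exists (x - b * g); last by rewrite mulrC addrC subrK.
      exact: sub_ideal_addl.
    move=> x Kx; apply: sub_ideal_addr; first exact: (ideal_image_scale g
      (@idealT A)).
    exact: sub_ideal_addr.
  apply: ideal_add_sub => //.
    move=> _ [a _ <-]; apply: (sub_ideal_addl IK); apply: (idealMr _ (Ig _)).
    by apply: sub_ideal_gen; rewrite /= mem_head.
  apply: ideal_addS => //; apply: ideal_genS => x xs.
  by rewrite /= inE (xs : is_true (x \in s)) orbT.
pose L := [set a | [set: A] a /\ K1 (g * a)].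
have IL : is_ideal L by apply: (idealI (@idealT A));
  apply: (ideal_pre _ (Ia s)).
have nL : n `<=` L.
  move=> a na; split=> //; apply: sub_ideal_addr; first exact: (Ig s).
  apply: nIK; rewrite mulrC.
  by apply: mem_ideal_mul => //; apply: sI; rewrite /= mem_head.
have [j lj] : exists j, is_length setT L j.
  have [L1|nL1] := pselect (L 1).
    by exists 0%N; rewrite (ideal1 IL L1); apply: is_length_refl.
  by exists 1%N; rewrite (maxn L) //; apply: is_length_maximal.
exists (j + k)%N; apply: is_length_add lk.
by apply/(is_length_scale _ (@idealT A) (Ia s) E (erefl L)).
Qed.

Lemma is_length_finite n c I K : noetherian A -> is_maximal n -> is_ideal I ->
  is_ideal K -> K `<=` I -> ideal_mul (ideal_pow n c) I `<=` K ->
  exists k, is_length I K k.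
Proof.
move=> NA Mn; elim: c I => [|c IHc] I II IK KI nIK.
  rewrite ideal_mulT // in nIK; exists 0%N.
  by have -> : I = K; [apply/seteqP|apply: is_length_refl].
have ImI := ideal_ideal_mul n I; have IL := ideal_ideal_add ImI IK.
have sL : ideal_add (ideal_mul n I) K `<=` I.
  by apply: ideal_add_sub => //; apply: ideal_mul_subr.
have [k lk] := is_length_killed NA Mn II IL sL (sub_ideal_addl IK).
have [||j lj] := IHc _ IL IK.
- exact: sub_ideal_addr.
- apply: ideal_mul_sub => // x _ nx [y nIy [z Kz <-]].
  rewrite mulrDr; apply: idealD => //; last exact: idealM.
  apply: nIK; rewrite ideal_powS [ideal_mul n _]ideal_mulC -ideal_mulA.
  exact: mem_ideal_mul.
by exists (k + j)%N; apply: is_length_add lk lj.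
Qed.

End LengthComputation.

(** * Eventually polynomial functions *)

Section EventuallyPolynomial.
Implicit Types (p q s : {poly rat}) (f : nat -> rat) (c e : rat).

Lemma size_shift p c : size (p \Po ('X + c%:P)) = size p.
Proof. by rewrite size_comp_poly2 // size_XaddC. Qed.

Lemma lead_coef_shift p c : lead_coef (p \Po ('X + c%:P)) = lead_coef p.
Proof. by rewrite lead_coef_comp ?size_XaddC // lead_coefXaddC expr1n mulr1.
  Qed.

Lemma horner_shift p c x : (p \Po ('X + c%:P)).[x] = p.[x + c].
Proof. by rewrite horner_comp hornerD hornerX hornerC. Qed.

Lemma shift_diff_Xn d :
  exists2 r : {poly rat}, ('X + 1) ^+ d.+1 - 'X^(d.+1) = d.+1%:R *: 'X^d + r &
    (size r <= d)%N.
Proof.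
exists (\sum_(i < d) 'X^i *+ 'C(d.+1, i)).
  rewrite exprD1n big_ord_recr /= binn mulr1n addrK big_ord_recr /= binSn addrC.
  by rewrite scaler_nat.
apply: leq_trans (size_sum _ _ _) _; apply/bigmax_leqP => i _.
by rewrite -scaler_nat; apply: leq_trans (size_scale_leq _ _) _;
  rewrite size_polyXn.
Qed.

(* For [p = 0] this asks for [size q = 1], hence the constant [q = 1]. *)
Lemma antidifference p : exists q, [/\ q \Po ('X + 1%:P) - q = p,
  size q = (size p).+1 & lead_coef q * (size p)%:R = lead_coef p].
Proof.
move: {2}(size p) (leqnn (size p)) => n; elim: n p => [|n IHn] p sp.
  have -> : p = 0 by apply/eqP; rewrite -size_poly_eq0 -leqn0.
  exists 1%:P; rewrite size_poly0 size_polyC lead_coef0 mulr0 oner_eq0;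
    split=> //.
  by rewrite comp_polyC subrr.
have [sp'|] := leqP (size p) n; first exact: IHn.
move=> np; have {np}sp : size p = n.+1 by apply/eqP; rewrite eqn_leq sp.
have [r er sr] := shift_diff_Xn n.
(* With this [c], the difference of c X^(n+1) has the leading term of [p]. *)
pose c := lead_coef p / n.+1%:R.
have n0 : n.+1%:R != 0 :> rat by rewrite pnatr_eq0.
pose p1 := p - (c *: (('X + 1) ^+ n.+1 - 'X^(n.+1))).
have sp1 : (size p1 <= n)%N.
  apply/leq_sizeP => j; rewrite /p1 er scalerDr scalerA divfK // coefB coefD
    !coefZ coefXn.
  rewrite leq_eqVlt => /predU1P[<-|nj].
    by rewrite eqxx mulr1 (nth_default 0 sr) mulr0 addr0 lead_coefE sp subrr.
  rewrite (nth_default 0 (leq_trans sr (ltnW nj))) gtn_eqF // nth_default ?sp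
    // !mulr0.
  by rewrite !add0r oppr0.
have [q1 [dq1 sq1 _]] := IHn _ sp1.
have c0 : c != 0 by rewrite mulf_neq0 ?invr_eq0 // lead_coef_eq0 -size_poly_eq0
  sp.
have scX : size (c *: 'X^(n.+1) : {poly rat}) = n.+2 by rewrite size_scale //
  size_polyXn.
have sq : (size q1 < size (c *: 'X^(n.+1) : {poly rat}))%N by rewrite sq1 scX
  ltnS.
exists (c *: 'X^(n.+1) + q1); split.
- rewrite comp_polyD comp_polyZ comp_Xn_poly polyC1 opprD addrACA dq1 -scalerBr.
  by rewrite /p1 addrC subrK.
- by rewrite size_polyDl // scX sp.
- by rewrite lead_coefDl // lead_coefZ lead_coefXn mulr1 sp divfK.
Qed.

Definition evpoly f := exists p n0, forall k, (n0 <= k)%N -> f k = p.[k%:R].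

Lemma evpoly_antidifference f p n0 :
  (forall k, (n0 <= k)%N -> f k.+1 - f k = p.[k%:R]) ->
  exists q, (forall k, (n0 <= k)%N -> f k = q.[k%:R]) /\
    (p != 0 -> size q = (size p).+1 /\ lead_coef q * (size p)%:R = lead_coef p).
Proof.
move=> fp; have [q [dq sq lq]] := antidifference p.
(* The added constant fits the value at [n0]; for nonzero [p] it has smaller size than [q] and
   leaves the leading term alone. *)
exists (q + (f n0 - q.[n0%:R])%:P); split.
  move=> k /subnKC <-; elim: (k - n0)%N => [|j IHj].
    by rewrite addn0 hornerD hornerC addrC subrK.
  have := fp _ (leq_addr j n0); rewrite -dq hornerD hornerN horner_shift =>
    /eqP.
  rewrite subr_eq IHj addnS => /eqP ->; rewrite !hornerD !hornerC -natr1.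
  by rewrite addrA subrK.
move=> p0; have sc : (size (f n0 - q.[n0%:R])%:P < size q)%N.
  apply: leq_ltn_trans (size_polyC_leq1 _) _.
  by rewrite sq ltnS lt0n size_poly_eq0.
by rewrite size_polyDl // lead_coefDl.
Qed.

Lemma evpoly_diff f : evpoly (fun k => f k.+1 - f k) -> evpoly f.
Proof. by move=> [p [n0 /evpoly_antidifference[q [fq _]]]]; exists q, n0. Qed.

Lemma evpolyB f g : evpoly f -> evpoly g -> evpoly (fun k => f k - g k).
Proof.
move=> [p [m fp]] [q [n gq]]; exists (p - q), (maxn m n) => k.
by rewrite geq_max => /andP[mk nk]; rewrite fp // gq // hornerD hornerN.
Qed.

Lemma evpolyS f : evpoly f -> evpoly (fun k => f k.+1).
Proof.
move=> [p [m fp]]; exists (p \Po ('X + 1%:P)), m => k mk.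
by rewrite horner_shift natr1 fp // leqW.
Qed.

Lemma poly_eventually_pos p : 0 < lead_coef p ->
  exists n0, forall k, (n0 <= k)%N -> 0 < p.[k%:R].
Proof.
move=> l0; have lN0 : lead_coef p != 0 by rewrite gt_eqF.
have [|b Hb] := @monic_Cauchy_bound _ ((lead_coef p)^-1 *: p).
  by rewrite monicE lead_coefZ mulVf.
exists (Num.bound b) => k bk.
suff /Hb : b <= k%:R by rewrite hornerZ pmulr_rgt0 ?invr_gt0.
apply: le_trans (ler_norm _) _; apply: ltW.
apply: lt_le_trans (archi_boundP (normr_ge0 b)) _.
by rewrite ler_nat /Num.bound normr_id.
Qed.

(** An eventually nonnegative polynomial has a nonnegative leading coefficient. Applied to [p - s1]
    and [s2 - p], this excludes first a different degree and then a different leading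
    coefficient. *)
Lemma poly_squeeze s1 p s2 n0 : size s1 = size s2 ->
  lead_coef s1 = lead_coef s2 ->
  0 < lead_coef s1 ->
  (forall k, (n0 <= k)%N -> s1.[k%:R] <= p.[k%:R] <= s2.[k%:R]) ->
  size p = size s1 /\ lead_coef p = lead_coef s1.
Proof.
move=> ss ls l0 sp.
have nonneg q : (forall k, (n0 <= k)%N -> 0 <= q.[k%:R]) -> 0 <= lead_coef q.
  move=> q0; rewrite leNgt; apply/negP => lq.
  have [|n1 Hn] := @poly_eventually_pos (- q).
    by rewrite lead_coefN oppr_gt0.
  have := Hn _ (leq_maxr n0 n1).
  by rewrite hornerN oppr_gt0 ltNge (q0 _ (leq_maxl n0 n1)).
have n1 : 0 <= lead_coef (p - s1).
  by apply: nonneg => k /sp /andP[? _]; rewrite hornerD hornerN subr_ge0.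
have n2 : 0 <= lead_coef (s2 - p).
  by apply: nonneg => k /sp /andP[_ ?]; rewrite hornerD hornerN subr_ge0.
have p_s : size p = size s1.
  apply/eqP; rewrite eqn_leq; apply/andP; split; rewrite leqNgt;
    apply/negP => sz.
    rewrite lead_coefDl ?size_polyN // in n1.
    rewrite addrC lead_coefDl ?size_polyN -?ss // lead_coefN in n2.
    have : lead_coef p == 0 by rewrite eq_le n1 -oppr_ge0 n2.
    by rewrite lead_coef_eq0 => /eqP p0; rewrite p0 size_poly0 in sz.
  rewrite addrC lead_coefDl ?size_polyN // lead_coefN in n1.
  by rewrite oppr_ge0 leNgt l0 in n1.
split=> //.
have top q (r : {poly rat}) : size q = size r -> 0 <= lead_coef (q - r) ->
  lead_coef r <= lead_coef q.
  move=> sqr; rewrite leNgt => /negP lqr; rewrite leNgt; apply/negP => qr;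
    apply: lqr.
  have cE : (q - r)`_(size q).-1 = lead_coef q - lead_coef r.
    by rewrite coefB !lead_coefE sqr.
  have -> : lead_coef (q - r) = lead_coef q - lead_coef r;
    last by rewrite subr_lt0.
  rewrite -cE lead_coefE; congr (_`_(_.-1)); apply/eqP; rewrite eqn_leq.
  rewrite (leq_trans (size_polyD _ _)) ?size_polyN -?sqr ?maxnn //=.
  have : (q - r)`_(size q).-1 != 0 by rewrite cE subr_eq0 lt_eqF.
  by apply: contraNleq => sz; rewrite nth_default //; case: (size q) sz => //.
by apply/eqP; rewrite eq_le ls; apply/andP; split; [apply: top|rewrite -ls;
  apply: top]; rewrite // -ss.
Qed.

End EventuallyPolynomial.

(** * Hilbert functions *)

Section HilbertSerre.
Variable R : comPzRingType.
Implicit Types (U V W : nat -> set R) (ys : seq R).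

(** The quotients U_k / V_k form a graded module over a polynomial ring with one variable of degree
    1 for each [y] in [ys], acting as multiplication by [y]. A graded submodule is a family [W]
    between [V] and [U]; the step collects what degree [k] produces in degree [k.+1]. *)
Definition graded_step (V W : nat -> set R) (ys : seq R) k : set R :=
  V k.+1 `|` [set z | exists y w, [/\ y \in ys, W k w & z = y * w]].

Definition graded_closed (W : nat -> set R) (ys : seq R) :=
  (forall k, is_ideal (W k)) /\
  (forall y k w, y \in ys -> W k w -> W k.+1 (y * w)).

(* Every graded submodule of [U / V] over [R[T_y | y in ys]] is finitely generated. *)
Definition graded_noetherian U V ys := forall W,
  graded_closed W ys -> (forall k, V k `<=` W k) -> (forall k, W k `<=` U k) ->
  exists k0, forall k, (k0 <= k)%N -> W k.+1 `<=` ideal_gen (graded_step V W ys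
    k).

(* Induction on the number of variables: the kernel and the cokernel of the
   multiplication by a variable are graded modules in the remaining ones. *)
Lemma hilbert_serre ys U V (f : nat -> nat) :
  graded_closed U ys -> graded_closed V ys -> (forall k, V k `<=` U k) ->
  graded_noetherian U V ys ->
  (forall k, is_length (U k) (V k) (f k)) ->
  evpoly (fun k => (f k)%:R).
Proof.
elim: ys U V f => [|y ys IHys] U V f [IU US] [IV VS] VU NUV lf.
  have [k0 Hk0] := NUV U (conj IU US) VU (fun=> @subset_refl _ _).
  exists 0, k0.+1 => k; case: k => // k /Hk0 UVk; rewrite horner0.
  have UV : U k.+1 = V k.+1.
    apply/seteqP; split; last exact: VU.
    apply: subset_trans UVk _; apply: ideal_gen_sub => // z [//|].
    by move=> [y [w []]].
  by have := lf k.+1; rewrite UV => /is_length_uniq/(_ (is_length_refl (IV _)))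
    ->.
have yys : {subset ys <= y :: ys} by move=> z zys; rewrite inE zys orbT.
have {US}[yU US] : (forall k w, U k w -> U k.+1 (y * w)) /\
    (forall z k w, z \in ys -> U k w -> U k.+1 (z * w)).
  by split=> [k w|z k w /yys]; apply: US => //; apply: mem_head.
have {VS}[yV VS] : (forall k w, V k w -> V k.+1 (y * w)) /\
    (forall z k w, z \in ys -> V k w -> V k.+1 (z * w)).
  by split=> [k w|z k w /yys]; apply: VS => //; apply: mem_head.
(* [K] is the kernel of [y], and [C] is its image enlarged by [V]. The image sits one degree higher,
   so in degree 0 only [V] remains. *)
pose K k := [set u | U k u /\ V k.+1 (y * u)].
pose C k := if k is k'.+1 then ideal_add [set y * u | u in U k'] (V k) else V
  0%N.
have IK k : is_ideal (K k) by apply: (idealI (IU k)); apply: ideal_pre.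
have IC k : is_ideal (C k) by case: k => [|k];
  [exact: IV|exact: (ideal_scale y (IU k) (IV k.+1))].
have VK k : V k `<=` K k by move=> x Vx; split; [exact: VU|exact: yV].
have KU k : K k `<=` U k by move=> x [].
have VC k : V k `<=` C k.
  by case: k => [|k] //; apply: sub_ideal_addr;
    apply: (ideal_image_scale _ (IU k)).
have CU k : C k `<=` U k.
  case: k => [|k]; first exact: VU.
  by apply: ideal_add_sub => // _ [u Uu <-]; apply: yU.
have KS : graded_closed K ys.
  split=> // z k w zys [Uw Vw]; split; first exact: US.
  by rewrite mulrCA; apply: VS.
have CS : graded_closed C ys.
  split=> // z [|k] w zys; first by move=> Vw; apply: VC; apply: VS.
  move=> [_ [u Uu <-] [v Vv <-]]; exists (z * (y * u)); last first.
    by exists (z * v); [exact: VS|rewrite mulrDr].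
  by exists (z * u); [exact: US|rewrite mulrCA].
(* [y] sends the kernel into [V], so it produces nothing new there, and the other variables suffice.
   The same happens to the cokernel, as [y] sends [U] into [C]. *)
have NK : graded_noetherian K V ys.
  move=> W [IW WS] VW WK; have [||k0 Hk0] := NUV W _ VW.
  - split=> // z k w; rewrite inE => /predU1P[->|]; last exact: WS.
    by move=> /WK[_ Vw]; apply: VW.
  - by move=> k; apply: subset_trans (WK k) (KU k).
  exists k0 => k /Hk0 Wk; apply: subset_trans Wk _.
  have IG := ideal_gen_is_ideal (graded_step V W ys k).
  apply: ideal_gen_sub => // t [Vz|[z [w [+ Ww ->]]]].
    by apply: sub_ideal_gen; left.
  rewrite inE => /predU1P[->|zys].
    by apply: sub_ideal_gen; left; have [] := WK _ _ Ww.
  by apply: sub_ideal_gen; right; exists z, w.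
have NC : graded_noetherian U C ys.
  move=> W [IW WS] CW WU; have [||k0 Hk0] := NUV W _ _ WU.
  - split=> // z k w; rewrite inE => /predU1P[->|]; last exact: WS.
    by move=> /WU Uw; apply: CW; apply: sub_ideal_addl => //; exists w.
  - by move=> k; apply: subset_trans (VC k) (CW k).
  exists k0 => k /Hk0 Wk; apply: subset_trans Wk _.
  have IG := ideal_gen_is_ideal (graded_step C W ys k).
  apply: ideal_gen_sub => // t [Vz|[z [w [+ Ww ->]]]].
    by apply: sub_ideal_gen; left; apply: VC.
  rewrite inE => /predU1P[->|zys].
    apply: sub_ideal_gen; left; apply: sub_ideal_addl => //.
    by exists w => //; apply: WU.
  by apply: sub_ideal_gen; right; exists z, w.
have lenK k : exists b, is_length (K k) (V k) b.
  by have [a [b [_ lb _]]] := is_length_split (lf k) (IK k) (VK k) (KU k);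
    exists b.
have lenC k : exists a, is_length (U k) (C k) a.
  by have [a [b [la _ _]]] := is_length_split (lf k) (IC k) (VC k) (CU k);
    exists a.
have /choice[g lg] := lenK; have /choice[h lh] := lenC.
have pg := IHys _ _ _ KS (conj IV VS) VK NK lg.
have ph := IHys _ _ _ (conj IU US) CS CU NC lh.
have [p [n0 hp]] := evpolyB (evpolyS ph) pg.
apply: evpoly_diff; exists p, n0 => k /hp <-.
(* Multiplication by [y] identifies U_k / K_k with C_(k+1) / V_(k+1), whence f(k+1) - f(k) = h(k+1)
   - g(k). *)
have [a [b [la lb e1]]] := is_length_split (lf k) (IK k) (VK k) (KU k).
have [a' [b' [la' lb' e2]]] :=
  is_length_split (lf k.+1) (IC k.+1) (VC k.+1) (CU k.+1).
have := is_length_scale b' (IU k) (IV k.+1) (erefl (C k.+1)) (erefl (K k)).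
move=> /proj1/(_ lb')/is_length_uniq/(_ la) eb'.
rewrite e1 e2 (is_length_uniq (lg k) lb) (is_length_uniq (lh k.+1) la') eb'
  !natrD.
by rewrite opprD addrA addrK.
Qed.

End HilbertSerre.

(** * The Hilbert-Samuel function *)

Section HilbertSamuel.
Variable R : comNzRingType.

(** The first difference of [f] is the Hilbert function of the associated graded ring of the
    quotient by [N] with respect to [M], to which [hilbert_serre] applies with [V] the shift of
    [U]. *)
Lemma hilbert_samuel (M N : set R) (f : nat -> nat) : noetherian R ->
  is_ideal M -> is_ideal N ->
  (forall k, is_length setT (ideal_add (ideal_pow M k) N) (f k)) ->
  evpoly (fun k => (f k)%:R).
Proof.
move=> NR IM IN lf; apply: evpoly_diff; have [ys Es] := NR _ IM.
pose U k := ideal_add (ideal_pow M k) N.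
have IP k : is_ideal (ideal_pow M k) by apply: ideal_ideal_pow.
have IU k : is_ideal (U k) by apply: ideal_ideal_add.
have UU k : U k.+1 `<=` U k.
  by apply: ideal_addS => //; apply: ideal_pow_decr.
have yM y : y \in ys -> M y by move=> yys; rewrite Es; apply: sub_ideal_gen.
have US : graded_closed U ys.
  split=> // y k _ /yM My [x Mx [z Nz <-]]; exists (y * x).
    by rewrite ideal_powS; apply: mem_ideal_mul.
  by exists (y * z); [exact: idealM|rewrite mulrDr].
have VS : graded_closed (fun k => U k.+1) ys.
  by split=> // y k w; apply: US.2.
have /choice[g lg] k : exists b, is_length (U k) (U k.+1) b.
  by have [a [b [_ lb _]]] := is_length_split (lf k.+1) (IU k) (UU k) (@subsetT
    _ _); exists b.
suff [p [n0 gp]] : evpoly (fun k => (g k)%:R).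
  exists p, n0 => k /gp <-.
  rewrite (is_length_uniq (lf k.+1) (is_length_add (lf k) (lg k))) natrD.
  by rewrite addrC addKr.
apply: (hilbert_serre US VS UU) lg => W [IW WS] UW WU.
(* An element of W_k lies in M^k + N only. Intersecting with M^k meets the hypothesis of
   [graded_stable], and the part in [N] is absorbed by [U k.+1]. *)
pose W1 k := W k `&` ideal_pow M k.
have [|||k0 Hk0] := @graded_stable R M W1 NR IM.
- by move=> k; apply: idealI.
- by move=> k x [].
- move=> k x w Mx [Ww Mw]; split; last by rewrite ideal_powS;
    apply: mem_ideal_mul.
  move: x Mx; rewrite Es => x; rewrite mulrC.
  by apply: (ideal_genM (IW k.+1)) => y yys; rewrite mulrC; apply: WS.
exists k0 => k /Hk0 Wk w Ww.
have IG := ideal_gen_is_ideal (graded_step (fun k => U k.+1) W ys k).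
have [x Mx [z Nz e]] := WU _ _ Ww.
have Nk j : N `<=` U j by apply: sub_ideal_addr.
rewrite -e; apply: (idealD IG); last by apply: sub_ideal_gen; left; apply: Nk.
have W1x : W1 k.+1 x.
  split=> //; have -> : x = w - z by rewrite -e addrK.
  by apply: (idealB (IW _)) => //; apply: UW; apply: Nk.
move/Wk: W1x; apply: ideal_mul_sub => // u v; rewrite Es => Mu [Wv _].
rewrite mulrC; apply: (ideal_genM IG) Mu => y yys.
by apply: sub_ideal_gen; right; exists y, v; rewrite mulrC.
Qed.

End HilbertSamuel.

(** * Weak-(FC)-sequences *)

Section RingQuotient.
Variables (A : comPzRingType) (S : set A).
Implicit Types (I J : set A) (x y a : A).
Local Notation K := (ideal_gen S).
Local Notation qpi := (\pi_(ring_quot S)).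

Lemma quot_piD x y : qpi (x + y) = qpi x + qpi y.
Proof. by rewrite -quot_pi_add. Qed.

Lemma quot_piM x y : qpi (x * y) = qpi x * qpi y.
Proof. by rewrite -quot_pi_mul. Qed.

Lemma quot_pi0P x : qpi x = 0 <-> K x.
Proof. by rewrite -[0]/(qpi 0); apply: iff_trans (ring_quotP _ _ _) _;
  rewrite subr0. Qed.

Lemma quot_ideal I : is_ideal I -> is_ideal (quot_set S I).
Proof.
move=> II; split=> [|_ _ [x Ix <-] [y Iy <-]|a _ [x Ix <-]].
- by exists 0; first exact: ideal0.
- by exists (x + y); [exact: idealD|rewrite quot_piD].
- by elim/quotW: a => a; exists (a * x); [exact: idealM|rewrite quot_piM].
Qed.

Lemma quot_setP I a : quot_set S I (qpi a) <-> exists2 i, I i & K (a - i).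
Proof.
split=> [[i Ii /ring_quotP Kia]|[i Ii /ring_quotP e]].
  by exists i => //; apply: (idealBC (ideal_gen_is_ideal S)).
by exists i.
Qed.

Lemma quot_ideal_mul I J :
  ideal_mul (quot_set S I) (quot_set S J) = quot_set S (ideal_mul I J).
Proof.
apply/seteqP; split.
  apply: ideal_mul_sub; first by apply: quot_ideal; apply: ideal_ideal_mul.
  move=> _ _ [x Ix <-] [y Jy <-]; exists (x * y); last by rewrite quot_piM.
  exact: mem_ideal_mul.
have IM := ideal_ideal_mul (quot_set S I) (quot_set S J).
move=> _ [z Iz <-]; move: z Iz; change (ideal_mul I J `<=`
  [set z | ideal_mul (quot_set S I) (quot_set S J) (qpi z)]).
apply: ideal_mul_sub.
  split=> [|x y /= Ix Iy|a x /= Ix]; first exact: (ideal0 IM).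
    by rewrite quot_piD; apply: (idealD IM).
  by rewrite quot_piM; apply: (idealM _ IM).
by move=> x y Ix Jy /=; rewrite quot_piM; apply: mem_ideal_mul;
  [exists x|exists y].
Qed.

Lemma quot_ideal_gen1 x : ideal_gen [set qpi x] = quot_set S (ideal_gen [set
  x]).
Proof.
apply/seteqP; split=> [y /ideal_gen1[b ->]|_ [_ /ideal_gen1[b ->] <-]].
  by elim/quotW: b => b; exists (b * x); [apply/ideal_gen1;
    exists b|rewrite quot_piM].
by apply/ideal_gen1; exists (qpi b); rewrite quot_piM.
Qed.

End RingQuotient.

Section WeakFCElement.
Variables (A : comPzRingType) (S J : set A) (F : nat -> set A) (x : A).
Hypotheses (IJ : is_ideal J) (IF : forall n, is_ideal (F n)).
Hypothesis FCx : weak_FC_element (quot_set S J) (fun n => quot_set S (F n))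
  (\pi_(ring_quot S) x).
Local Notation K := (ideal_gen S).
Let IK : is_ideal K := ideal_gen_is_ideal S.

Lemma weak_FC_nonnilpotent :
  ~ exists n0, forall n, (n0 <= n)%N -> F n `<=` K.
Proof.
case: FCx => _ nn _ _ _ [n0 FK]; apply: nn; exists n0 => n /FK FnK.
apply/seteqP; split=> [_ [y /FnK/quot_pi0P -> <-]//|_ ->].
by exists 0 => //; apply: (ideal0 (IF n)).
Qed.

Lemma weak_FC_colon a : K (a * x) -> saturation K (F 1%N) a.
Proof.
case: FCx => _ _ _ _ /(_ (\pi_(ring_quot S) a)) fc Kax.
have [|n _ Hn] := fc; first by move=> _ ->; rewrite -quot_piM; apply/quot_pi0P.
exists n => // y Fy; apply/quot_pi0P; rewrite quot_piM; apply: Hn.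
have -> : ideal_pow (quot_set S (F 1%N)) n = quot_set S (ideal_pow (F 1%N) n).
  elim: n {y Fy} => [|n IHn]; last by rewrite ideal_powS IHn quot_ideal_mul.
  by apply/seteqP; split=> // y _; elim/quotW: y => y; exists y.
by exists y.
Qed.

(** The cases m = 0 and m = 1 of [FC1], pulled back from the quotient to [A], with congruences
    modulo [K] for equalities. *)
Lemma weak_FC_intersection : exists n0, forall n, (n0 <= n)%N ->
  (forall a b, F n.+1 a -> K (a - x * b) -> exists2 c, F n c & K (a - x * c)) /\
  (forall a j, F n a -> ideal_mul J (F n.+1) j -> K (x * a - j) ->
    exists2 i, ideal_mul J (F n) i & K (x * a - x * i)).
Proof.
have gen1 I : ideal_mul (ideal_gen [set x]) I `<=` [set y | exists2 c,
  ideal_gen I c & y = x * c].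
  apply: ideal_mul_sub.
    have IG := ideal_gen_is_ideal I.
    split=> [|_ _ [c Ic ->] [d Id ->]|b _ [c Ic ->]].
    - by exists 0; [exact: (ideal0 IG)|rewrite mulr0].
    - by exists (c + d); [exact: (idealD IG)|rewrite mulrDr].
    - by exists (b * c); [exact: (idealM _ IG)|rewrite mulrCA].
  move=> _ c /ideal_gen1[b ->] Ic; exists (b * c); last by rewrite mulrCA mulrA.
  by apply: (idealM _ (ideal_gen_is_ideal _)); apply: sub_ideal_gen.
case: FCx => _ _ _ [n0 fc] _; exists n0 => n nn;
  split=> [a b Fa Kab|a j Fa Jj Kaj].
  have := fc n nn 0%N; rewrite quot_ideal_gen1 !quot_ideal_mul !ideal_mulT;
    first last.
  - exact: quot_ideal.
  - by apply: quot_ideal; apply: ideal_ideal_mul.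
  move=> /(congr1 (fun X => X (\pi_(ring_quot S) a))) e.
  have : quot_set S (ideal_mul (ideal_gen [set x]) (F n)) (\pi_(ring_quot S) a).
    rewrite -e; split; first by exists a.
    by apply/quot_setP; exists (x * b) => //; apply/ideal_gen1; exists b;
      rewrite mulrC.
  move=> /quot_setP[_ /gen1[c Fc ->] Kac]; exists c => //.
  by rewrite (ideal_gen_id (IF n)) in Fc.
have := fc n nn 1%N; rewrite quot_ideal_gen1 quot_ideal_mul ideal_pow1;
  last exact: quot_ideal.
rewrite !quot_ideal_mul => /(congr1 (fun X => X (\pi_(ring_quot S) (x * a)))) e.
have : quot_set S (ideal_mul J (ideal_mul (ideal_gen [set x]) (F n)))
  (\pi_(ring_quot S) (x * a)).
  rewrite -e; split; first by apply/quot_setP; exists j.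
  by exists (x * a) => //; apply/ideal_gen1; exists a; rewrite mulrC.
move=> /quot_setP[i]; rewrite ideal_mulA [ideal_mul J _]ideal_mulC -ideal_mulA.
move=> /gen1[c Fc ->] Kac; exists c => //.
by rewrite (ideal_gen_id (ideal_ideal_mul J (F n))) in Fc.
Qed.

End WeakFCElement.

(** * Good filtrations *)

Section GoodFiltration.
Variables (A : comPzRingType) (F : nat -> set A).
Hypothesis goodF : is_good F.

Lemma good_ideal n : is_ideal (F n).
Proof. by case: goodF => -[]. Qed.

Lemma good_filt0 : F 0%N = setT.
Proof. by case: goodF => -[]. Qed.

Lemma good_mul m n a b : F m a -> F n b -> F (m + n)%N (a * b).
Proof.
by case: goodF => -[_ _ _ _ FM] _ Fa Fb; apply: FM; apply: mem_ideal_mul.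
Qed.

Lemma good_mul1 a n b : F 1%N a -> F n b -> F n.+1 (a * b).
Proof. exact: good_mul. Qed.

(** An ideal for which [F] is good lies in [F 1], since [F 0] is the whole ring. *)
Lemma good_stable : exists n0, forall n, (n0 <= n)%N ->
  F n.+1 `<=` ideal_mul (F 1%N) (F n).
Proof.
case: goodF => -[FI F0 _ _ FM] [I [II IF [n0 H]]].
exists n0 => n /H ->; apply: ideal_mulS => // x Ix.
by rewrite -[x]mulr1; apply: IF; apply: mem_ideal_mul; rewrite ?F0.
Qed.

Lemma good_stable_pow : exists n0, forall n k, (n0 <= n)%N ->
  F (k + n)%N `<=` ideal_mul (ideal_pow (F 1%N) k) (F n).
Proof.
have [n0 H] := good_stable; exists n0 => n k nn; elim: k => [|k IHk].
  by rewrite ideal_mulT //; apply: good_ideal.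
rewrite addSn ideal_powS -ideal_mulA.
apply: subset_trans (H _ (leq_trans nn (leq_addl k n))) _.
exact: ideal_mulS.
Qed.

Lemma good_sub_pow k : exists n0, forall n, (n0 <= n)%N ->
  F n `<=` ideal_pow (F 1%N) k.
Proof.
have [n0 H] := good_stable_pow; exists (k + n0)%N => n nn.
rewrite -(subnKC (leq_trans (leq_addr n0 k) nn)).
apply: subset_trans (H _ _ _) _; first by rewrite -(leq_add2l k) subnKC //
  (leq_trans (leq_addr n0 k)).
by apply: ideal_mul_subl; apply: ideal_ideal_pow.
Qed.

End GoodFiltration.

(** * Fiber cones modulo initial segments of the sequence *)

Section WeakFCSequence.
Variables (A : comNzRingType) (m J : set A) (F : nat -> set A) (xs : seq A).
Hypotheses (NA : noetherian A) (mloc : is_local m) (Jm : primary_to m J).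
Hypotheses (goodF : is_good F) (FCxs : weak_FC_sequence J F xs).
Let IF n : is_ideal (F n) := good_ideal goodF n.

Definition fc_ideal i := ideal_gen [set` take i xs].
Local Notation K := fc_ideal.
(* [F n / fc_fiber i n] is the degree [n] component of the fiber cone of the
   filtration induced by [F] on [A / (x_1, .., x_i)]. *)
Definition fc_fiber i n := ideal_add (ideal_mul J (F n)) (K i `&` F n).
Local Notation D := fc_fiber.

Let IJ : is_ideal J. Proof. by case: Jm => -[]. Qed.
Lemma ideal_fc_ideal i : is_ideal (K i). Proof. exact: ideal_gen_is_ideal. Qed.
Let IK := ideal_fc_ideal.
Let IJF n : is_ideal (ideal_mul J (F n)). Proof. exact: ideal_ideal_mul. Qed.
Let IKF i n : is_ideal (K i `&` F n). Proof. exact: idealI. Qed.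
Lemma ideal_fc_fiber i n : is_ideal (D i n). Proof. exact: ideal_ideal_add. Qed.
Let ID := ideal_fc_fiber.

Lemma primary_sub : J `<=` m.
Proof. by case: Jm => _ <- x Jx; exists 1%N; rewrite expr1. Qed.

Lemma primary_pow : exists c, ideal_pow m c `<=` J.
Proof.
have Im := local_ideal mloc; case: Jm => _ Jrad.
by apply: (ideal_pow_sub_radical NA Im IJ); rewrite Jrad.
Qed.

Lemma sub_fc_ideal i : K i `<=` F 1%N.
Proof.
apply: (ideal_gen_sub (IF 1)) => x /= /mem_take xxs.
by case: FCxs => H _; apply: H.
Qed.

Lemma fc_ideal0 : K 0 = [set 0].
Proof. by rewrite /K take0 ideal_gen_nil. Qed.

Lemma fc_fiber0 n : D 0 n = ideal_mul J (F n).
Proof.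
rewrite /D fc_ideal0; apply/seteqP; split; last by apply: sub_ideal_addl;
  rewrite -fc_ideal0.
by apply: ideal_add_sub => // _ [-> _]; apply: (ideal0 (IJF n)).
Qed.

Lemma fc_fiber_sub i n : D i n `<=` F n.
Proof.
by apply: ideal_add_sub => //; apply: ideal_mul_subr.
Qed.

Lemma fc_fiber_mul p i n a b : F p a -> D i n b -> D i (p + n) (a * b).
Proof.
move=> Fa [j Jj [k [Kk Fk] <-]]; rewrite mulrDr; exists (a * j).
  apply: (ideal_genM (IJF _)) Jj => _ [y Jy [z Fz <-]].
  by rewrite mulrCA; apply: mem_ideal_mul => //; apply: (good_mul goodF).
exists (a * k) => //; split; first exact: (idealM _ (IK i)).
exact: (good_mul goodF).
Qed.

(** Since [J] lies in [m], Nakayama's lemma turns the vanishing of a fiber cone in large degrees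
    into nilpotency of [F] modulo [K i], which [fc_nonnilpotent] forbids. *)
Lemma fc_nakayama i : (exists n0, forall n, (n0 <= n)%N -> F n `<=` D i n) ->
  exists n0, forall n, (n0 <= n)%N -> F n `<=` K i.
Proof.
move=> [n0 H]; exists n0 => n /H FD.
apply: (nakayama mloc NA (IF n) (IK i)); apply: subset_trans FD _.
apply: ideal_addS => [|x []//].
by apply: ideal_mulS => //; apply: primary_sub.
Qed.

(** For large [n], [F n] lies in a power of [F 1] so high that the saturation adds nothing to [K i]
    there. *)
Lemma fc_artin_rees i : exists n0, forall n, (n0 <= n)%N ->
  forall a, F n a -> saturation (K i) (F 1%N) a -> K i a.
Proof.
have [k0 Hk] := artin_rees_saturation NA (IF 1) (IK i).
have [n0 Hn] := good_sub_pow goodF k0.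
exists n0 => n /Hn FP a /FP Pa Sa; exact: (Hk k0).
Qed.

Section Step.
Variable i : nat.
Hypothesis ilt : (i < size xs)%N.
Local Notation x := (xs`_i).

Let FCi := (FCxs.2 i ilt).

Lemma fc_elem : F 1%N x. Proof. by apply: FCxs.1; apply: mem_nth. Qed.

Lemma fc_ideal_elem : K i.+1 x.
Proof. by apply: sub_ideal_gen; rewrite /= (take_nth 0 ilt) mem_rcons mem_head.
  Qed.

Lemma fc_ideal_incr : K i `<=` K i.+1.
Proof.
apply: ideal_genS => y yi; rewrite /= (take_nth 0 ilt) mem_rcons inE.
by rewrite (yi : is_true (y \in take i xs)) orbT.
Qed.

Lemma fc_ideal_succ a : K i.+1 a -> exists b, K i (a - x * b).
Proof.
by rewrite /K (take_nth 0 ilt) => /ideal_gen_rcons[b]; exists b; rewrite mulrC.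
Qed.

Lemma fc_nonnilpotent : ~ exists n0, forall n, (n0 <= n)%N -> F n `<=` K i.
Proof. exact: (weak_FC_nonnilpotent IF FCi). Qed.

Lemma fc_colon a : K i (a * x) -> saturation (K i) (F 1%N) a.
Proof. exact: (weak_FC_colon FCi). Qed.

Lemma fc_intersection : exists n0, forall n, (n0 <= n)%N ->
  (forall a, F n.+1 a -> K i.+1 a -> exists2 c, F n c & K i (a - x * c)) /\
  (forall a j, F n a -> ideal_mul J (F n.+1) j -> K i (x * a - j) ->
    exists2 t, ideal_mul J (F n) t & K i (x * a - x * t)).
Proof.
have [n0 H] := weak_FC_intersection IJ IF FCi; exists n0 => n /H[H1 H2].
split=> // a Fa /fc_ideal_succ[b Kab]; exact: H1 Kab.
Qed.

(** This is the case m = 0 of [FC1]. With [fc_fiber_regular] it has the shape that [is_length_scale]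
    requires. *)
Lemma fc_fiber_succ : exists n0, forall n, (n0 <= n)%N ->
  D i.+1 n.+1 = ideal_add [set x * a | a in F n] (D i n.+1).
Proof.
have [n0 H] := fc_intersection; exists n0 => n /H[H1 _]; apply/seteqP; split.
  have IS := ideal_scale x (IF n) (ID i n.+1).
  apply: ideal_add_sub => //.
    move=> y Jy; apply: sub_ideal_addr; first exact: ideal_image_scale.
    exact: sub_ideal_addl.
  move=> y [Ky Fy]; have [c Fc Kc] := H1 y Fy Ky.
  exists (x * c); first by exists c.
  exists (y - x * c); last by rewrite addrC subrK.
  apply: sub_ideal_addr => //; split=> //; apply: (idealB (IF _)) => //.
  exact: (good_mul1 goodF fc_elem).
apply: ideal_add_sub; first exact: ID.
  move=> _ [c Fc <-]; apply: sub_ideal_addr => //; split.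
    by apply: (idealMr _ (IK _)); apply: fc_ideal_elem.
  exact: (good_mul1 goodF fc_elem).
by apply: ideal_addS => // y [/fc_ideal_incr Ky Fy].
Qed.

(** If x a lies in J F_(n+1) modulo K_i, the case m = 1 of [FC1] gives x a = x t modulo K_i with t
    in J F_n. Then a - t lies in the saturation by [FC2], and for large n in K_i itself. *)
Lemma fc_fiber_regular : exists n0, forall n, (n0 <= n)%N ->
  D i n = [set a | F n a /\ D i n.+1 (x * a)].
Proof.
have [n1 H1] := fc_intersection; have [n2 H2] := fc_artin_rees i.
exists (maxn n1 n2) => n; rewrite geq_max => /andP[/H1[_ {}H1] /H2 {}H2].
apply/seteqP; split=> [a Da|a [Fa [j Jj [k [Kk Fk] e]]]].
  by split; [exact: fc_fiber_sub Da|apply: (fc_fiber_mul (p := 1)) Da;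
    apply: fc_elem].
have [|t Jt Kt] := H1 a j Fa Jj; first by rewrite -e addrC addKr.
have Ft : F n t by apply: ideal_mul_subr Jt.
have Fat : F n (a - t) by apply: (idealB (IF n)).
exists t => //; exists (a - t); last by rewrite addrC subrK.
split=> //; apply: H2 => //; apply: fc_colon.
by rewrite mulrC mulrBr.
Qed.

End Step.

(** By [FC1], an element of K_(i+1) in F_(n+1) is x c modulo K_i with c in F_n; the remainder is
    again in F_(n+1), so the induction applies to it. *)
Lemma fc_ideal_filt i : (i <= size xs)%N -> exists n0, forall n, (n0 <= n)%N ->
  K i `&` F n.+1 `<=` ideal_mul (K i) (F n).
Proof.
elim: i => [_|i IHi ilt].
  exists 0%N => n _ x; rewrite fc_ideal0 => -[-> _];
    exact: (ideal0 (ideal_ideal_mul _ _)).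
have [n1 H1] := IHi (ltnW ilt); have [n2 H2] := fc_intersection ilt.
exists (maxn n1 n2) => n; rewrite geq_max => /andP[/H1{}H1 /H2[{}H2 _]] a [Ka
  Fa].
have [c Fc Kc] := H2 a Fa Ka.
have Im := ideal_ideal_mul (K i.+1) (F n).
apply: (idealBr Im (y := xs`_i * c)).
  apply: ideal_mulS (H1 _ _) => //; first exact: fc_ideal_incr.
  split=> //; apply: (idealB (IF _)) => //;
    exact: (good_mul1 goodF (fc_elem ilt)).
by apply: mem_ideal_mul => //; apply: fc_ideal_elem.
Qed.

(** With K the ideal of the whole sequence, F_(n+1) lies in m F_(n+1) + K F_n by [fc_ideal_filt],
    and Nakayama's lemma removes the first term. *)
Lemma fc_reduction : (exists n0, forall n, (n0 <= n)%N ->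
  F n `<=` D (size xs) n) ->
  exists n0, stable_from (K (size xs)) F n0.
Proof.
move=> [n1 H1]; have [n2 H2] := fc_ideal_filt (leqnn (size xs)).
exists (maxn n1 n2) => n; rewrite geq_max => /andP[n1n n2n].
apply/seteqP; split.
  by apply: ideal_mul_sub => // x y /sub_fc_ideal; apply: (good_mul1 goodF).
apply: (nakayama mloc NA (IF _) (ideal_ideal_mul _ _)).
apply: subset_trans (H1 _ (leqW n1n)) _; apply: ideal_addS; last exact: H2.
by apply: ideal_mulS => //; apply: primary_sub.
Qed.

Lemma fc_fiber_length i n : exists k, is_length (F n) (D i n) k.
Proof.
have [c Hc] := primary_pow; case: mloc => Mm _.
apply: (is_length_finite (n := m) (c := c)) => //; first exact: fc_fiber_sub.
by apply: subset_trans (sub_ideal_addl _) => //; apply: ideal_mulS.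
Qed.

(* Write [E n] for the ideal by which [F n] is divided.  For [n >= r] the last
   element of the sequence is a nonzerodivisor modulo the saturation and
   generates [F n.+1] over [F n] modulo it, so that multiplying by it identifies
   [F n / E n] with [F n.+1 / E n.+1]. *)
Lemma fc_saturation_length i r : (i < size xs)%N -> size xs = i.+1 ->
  stable_from (K i.+1) F r -> exists e, forall n, (r <= n)%N ->
    is_length (F n) (ideal_add (saturation (K i) (F 1%N) `&` F n) (ideal_mul J
      (F n))) e.
Proof.
move=> ilt sxs st; set S := saturation _ _.
have IS : is_ideal S by apply: ideal_saturation.
pose E n := ideal_add (S `&` F n) (ideal_mul J (F n)).
have ISF n : is_ideal (S `&` F n) by apply: idealI.
have IE n : is_ideal (E n) by apply: ideal_ideal_add.
have KS : K i `<=` S by apply: sub_saturation.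
have Sx a : S (xs`_i * a) -> S a.
  (* The exponent that [fc_colon] provides depends on [y]; finitely many generators of the k-th
     power of [F 1] make it uniform. *)
  move=> [k _ Hk]; have [k' _ Hk'] : exists2 k', True & forall y, ideal_pow (F
    1%N) k y ->
      forall z, ideal_pow (F 1%N) k' z -> K i (a * y * z).
    have [s Es] := NA (ideal_ideal_pow (F 1%N) k).
    have [k' Hk'] : exists k', forall y : A, y \in s ->
        forall z, ideal_pow (F 1%N) k' z -> K i (a * y * z).
      apply: (seq_bounded (P := fun y k' => forall z, ideal_pow (F 1%N) k' z ->
        K i (a * y * z))).
        by move=> y p q pq H z /(ideal_pow_decr pq); apply: H.
      move=> y ys; have [|k' _ Hk'] := @fc_colon i ilt (a * y).
        rewrite mulrAC [a * _]mulrC; apply: Hk; rewrite Es;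
          exact: sub_ideal_gen.
      by exists k' => z; apply: Hk'.
    exists k' => // y; rewrite Es => sy z Pz; rewrite -mulrA [y * z]mulrC mulrA.
    by apply: (ideal_genM (IK i)) sy => t ts; rewrite mulrAC; apply: Hk'.
  exists (k + k')%N => // y; rewrite ideal_powD; apply: (ideal_genM (IK i)).
  by move=> _ [u Pu [v Pv <-]]; rewrite mulrA; apply: Hk'.
have x1 := fc_elem ilt.
have step n : (r <= n)%N ->
    F n.+1 = ideal_add [set xs`_i * a | a in F n] (E n.+1) /\
    E n = [set a | F n a /\ E n.+1 (xs`_i * a)].
  (* An element of K_(i+1) I is x c with c in I, up to an element of K_i I. This serves for I = F_n
     and for I = J F_n. *)
  move=> /st Fn; have decomp I L : is_ideal I -> is_ideal L ->
      (forall a b, I b -> K i a -> L (a * b)) ->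
      forall y, ideal_mul (K i.+1) I y -> exists2 c, I c & L (y - xs`_i * c).
    move=> II IL KIL; change (ideal_mul (K i.+1) I `<=`
      [set y | exists2 c, I c & L (y - xs`_i * c)]).
    apply: ideal_mul_sub.
      split=> [|y z [c Ic Lc] [d Id Ld]|b y [c Ic Lc]].
      - by exists 0; [exact: ideal0|rewrite mulr0 subr0; apply: ideal0].
      - exists (c + d); first exact: idealD.
        by rewrite mulrDr opprD addrACA; apply: idealD.
      - exists (b * c); first exact: idealM.
        by rewrite mulrCA -mulrBr; apply: idealM.
    move=> y z /(fc_ideal_succ ilt)[b Kb] Iz; exists (b * z);
      first exact: idealM.
    by rewrite mulrA -mulrBl; apply: KIL.
  split.
    apply/seteqP; split; last first.
      apply: ideal_add_sub => // [_ [a Fa <-]|]; first exact: (good_mul1 goodF).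
      by apply: ideal_add_sub => //; apply: ideal_mul_subr.
    move=> y; rewrite -{1}Fn => /(decomp _ (S `&` F n.+1) (IF n))[||c Fc Lc] //.
      move=> a b Fb Ka; split; first by apply: (idealMr _ IS); apply: KS.
      by apply: (good_mul1 goodF) => //; apply: sub_fc_ideal Ka.
    exists (xs`_i * c); first by exists c.
    exists (y - xs`_i * c); last by rewrite addrC subrK.
    exact: sub_ideal_addl.
  apply/seteqP; split=> a.
    move=> [s [Ss Fs] [j Jj <-]].
    have Fj : F n j by apply: ideal_mul_subr Jj.
    split; first exact: (idealD (IF n)).
    rewrite mulrDr; exists (xs`_i * s).
      by split; [exact: (idealM _ IS)|exact: (good_mul1 goodF)].
    exists (xs`_i * j) => //; apply: (ideal_genM (IJF _)) Jj => _ [y Jy [z Fz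
      <-]].
    by rewrite mulrCA; apply: mem_ideal_mul => //; apply: (good_mul1 goodF).
  move=> [Fa [s [Ss Fs] [j Jj e]]].
  (* J F_(n+1) equals K_(i+1) J F_n, so [j] is x c modulo K_i with c in J F_n, and x (a - c) lies in
     the saturation. *)
  have [||||c Jc Lc] := decomp (ideal_mul J (F n)) (K i) _ _ _ j.
  - exact: IJF.
  - exact: IK.
  - by move=> b d _ Kb; apply: (idealMr _ (IK i)).
  - move: Jj; rewrite -Fn ideal_mulA [ideal_mul J _]ideal_mulC -ideal_mulA;
      exact.
  have Fc : F n c by apply: ideal_mul_subr Jc.
  have Sac : S (a - c).
    apply: Sx; rewrite mulrBr -e -addrA; apply: (idealD IS) => //.
    exact: KS.
  exists (a - c); last by exists c => //; rewrite subrK.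
  by split=> //; apply: (idealB (IF n)).
have EF n : E n `<=` F n.
  by apply: ideal_add_sub => //; apply: ideal_mul_subr.
have [e le] : exists e, is_length (F r) (E r) e.
  have [c Hc] := primary_pow; case: mloc => Mm _.
  apply: (is_length_finite (n := m) (c := c)) => //.
  by apply: subset_trans (sub_ideal_addr _) => //; apply: ideal_mulS.
exists e => n /subnK <-; elim: (n - r)%N => [//|k IHk].
have [F1 E1] := step (k + r)%N (leq_addl _ _).
exact/(is_length_scale e (IF _) (IE _) F1 E1).
Qed.

Lemma fc_saturation_eq i : (i < size xs)%N ->
  exists n0, forall n, (n0 <= n)%N ->
  ideal_add (saturation (K i) (F 1%N) `&` F n) (ideal_mul J (F n)) = D i n.
Proof.
move=> ilt; have [n0 H] := fc_artin_rees i; exists n0 => n /H{}H.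
rewrite /D [RHS]ideal_addC; congr (ideal_add _ _).
apply/seteqP; split=> x [Sx Fx]; split=> //; first exact: H.
exact: sub_saturation.
Qed.

End WeakFCSequence.

(** * The Rees algebra *)

Section ReesAlgebra.
Variables (A : comNzRingType) (F : filtration A).
Hypothesis goodF : is_good F.
Local Notation R := (rees F).
Local Notation coef p n := ((rees_poly p)`_n).
Let IF n : is_ideal (F n) := good_ideal goodF n.
Implicit Types (p q : R) (a b : A) (d : nat -> set A).

Lemma rees_coefP p n : F n (coef p n).
Proof. by case: p => p Fp /=; move/asboolP: Fp. Qed.

Lemma rees_polyD p q : rees_poly (p + q) = rees_poly p + rees_poly q.
Proof. by []. Qed.

Lemma rees_polyM p q : rees_poly (p * q) = rees_poly p * rees_poly q.
Proof. by []. Qed.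

Lemma rees_poly0 : rees_poly (0 : R) = 0. Proof. by []. Qed.
Lemma rees_poly1 : rees_poly (1 : R) = 1. Proof. by []. Qed.

Lemma rees_poly_inj : injective (@rees_poly _ F).
Proof. exact: val_inj. Qed.

(** The homogeneous element a t^n; the default 0 is taken when [a] is not in [F n]. *)
Definition rees_mono n a : R := insubd 0 (a *: 'X^n).

Lemma rees_monoE n a : F n a -> rees_poly (rees_mono n a) = a *: 'X^n.
Proof.
move=> Fa; rewrite /rees_mono [LHS]val_insubd; case: ifP => // /negP[].
apply/asboolP => k.
by rewrite coefZ coefXn; case: eqP => [->|_]; rewrite ?mulr1 ?mulr0 //;
  apply: (ideal0 (IF _)).
Qed.

Lemma coef_rees_mono n a k : F n a -> coef (rees_mono n a) k = if k == n then a
  else 0.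
Proof. by move=> /rees_monoE ->; rewrite coefZ coefXn; case: eqP;
  rewrite ?mulr1 ?mulr0. Qed.

Lemma rees_monoD n a b : F n a -> F n b ->
  rees_mono n (a + b) = rees_mono n a + rees_mono n b.
Proof.
move=> Fa Fb; apply: rees_poly_inj; rewrite rees_polyD !rees_monoE ?scalerDl //.
exact: (idealD (IF n)).
Qed.

Lemma rees_monoM k n a b : F k a -> F n b ->
  rees_mono (k + n) (a * b) = rees_mono k a * rees_mono n b.
Proof.
move=> Fa Fb; apply: rees_poly_inj; rewrite rees_polyM !rees_monoE //.
  by rewrite -scalerAl -scalerAr scalerA exprD.
exact: (good_mul goodF).
Qed.

Lemma rees_mono0 n : rees_mono n 0 = 0.
Proof. by apply: rees_poly_inj; rewrite rees_monoE ?scale0r //;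
  apply: (ideal0 (IF _)). Qed.

Lemma rees_sum p : p = \sum_(i < size (rees_poly p)) rees_mono i (coef p i).
Proof.
apply: rees_poly_inj; rewrite (big_morph _ rees_polyD rees_poly0).
rewrite -[LHS]coefK poly_def; apply: eq_bigr => i _.
by rewrite rees_monoE //; apply: rees_coefP.
Qed.

Lemma rees_ideal_sum (X : set R) p : is_ideal X ->
  (forall n, X (rees_mono n (coef p n))) -> X p.
Proof. by move=> IX Xp; rewrite [p]rees_sum; apply: (ideal_sum _ IX). Qed.

Lemma rees_exists (p : {poly A}) : (forall n, F n p`_n) ->
  exists q : R, rees_poly q = p.
Proof. by move=> Fp; exists (Rees (asboolT Fp)). Qed.

Definition comp_ideal d : set R := [set p | forall n, d n (coef p n)].

Lemma ideal_comp_ideal d : (forall n, is_ideal (d n)) ->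
  (forall k n a b, F k a -> d n b -> d (k + n)%N (a * b)) ->
    is_ideal (comp_ideal d).
Proof.
move=> Id dM; split=> [n|p q dp dq n|p q dq n].
- by rewrite rees_poly0 coef0; apply: (ideal0 (Id n)).
- by rewrite rees_polyD coefD; apply: (idealD (Id n)).
- rewrite rees_polyM coefM; apply: (ideal_sum _ (Id n)) => i _.
  rewrite -{1}(subnKC (ltn_ord i : i <= n)%N); apply: dM => //;
    exact: rees_coefP.
Qed.

Lemma comp_ideal_mono d n a : (forall k, is_ideal (d k)) -> F n a ->
  comp_ideal d (rees_mono n a) <-> d n a.
Proof.
move=> Id Fa; split=> [/(_ n)|da k]; rewrite coef_rees_mono // ?eqxx //.
by case: eqP => [->//|_]; apply: (ideal0 (Id k)).
Qed.

(** Beyond degree [n0] the filtration is generated by products with [F 1], so finitely many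
    monomials generate the Rees algebra over A. It is thus the image of a Noetherian ring [B], and
    generators of an ideal come from those of its preimage. *)
Lemma noetherian_rees : noetherian A -> noetherian R.
Proof.
move=> NA U IU; have [n0 Hn0] := good_stable goodF.
(* Degree 1 is always included, even if [n0] is 0, because the products with [F 1] use it. *)
have [s [sR Hs]] : exists s : seq {poly A}, [set` s] `<=` [set p | forall n, F
  n p`_n] /\
    forall n, (n <= maxn n0 1)%N -> exists t : seq A, F n = ideal_gen [set` t]
      /\
      forall g : A, g \in t -> g *: 'X^n \in s.
  elim: (maxn n0 1) => [|N [s [sR Hs]]].
    have [t Et] := NA _ (IF 0); exists [seq g *: 'X^0 | g <- t]; split.
      move=> _ /mapP[g gt ->] n; rewrite coefZ coefXn; case: eqP => [->|_].
        by rewrite mulr1 Et; apply: sub_ideal_gen.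
      by rewrite mulr0; apply: (ideal0 (IF n)).
    move=> n; rewrite leqn0 => /eqP ->; exists t; split=> // g gt.
    by apply/mapP; exists g.
  have [t Et] := NA _ (IF N.+1); exists ([seq g *: 'X^(N.+1) | g <- t] ++ s);
    split.
    move=> p /=; rewrite mem_cat => /orP[/mapP[g gt ->] n|]; last exact: sR.
    rewrite coefZ coefXn; case: eqP => [->|_].
      by rewrite mulr1 Et; apply: sub_ideal_gen.
    by rewrite mulr0; apply: (ideal0 (IF n)).
  move=> n; rewrite leq_eqVlt => /predU1P[->|nN].
    exists t; split=> // g gt; rewrite mem_cat; apply/orP; left.
    by apply/mapP; exists g.
  have [t' [Et' Ht']] := Hs n nN; exists t'; split=> // g /Ht'.
  by rewrite mem_cat orbC => ->.
have [B [phi [NB cphi sphi phiT]]] :=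
  @noetherian_adjoin {poly A} A (polyC : {rmorphism A -> {poly A}}) s NA.
have {}cphi c : range phi c%:P by apply: cphi; exists c.
have Imono n := @ideal_monomial A B phi n cphi.
have mono n a : F n a -> range phi (a *: 'X^n).
  have low k : (k <= maxn n0 1)%N -> F k `<=` [set a : A | range phi (a *:
    'X^k)].
    move=> /Hs[t [-> Ht]]; apply: (ideal_gen_sub (Imono k)) => g gt.
    by apply: sphi; apply: Ht.
  elim: n a => [|n IHn] a; first exact: low.
  have [/low|] := leqP n.+1 (maxn n0 1); first exact.
  rewrite ltnS geq_max => /andP[/Hn0 Fn _] /Fn.
  move: a; change (ideal_mul (F 1%N) (F n) `<=` [set a : A | range phi (a *:
    'X^(n.+1))]).
  apply: (ideal_mul_sub (Imono _)) => x y /(low 1%N (leq_maxr n0 1))[b _ eb]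
    /IHn[c _ ec].
  exists (b * c) => //=; rewrite rmorphM eb ec.
  by rewrite -scalerAl -scalerAr -exprD scalerA.
have phiR (b : B) : exists p, rees_poly p = phi b.
  apply: rees_exists; suff : range phi `<=` [set p | forall k, F k p`_k] by
    apply; exists b.
  apply: phiT => // [|_ [c _ <-] j /=].
    split=> p q Tp Tq j; first by rewrite coefD; apply: (idealD (IF j)).
    rewrite coefM; apply: (ideal_sum _ (IF j)) => i _.
    by rewrite -{1}(subnKC (ltn_ord i : i <= j)%N); apply: (good_mul goodF).
  by rewrite coefC; case: j => [|j] /=; [rewrite good_filt0|apply: (ideal0 (IF
    _))].
have surj p : exists b : B, phi b = rees_poly p.
  suff [b _ eb] : range phi (rees_poly p) by exists b.
  rewrite -[rees_poly p]coefK poly_def; elim/big_rec: _ => [|i _ _ [c _ <-]].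
    by exists 0; rewrite ?rmorph0.
  have [b _ <-] := mono i _ (rees_coefP p i).
  by exists (b + c); rewrite ?rmorphD.
pose U' := [set b : B | exists2 p, U p & rees_poly p = phi b].
have IU' : is_ideal U'.
  split=> [|b c [p Up ep] [q Uq eq]|b c [p Up ep]].
  - by exists 0; [exact: ideal0|rewrite rmorph0].
  - by exists (p + q); [exact: idealD|rewrite rmorphD rees_polyD ep eq].
  - have [q eq] := phiR b; exists (q * p); first exact: idealM.
    by rewrite rmorphM rees_polyM ep eq.
have [t Et] := NB _ IU'.
have [b|u [uU uP]] := @seq_lift _ _ (fun (b : B) p => U p /\ rees_poly p = phi
  b) t.
  move=> bt; have [p Up ep] : U' b by rewrite Et; apply: sub_ideal_gen.
  by exists p.
exists u; have Iu := ideal_gen_is_ideal [set` u].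
apply/seteqP; split; last by apply: (ideal_gen_sub IU) => p /uU[b []].
move=> p Up; have [b eb] := surj p.
have : U' b by exists p.
rewrite Et => gb.
suff [q gq eq] : [set b : B | exists2 q, ideal_gen [set` u] q & rees_poly q =
  phi b] b.
  by have -> : p = q by apply: rees_poly_inj; rewrite eq.
move: gb; apply: ideal_gen_sub.
  split=> [|b1 c1 [q Uq eq] [r Ur er]|b1 c1 [r Ur er]].
  - by exists 0; [exact: (ideal0 Iu)|rewrite rmorph0].
  - by exists (q + r); [exact: (idealD Iu)|rewrite rmorphD rees_polyD er eq].
  - have [q eq] := phiR b1; exists (q * r); first exact: (idealM _ Iu).
    by rewrite rmorphM rees_polyM er eq.
by move=> c /uP[q qu [_ eq]]; exists q => //; apply: sub_ideal_gen.
Qed.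

End ReesAlgebra.

(** * Lengths of quotients of the Rees algebra *)

Section ReesLength.
Variables (A : comNzRingType) (m J : set A) (F : filtration A).
Hypotheses (NA : noetherian A) (mloc : is_local m) (Jm : primary_to m J).
Hypothesis goodF : is_good F.
Local Notation R := (rees F).
Local Notation coef p n := ((rees_poly p)`_n).
Local Notation mono := (rees_mono F).
Let IF n : is_ideal (F n) := good_ideal goodF n.
Let Im : is_ideal m := local_ideal mloc.
Let IJF n : is_ideal (ideal_mul J (F n)). Proof. exact: ideal_ideal_mul. Qed.
Let JF_F n : ideal_mul J (F n) `<=` F n. Proof. exact: ideal_mul_subr. Qed.
Implicit Types (p q : R) (a b : A).

Lemma ideal_mul_filt (I : set A) k n a b :
  F k a -> ideal_mul I (F n) b -> ideal_mul I (F (k + n)%N) (a * b).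
Proof.
move=> Fa; apply: (ideal_genM (ideal_ideal_mul _ _)) => _ [y Iy [z Fz <-]].
by rewrite mulrCA; apply: mem_ideal_mul => //; apply: (good_mul goodF).
Qed.

Definition rees_max : set R := [set p | m (coef p 0)].
Definition rees_fiber : set R := [set p | forall n, ideal_mul J (F n) (coef p
  n)].
Local Notation M := rees_max.

Lemma ideal_rees_fiber : is_ideal rees_fiber.
Proof. by apply: (ideal_comp_ideal IJF) => k n a b Fa; apply: ideal_mul_filt.
  Qed.

Lemma rees_max_maximal : is_maximal M.
Proof.
have IM : is_ideal M.
  split=> [|p q Mp Mq|p q Mq]; rewrite /rees_max /mkset.
  - by rewrite rees_poly0 coef0; apply: ideal0.
  - by rewrite rees_polyD coefD; apply: idealD.
  - by rewrite rees_polyM coef0M; apply: idealM.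
have M1 : is_proper M.
  by rewrite /is_proper /rees_max /mkset rees_poly1 coef1 /=; case: mloc => -[].
split=> // K IK K1 MK; apply/seteqP; split=> // p Kp; apply: contrapT => Mp.
have [y ey] := local_unit mloc Mp.
have F0 a : F 0%N a by rewrite (good_filt0 goodF).
apply: K1; rewrite -(subrK (mono 0 y * p) 1); apply: (idealD IK);
  last exact: idealM.
apply: MK; rewrite /rees_max /mkset.
suff -> : coef (1 - mono 0 y * p) 0 = 0 by exact: ideal0.
have -> : rees_poly (1 - mono 0 y * p) = 1 - rees_poly (mono 0 y) * rees_poly p
  by [].
by rewrite rees_monoE // coefB coef1 coef0M coefZ coefXn /= mulr1 ey subrr.
Qed.

Let IM : is_ideal M. Proof. by case: rees_max_maximal. Qed.

Lemma rees_fiber_sub_max : rees_fiber `<=` M.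
Proof.
move=> p /(_ 0%N); rewrite (good_filt0 goodF) ideal_mulIT;
  last by case: Jm => -[].
exact: (primary_sub Jm).
Qed.

Lemma rees_max_mono n a : (0 < n)%N -> F n a -> M (mono n a).
Proof.
move=> n0 Fa; rewrite /rees_max /mkset coef_rees_mono // eq_sym gtn_eqF //;
  exact: ideal0.
Qed.

(** Generated in degree 1 only, hence possibly smaller than the ideal of all elements of positive
    degree. Still, for some constant c, its k-th power contains everything of degree at least k + c,
    because F_(k+n) = F_1^k F_n for large n. *)
Definition rees_irr : set R := ideal_gen [set mono 1 a | a in F 1%N].

Lemma rees_irr_sub_max : rees_irr `<=` M.
Proof. by apply: ideal_gen_sub => // _ [a Fa <-]; apply: rees_max_mono. Qed.

Lemma filt_pow_sub k : ideal_pow (F 1%N) k `<=` F k.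
Proof.
elim: k => [|k IHk]; first by rewrite (good_filt0 goodF).
by apply: (ideal_mul_sub (IF _)) => x y Fx /IHk; apply: (good_mul1 goodF).
Qed.

Lemma rees_irr_pow k n a : ideal_mul (ideal_pow (F 1%N) k) (F n) a ->
  ideal_pow rees_irr k (mono (k + n) a).
Proof.
have IP j : is_ideal (ideal_pow rees_irr j) by apply: ideal_ideal_pow.
have Imono j i : is_ideal [set a | F j a /\ ideal_pow rees_irr i (mono j a)].
  split=> [|x y [Fx Px] [Fy Py]|b x [Fx Px]].
  - by split; [exact: (ideal0 (IF j))|rewrite rees_mono0 //;
      apply: (ideal0 (IP i))].
  - by split; [exact: (idealD (IF j))|rewrite rees_monoD //;
      apply: (idealD (IP i))].
  - split; first exact: (idealM _ (IF j)).
    have Fb : F 0%N b by rewrite (good_filt0 goodF).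
    by rewrite -[j]add0n rees_monoM //; apply: (idealM _ (IP i)).
have pow b : ideal_pow (F 1%N) k b -> F k b /\ ideal_pow rees_irr k (mono k b).
  elim: k b {a} => [|k IHk]; first by rewrite (good_filt0 goodF).
  apply: (ideal_mul_sub (Imono k.+1 k.+1)) => x y Fx /IHk[Fy Py].
  split; first exact: (good_mul1 goodF).
  rewrite -[k.+1]add1n rees_monoM // add1n ideal_powS;
    apply: mem_ideal_mul => //.
  by apply: sub_ideal_gen; exists x.
move=> aP; suff [] : F (k + n)%N a /\ ideal_pow rees_irr k (mono (k + n) a) by
  [].
move: a aP; apply: (ideal_mul_sub (Imono _ _)) => x y /pow[Fx Px] Fy.
split; first exact: (good_mul goodF).
by rewrite rees_monoM //; apply: (idealMr _ (IP k)).
Qed.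

(* The quotient by [rees_trunc k] is the part of degree [< k] of the fiber cone. *)
Definition rees_trunc k : set R :=
  comp_ideal (fun n => if (n < k)%N then ideal_mul J (F n) else F n).
Local Notation T := rees_trunc.

Let Itr k n : is_ideal (if (n < k)%N then ideal_mul J (F n) else F n).
Proof. by case: ifP. Qed.

Lemma ideal_rees_trunc k : is_ideal (T k).
Proof.
apply: ideal_comp_ideal => // i n a b Fa; case: ifP => nk; case: ifP => ik.
- exact: ideal_mul_filt.
- by move=> /JF_F; apply: (good_mul goodF).
- by move: ik nk; lia.
- exact: (good_mul goodF).
Qed.

(** Elements of positive degree carry [T k] into [T k.+1], so the Rees algebra acts on the quotient
    through A, and the coefficient of degree [k] identifies it with F_k / J F_k. The maps [f] and
    [g] insert and read that coefficient. *)
Lemma is_length_rees_trunc1 k e : is_length (F k) (ideal_mul J (F k)) e ->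
  is_length (T k) (T k.+1) e.
Proof.
pose d (Y : set A) n := if (n < k)%N then ideal_mul J (F n) else
  if n == k then Y else F n.
pose f Y : set R := comp_ideal (d Y).
pose g (X : set R) := [set coef p k | p in X].
have Id Y n : is_ideal Y -> is_ideal (d Y n) by move=> IY; rewrite /d;
  do 2?case: ifP.
have fP Y p : ideal_mul J (F k) `<=` Y -> Y `<=` F k ->
    f Y p <-> T k p /\ Y (coef p k).
  move=> JY YF; split=> [fp|[Tp Yp] n].
    split=> [n|]; last by have := fp k; rewrite /d ltnn eqxx.
    have := fp n; rewrite /d; case: ifP => // _; case: eqP => // -> /YF; exact.
  have := Tp n; rewrite /d; case: ifP => // nk; by case: eqP => // ->.
have fS X Y : X `<=` Y -> f X `<=` f Y.
  move=> XY p fp n; have := fp n; rewrite /d; do 2?case: ifP => // _; exact: XY.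
have gS X Y : X `<=` Y -> g X `<=` g Y.
  by move=> XY _ [p Xp <-]; exists p => //; apply: XY.
have F0 a : F 0%N a by rewrite (good_filt0 goodF).
have TE p : T k.+1 p <-> T k p /\ ideal_mul J (F k) (coef p k).
  split=> [Tp|[Tp Yp] n].
    split=> [n|]; last by have := Tp k; rewrite ltnSn.
    by have := Tp n; rewrite ltnS; case: (ltngtP n k) => // -> /JF_F.
  by have := Tp n; rewrite ltnS; case: (ltngtP n k) => // ->.
move=> le; apply: (is_length_transfer (f := f) (g :=
  g) _ _ fS gS _ _ _ _ _ _ _ le) => //.
- move=> X IX JX XF; apply: ideal_comp_ideal => [n|i n a b Fa]; first exact: Id.
  rewrite /d; case: (ltnP n k) => [nk Jb|kn].
    have := ideal_mul_filt Fa Jb; case: ifP => // _; case: eqP => [->|_];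
      first exact: JX.
    exact: JF_F.
  case: eqP => [->|nk] Xb.
    rewrite ltnNge leq_addl /=; case: eqP => [e1|_];
      last by apply: (good_mul goodF) => //; apply: XF.
    exact: idealM.
  rewrite ltnNge (leq_trans kn (leq_addl _ _)) /= gtn_eqF;
    first exact: (good_mul goodF).
  by move: kn nk; lia.
- move=> X IX TX XT; split=> [|_ _ [p Xp <-] [q Xq <-]|a _ [p Xp <-]].
  + by exists 0; [exact: ideal0|rewrite rees_poly0 coef0].
  + by exists (p + q); [exact: idealD|rewrite rees_polyD coefD].
  + exists (mono 0 a * p); first exact: idealM.
    by rewrite rees_polyM rees_monoE // expr0 alg_polyC coefCM.
- move=> Y IY JY YF; apply/seteqP; split=> [_ [p /(fP _ _ JY YF)[_ Yp] <-]//|y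
    Yy].
  have Fy : F k y by apply: YF.
  exists (mono k y); last by rewrite coef_rees_mono // eqxx.
  by apply/comp_ideal_mono => // [n|]; [exact: Id|rewrite /d ltnn eqxx].
- move=> X IX TX XT; have gX1 : ideal_mul J (F k) `<=` g X.
    move=> y Jy; exists (mono k y); last by rewrite coef_rees_mono ?eqxx //;
      apply: JF_F.
    apply: TX; apply/comp_ideal_mono => //; first exact: JF_F.
    by rewrite ltnSn.
  have gX2 : g X `<=` F k by move=> _ [p _ <-]; apply: rees_coefP.
  apply/seteqP; split=> p; last first.
    by move=> Xp; apply/(fP _ _ gX1 gX2); split; [exact: XT|exists p].
  move=> /(fP _ _ gX1 gX2)[Tp [q Xq eq]].
  apply: (idealBr IX _ Xq); apply: TX; apply/TE; split.
    by apply: (idealB (ideal_rees_trunc k)) => //; apply: XT.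
  have -> : rees_poly (p - q) = rees_poly p - rees_poly q by [].
  by rewrite coefB eq subrr; apply: ideal0.
- by apply/seteqP; split=> p; [move=> /fP/TE|move=> /TE/fP]; apply.
- apply/seteqP; split=> p; first by move=> /fP[].
  by move=> Tp; apply/fP => //; split=> //; apply: rees_coefP.
Qed.

Lemma is_length_rees_trunc (h : nat -> nat) k :
  (forall n, is_length (F n) (ideal_mul J (F n)) (h n)) ->
  is_length setT (T k) (\sum_(n < k) h n).
Proof.
move=> lh; elim: k => [|k IHk].
  rewrite big_ord0; suff -> : T 0 = setT by exact: is_length_refl.
  by apply/seteqP; split=> // p _ n; apply: rees_coefP.
rewrite big_ord_recr /=; apply: is_length_add IHk _.
exact: is_length_rees_trunc1.
Qed.

(** Here [c] is the degree from which [F] is stable: a component of degree at least k + c is in the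
    k-th power of [rees_irr], and a lower one is in [rees_fiber]. *)
Lemma rees_trunc_sub : exists c, forall k,
  T (k + c)%N `<=` ideal_add (ideal_pow M k) rees_fiber.
Proof.
have [c Hc] := good_stable_pow goodF; exists c => k p Tp.
have IP := ideal_ideal_pow M k; have Ifib := ideal_rees_fiber.
apply: rees_ideal_sum => //; first exact: ideal_ideal_add.
move=> n; have Fp := rees_coefP p n; have [kc|nk] := leqP (k + c) n.
  apply: sub_ideal_addl => //; apply: (ideal_powSl rees_irr_sub_max).
  have kn : (k <= n)%N := leq_trans (leq_addr c k) kc.
  rewrite -(subnKC kn); apply: rees_irr_pow; apply: Hc; last by rewrite subnKC.
  by rewrite -(leq_add2l k) subnKC.
apply: sub_ideal_addr => //; apply: (proj2 (comp_ideal_mono goodF IJF Fp)).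
by have := Tp n; rewrite nk.
Qed.

(** Here m^c lies in [J]. In an element of M^(k+c), the coefficient of degree n < k carries at least
    k + c - n factors from [m], hence at least [c]; the ideals [Z j] keep this count. *)
Lemma rees_sub_trunc : exists c, forall k,
  ideal_add (ideal_pow M (k + c)) rees_fiber `<=` T k.
Proof.
have [c Hc] := primary_pow NA mloc Jm; exists c => k.
pose Z j : set R := comp_ideal (fun n => ideal_mul (ideal_pow m (j - n)) (F n)).
have IZ j : is_ideal (Z j).
  apply: ideal_comp_ideal => [n|i n a b Fa]; first exact: ideal_ideal_mul.
  move=> /(ideal_mul_filt Fa); apply: ideal_mulS => //.
  by apply: ideal_pow_decr; lia.
have PZ j : ideal_pow M j `<=` Z j.
  elim: j => [|j IHj].
    by move=> p _ n; rewrite ideal_mulT //; apply: rees_coefP.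
  apply: (ideal_mul_sub (IZ _)) => p q Mp /IHj Zq n.
  rewrite rees_polyM coefM; have In := ideal_ideal_mul (ideal_pow m (j.+1 - n))
    (F n).
  apply: (ideal_sum _ In) => -[[|i] ni] _ /=.
    rewrite subn0; have := mem_ideal_mul (Mp : m (coef p 0)) (Zq n);
      rewrite ideal_mulA -ideal_powS.
    by apply: ideal_mulS => //; apply: ideal_pow_decr; lia.
  have := ideal_mul_filt (rees_coefP p i.+1) (Zq (n - i.+1)%N).
  rewrite subnKC //; apply: ideal_mulS => //; apply: ideal_pow_decr.
  by move: ni; rewrite ltnS; lia.
apply: ideal_add_sub; first exact: ideal_rees_trunc.
  move=> p /PZ Zp n; case: ifP => nk; last exact: rees_coefP.
  apply: ideal_mulS (Zp n) => //; apply: subset_trans Hc.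
  by apply: ideal_pow_decr; lia.
by move=> p Np n; case: ifP => // _; apply: rees_coefP.
Qed.

Lemma is_length_rees_pow k : exists e,
  is_length setT (ideal_add (ideal_pow M k) rees_fiber) e.
Proof.
have Ia := ideal_ideal_add (ideal_ideal_pow M k) ideal_rees_fiber.
apply: (is_length_finite (c := k) (noetherian_rees goodF NA) rees_max_maximal)
  => //.
rewrite ideal_mulIT; last exact: ideal_ideal_pow.
exact: sub_ideal_addl ideal_rees_fiber.
Qed.

End ReesLength.

(** * Chains of primes in the Rees algebra *)

Section ReesDimension.
Variables (A : comNzRingType) (m J : set A) (F : filtration A) (xs : seq A).
Hypotheses (NA : noetherian A) (mloc : is_local m) (Jm : primary_to m J).
Hypotheses (goodF : is_good F) (FCxs : weak_FC_sequence J F xs).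
Local Notation R := (rees F).
Local Notation coef p n := ((rees_poly p)`_n).
Local Notation mono := (rees_mono F).
Local Notation M := (rees_max m (F := F)).
Local Notation D := (fc_fiber J F xs).
Let IF n : is_ideal (F n) := good_ideal goodF n.
Let F0 a : F 0%N a. Proof. by rewrite (good_filt0 goodF). Qed.
Let ID i n : is_ideal (D i n) := ideal_fc_fiber J xs goodF i n.
Implicit Types (p q s : R) (P : set R).

(** The kernel of the map from the Rees algebra onto the fiber cone of F / K_i. *)
Definition fc_rees_ideal i : set R := comp_ideal (D i).
Local Notation DR := fc_rees_ideal.

Lemma ideal_fc_rees_ideal i : is_ideal (DR i).
Proof.
by apply: ideal_comp_ideal => // k n a b; apply: (fc_fiber_mul goodF).
Qed.
Let IDR := ideal_fc_rees_ideal.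

Lemma rees_poly_exp p n : rees_poly (p ^+ n) = rees_poly p ^+ n.
Proof. by elim: n => // n IHn; rewrite !exprS rees_polyM IHn. Qed.

Lemma rees_mono_exp a k n : F k a -> mono k a ^+ n = mono (k * n) (a ^+ n).
Proof.
move=> Fa; elim: n => [|n IHn].
  by rewrite muln0 !expr0; apply: rees_poly_inj;
    rewrite rees_monoE // expr0 alg_polyC.
have Fan : F (k * n)%N (a ^+ n).
  elim: n {IHn} => [|n IHn]; first by rewrite muln0.
  by rewrite mulnS exprS; apply: (good_mul goodF).
by rewrite !exprS IHn -rees_monoM // mulnS.
Qed.

(* Let [y = x_(i+1) t].  It is regular in high degrees on the quotient by [DR i],
   and multiplying by a power of a homogeneous element outside [P] of positive
   degree moves everything to high degrees; hence no [s * y ^+ j] with [s]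
   outside [P] lies in [DR i], and some prime over [DR i] avoids them all. *)
Lemma fc_prime_drop i P : (i < size xs)%N -> is_prime P -> DR i.+1 `<=` P ->
  P `<=` M -> ~ M `<=` P -> exists P', [/\ is_prime P', DR i `<=` P' & P' `<`
    P].
Proof.
move=> ilt PP DP PM nMP; have [IP P1 PMul] := PP.
have [p [Mp nPp]] : exists p, M p /\ ~ P p.
  by apply: contrapT => no; apply: nMP => p Mp; apply: contrapT => nPp;
    apply: no; exists p.
have [n nPn] : exists n, ~ P (mono n (coef p n)).
  apply: contrapT => no; apply: nPp; apply: rees_ideal_sum => // n.
  by apply: contrapT => nPn; apply: no; exists n.
have [c Hc] := primary_pow NA mloc Jm.
(* In degree 0 the component would lie in [m], a power of which lies in [J], so the prime [P] would
   contain it. *)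
have n0 : (0 < n)%N.
  rewrite lt0n; apply/negP => /eqP n0; apply: nPn; rewrite n0.
  apply: (prime_exp (n := c) PP); rewrite rees_mono_exp // mul0n; apply: DP.
  apply/comp_ideal_mono => //; apply: sub_ideal_addl;
    first exact: idealI (ideal_fc_ideal _ _) (IF _).
  rewrite (good_filt0 goodF) ideal_mulIT; last by case: Jm => -[].
  by apply: Hc; apply: mem_ideal_pow.
set h := mono n _ in nPn; have Fp := rees_coefP p n.
have [N HN] := fc_fiber_regular NA Jm goodF FCxs ilt.
have hN q k : (k < N)%N -> coef (h ^+ N * q) k = 0.
  move=> kN; rewrite rees_polyM rees_poly_exp rees_monoE // exprZn -exprM.
  rewrite -scalerAl coefZ coefXnM; suff -> : (k < n * N)%N by rewrite mulr0.
  by apply: leq_trans kN _; apply: leq_pmull.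
set x := xs`_i in HN; have Fx : F 1%N x by apply: fc_elem FCxs _ ilt.
have reg s : (forall k, (k < N)%N -> coef s k = 0) -> DR i (s * mono 1 x) ->
  DR i s.
  move=> s0 Ds k; have [/s0 ->|Nk] := ltnP k N; first exact: (ideal0 (ID i k)).
  rewrite (HN _ Nk); split; first exact: rees_coefP.
  have := Ds k.+1; rewrite rees_polyM rees_monoE // expr1 -scalerAr coefZ
    coefMX /=; exact.
pose T := [set z | exists s j, ~ P s /\ z = s * mono 1 x ^+ j].
have T1 : is_mult_closed T.
  split=> [|_ _ [s [j [nPs ->]]] [t [k [nPt ->]]]].
    by exists 1, 0%N; rewrite expr0 mulr1.
  exists (s * t), (j + k)%N; split; first by move=> /PMul[].
  by rewrite exprD mulrACA.
have DT : DR i `&` T = set0.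
  apply/seteqP; split=> // z [Dz [s [j [nPs e]]]]; rewrite {}e in Dz.
  have DP' : DR i `<=` P.
    apply: subset_trans DP => q Dq k.
    have := Dq k; apply: ideal_addS => // y [Ky Fy]; split=> //.
    exact: fc_ideal_incr Ky.
  suff : P (h ^+ N * s) by move=> /PMul[/(prime_exp PP)|].
  apply: DP'; elim: j s {nPs} Dz => [|j IHj] s Dz.
    by rewrite expr0 mulr1 in Dz; apply: (idealM _ (IDR i)).
  apply: reg; first exact: hN.
  rewrite -mulrA; apply: IHj; rewrite -mulrA -exprS; exact: Dz.
have [P' [PP' DP' PT]] := prime_avoiding (IDR i) T1 DT.
exists P'; split=> //; split.
  move=> s Ps; apply: contrapT => nPs.
  have : (P' `&` T) s by split=> //; exists s, 0%N; rewrite expr0 mulr1.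
  by rewrite PT.
move=> PP1; have : (P' `&` T) (mono 1 x).
  split; last by exists 1, 1%N; rewrite expr1 mul1r.
  apply: PP1; apply: DP; apply/comp_ideal_mono => //.
  apply: sub_ideal_addr; first exact: ideal_ideal_mul.
  by split=> //; apply: fc_ideal_elem.
by rewrite PT.
Qed.

(** The given chain has positive length so that its smallest prime is strictly below [M], as
    [fc_prime_drop] demands; the new prime goes below it. *)
Lemma fc_chain_succ i k : (i < size xs)%N ->
  prime_chain_between (DR i.+1) M k.+1 ->
  prime_chain_between (DR i) M k.+2.
Proof.
move=> ilt [P [PP PS DP PM]].
have PkM j : (j <= k.+1)%N -> P j `<=` M.
  by move=> jk; apply: subset_trans PM; apply: (strict_chain_sub PS).
have [|P' [PP' DP' P'P]] := fc_prime_drop ilt (PP 0%N isT) DP (PkM 0%N isT).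
  by have [_ n01] := PS 0%N isT; move=> MP; apply: n01; apply: subset_trans MP;
    apply: PkM.
exists (fun j => if j is j'.+1 then P j' else P'); split=> //.
- by case=> // j; rewrite ltnS; apply: PP.
- by case=> // j; rewrite ltnS; apply: PS.
Qed.

Lemma fc_chain_bound N i : (i <= size xs)%N -> (i <= N)%N ->
  (forall k, prime_chain_between (DR 0) M k -> (k <= N)%N) ->
  forall k, prime_chain_between (DR i) M k -> (k <= N - i)%N.
Proof.
move=> + + bN; elim: i => [_ _ k|i IHi ilt iN [//|k]]; first by rewrite subn0;
  apply: bN.
by move=> /(fc_chain_succ ilt)/(IHi (ltnW ilt) (ltnW iN)); lia.
Qed.

(* If [a t] were not nilpotent modulo [DR i], comparing coefficients shows that
   no [s * (a t) ^+ j] with [s] outside [M] lies in [DR i], so that there would be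
   a prime over [DR i] strictly below [M]. *)
Lemma fc_chain_trivial i : (forall k, prime_chain_between (DR i) M k ->
  k = 0%N) ->
  exists n0, forall n, (n0 <= n)%N -> F n `<=` D i n.
Proof.
move=> triv; have Mmax := rees_max_maximal mloc goodF.
have Mprime := maximal_prime Mmax; have [IM M1 MM] := Mprime.
have rad a : F 1%N a -> radical (DR i) (mono 1 a).
  move=> Fa; apply: contrapT => nrad; set y := mono 1 a in nrad.
  pose T := [set z | exists s j, ~ M s /\ z = s * y ^+ j].
  have T1 : is_mult_closed T.
    split=> [|_ _ [s [j [nPs ->]]] [t [k [nPt ->]]]].
      by exists 1, 0%N; rewrite expr0 mulr1.
    exists (s * t), (j + k)%N; split; first by move=> /MM[].
    by rewrite exprD mulrACA.
  have DT : DR i `&` T = set0.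
    apply/seteqP; split=> // z [Dz [s [j [nMs e]]]]; rewrite {}e in Dz.
    apply: nrad; exists j; have := Dz j.
    have [u us] := local_unit mloc nMs.
    rewrite rees_mono_exp // mul1n rees_polyM (rees_monoE goodF); last first.
      by apply: filt_pow_sub => //; apply: mem_ideal_pow.
    rewrite -scalerAr coefZ coefMXn ltnn subnn => Dj.
    apply/comp_ideal_mono => //; first by apply: filt_pow_sub => //;
      apply: mem_ideal_pow.
    by rewrite -[a ^+ j]mul1r -us mulrAC -mulrA; apply: (idealM _ (ID i j)).
  have [P [PP DP PT]] := prime_avoiding (IDR i) T1 DT.
  suff /triv : prime_chain_between (DR i) M 1 by [].
  exists (fun j => if j is 0%N then P else M); split=> //.
  - by case=> [|[]].
  - case=> // _; split.
      move=> s Ps; apply: contrapT => nMs.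
      have : (P `&` T) s by split=> //; exists s, 0%N; rewrite expr0 mulr1.
      by rewrite PT.
    move=> MP; have : (P `&` T) y.
      split; first by apply: MP; apply: rees_max_mono.
      by exists 1, 1%N; rewrite expr1 mul1r.
    by rewrite PT.
(* Being generated by elements nilpotent modulo [DR i], the ideal [rees_irr] is nilpotent modulo it,
   and its N-th power is everything in high degrees. *)
have [N HN] : exists N, ideal_pow (rees_irr (F := F)) N `<=` DR i.
  apply: (ideal_pow_sub_radical (noetherian_rees goodF NA)) => //.
    exact: ideal_gen_is_ideal.
  by apply: (ideal_gen_sub (ideal_radical (IDR i))) => _ [a Fa <-]; apply: rad.
have [n0 Hn0] := good_stable_pow goodF; exists (N + n0)%N => n nn a Fa.
have e : n = (N + (n - N))%N by rewrite subnKC // (leq_trans (leq_addr n0 N)).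
have := Fa; rewrite e => /Hn0 aP.
have Fa' : F (N + (n - N))%N a by rewrite -e.
apply: (proj1 (comp_ideal_mono goodF (ID i) Fa')).
by apply: HN; apply: (rees_irr_pow goodF); apply: aP; lia.
Qed.

End ReesDimension.

(** * The localized fiber cone *)

(* [L] is the localization of [R / N] at the maximal ideal [M]. *)
Section LocalQuotient.
Variables (R L : comPzRingType) (psi : R -> L) (M N : set R).
Hypotheses (psiD : forall x y, psi (x + y) = psi x + psi y)
  (psiM : forall x y, psi (x * y) = psi x * psi y) (psi1 : psi 1 = 1).
Hypotheses (Mmax : is_maximal M) (IN : is_ideal N) (NM : N `<=` M).
Hypotheses (psi_unit : forall s, ~ M s -> exists u, u * psi s = 1)
  (psi_frac : forall z, exists p s, ~ M s /\ z * psi s = psi p)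
  (psi_ker : forall p, psi p = 0 <-> exists s, ~ M s /\ N (s * p)).
Implicit Types (X : set R) (Z : set L).

Let Mprime : is_prime M := maximal_prime Mmax.
Let IM : is_ideal M. Proof. by case: Mprime. Qed.
Let nM1 : ~ M 1. Proof. by case: Mprime. Qed.
Let nMM s t : ~ M s -> ~ M t -> ~ M (s * t).
Proof. by case: Mprime => _ _ MM ns nt /MM[]. Qed.

Let psi0 : psi 0 = 0.
Proof. by apply: (addrI (psi 0)); rewrite -psiD !addr0. Qed.

Let psiB x y : psi (x - y) = psi x - psi y.
Proof. by apply: (addIr (psi y)); rewrite -psiD !subrK. Qed.

(** As [psi s] is a unit, [z * psi s = psi p] says z = p / s without writing a fraction. *)
Definition extension X : set L :=
  [set z | exists p s, [/\ X p, ~ M s & z * psi s = psi p]].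
Definition contraction Z : set R := [set p | Z (psi p)].

Lemma ideal_extension X : is_ideal X -> is_ideal (extension X).
Proof.
move=> IX; split=> [|y z [p [s [Xp ns ep]]] [q [t [Xq nt eq]]]|a y [p [s [Xp ns
  ep]]]].
- by exists 0, 1; split=> //; [exact: ideal0|rewrite psi0 mul0r].
- exists (t * p + s * q), (s * t); split; last first.
  + by rewrite psiD !psiM -ep -eq; ring.
  + exact: nMM.
  + by apply: idealD => //; apply: idealM.
- have [b [t [nt eb]]] := psi_frac a; exists (b * p), (s * t); split.
  + exact: idealM.
  + exact: nMM.
  + by rewrite !psiM -ep -eb; ring.
Qed.

Lemma ideal_contraction Z : is_ideal Z -> is_ideal (contraction Z).
Proof.
move=> IZ; split=> [|x y Zx Zy|a x Zx]; rewrite /contraction /mkset.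
- by rewrite psi0; apply: ideal0.
- by rewrite psiD; apply: idealD.
- by rewrite psiM; apply: idealM.
Qed.

Lemma extensionS X Y : X `<=` Y -> extension X `<=` extension Y.
Proof. by move=> XY z [p [s [/XY Yp ns e]]]; exists p, s. Qed.

Lemma psi_cancel Z z s : is_ideal Z -> ~ M s -> Z (z * psi s) -> Z z.
Proof.
move=> IZ /psi_unit[u us] Zzs; have -> : z = u * (z * psi s);
  last exact: idealM.
by rewrite mulrCA us mulr1.
Qed.

Lemma psi_extension X p : X p -> extension X (psi p).
Proof. by move=> Xp; exists p, 1; split=> //; rewrite psi1 mulr1. Qed.

Lemma contractionK Z : is_ideal Z -> extension (contraction Z) = Z.
Proof.
move=> IZ; apply/seteqP; split=> [z [p [s [Zp ns e]]]|z Zz].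
  by apply: psi_cancel IZ ns _; rewrite e.
have [p [s [ns e]]] := psi_frac z; exists p, s; split=> //.
by rewrite /contraction /mkset -e; apply: idealMr.
Qed.

Lemma extensionP X p : is_ideal X -> N `<=` X -> extension X (psi p) ->
  exists2 s, ~ M s & X (s * p).
Proof.
move=> IX NX [q [s [Xq ns e]]].
have [|t [nt Nt]] := (psi_ker (p * s - q)).1.
  by rewrite psiB psiM e subrr.
exists (t * s); first exact: nMM.
have -> : t * s * p = t * (p * s - q) + t * q by ring.
by apply: idealD => //; [apply: NX|apply: idealM].
Qed.

Lemma extensionT : extension setT = setT.
Proof. by apply/seteqP; split=> // z _; have [p [s []]] := psi_frac z;
  exists p, s. Qed.

Lemma extension_proper X : is_ideal X -> N `<=` X -> X `<=` M ->
  is_proper (extension X).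
Proof.
move=> IX NX XM; rewrite /is_proper -psi1 => /(extensionP IX NX)[s ns].
by rewrite mulr1 => /XM.
Qed.

Lemma proper_sub_extension Z : is_ideal Z -> is_proper Z -> Z `<=` extension M.
Proof.
move=> IZ Z1 z Zz; have [p [s [ns e]]] := psi_frac z; exists p, s; split=> //.
apply: contrapT => np; apply: Z1; apply: (psi_cancel IZ np); rewrite mul1r -e.
exact: idealMr.
Qed.

Lemma extension_local : is_local (extension M).
Proof.
have IE := ideal_extension IM; have E1 :=
  extension_proper IM NM (@subset_refl _ M).
split=> [|Z [IZ Z1 maxZ]]; last first.
  by apply/esym/maxZ => //; apply: proper_sub_extension.
split=> // Z IZ Z1 EZ; apply/seteqP; split=> //; exact: proper_sub_extension.
Qed.

Lemma extension_mul X Y : is_ideal X -> is_ideal Y ->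
  ideal_mul (extension X) (extension Y) = extension (ideal_mul X Y).
Proof.
move=> IX IY; have IXY := ideal_ideal_mul X Y; apply/seteqP; split.
  apply: (ideal_mul_sub (ideal_extension IXY)).
  move=> y z [p [s [Xp ns ep]]] [q [t [Yq nt eq]]].
  exists (p * q), (s * t); split; [exact: mem_ideal_mul|exact: nMM|].
  by rewrite !psiM -ep -eq; ring.
have IE := ideal_ideal_mul (extension X) (extension Y).
move=> z [p [s [XYp ns e]]]; apply: (psi_cancel IE ns); rewrite e.
move: p XYp {e}; apply: (ideal_mul_sub (ideal_contraction IE)) => p q Xp Yq.
rewrite /contraction /mkset psiM.
by apply: mem_ideal_mul; apply: psi_extension.
Qed.

Lemma extension_pow k : ideal_pow (extension M) k = extension (ideal_pow M k).
Proof.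
elim: k => [|k IHk]; first by rewrite extensionT.
by rewrite ideal_powS IHk extension_mul //; apply: ideal_ideal_pow.
Qed.

(** An inverse modulo M is lifted to one modulo any power, by multiplying the errors 1 - y s and 1 -
    w s. *)
Lemma inverse_mod_pow s k : ~ M s -> exists w, ideal_pow M k (1 - w * s).
Proof.
move=> ns; have [y My] := maximal_inv Mmax ns; elim: k => [|k [w Pw]].
  by exists 0.
exists (y + w - y * w * s).
have -> : 1 - (y + w - y * w * s) * s = (1 - y * s) * (1 - w * s) by ring.
by rewrite ideal_powS; apply: mem_ideal_mul.
Qed.

(** Elements outside [M] are invertible modulo M^k, so every ideal containing M^k + N is the
    contraction of its extension: localizing does not change the quotient. *)
Lemma is_length_extension k e : is_length setT (ideal_add (ideal_pow M k) N) e
  ->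
  is_length setT (ideal_pow (extension M) k) e.
Proof.
have IP := ideal_ideal_pow M k; have IV := ideal_ideal_add IP IN.
have IE := ideal_extension IP.
apply: (is_length_transfer (f := extension) (g := contraction)) => //.
- by move=> X IX _ _; apply: ideal_extension.
- by move=> Z IZ _ _; apply: ideal_contraction.
- exact: extensionS.
- by move=> Z Z' ZZ p; apply: ZZ.
- move=> X IX VX _; apply/seteqP; split=> p; last exact: psi_extension.
  have NX : N `<=` X by apply: subset_trans VX; apply: sub_ideal_addr.
  move=> /(extensionP IX NX)[s ns Xs]; have [w Pw] := inverse_mod_pow k ns.
  have -> : p = (1 - w * s) * p + w * (s * p) by ring.
  apply: idealD => //; last exact: idealM.
  by apply: idealMr => //; apply: VX; apply: sub_ideal_addl.
- by move=> Z IZ _ _; apply: contractionK.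
- rewrite extension_pow; apply/seteqP; split;
    last exact: extensionS (sub_ideal_addl IN).
  move=> z [p [s [[q Pq [n Nn <-]] ns ez]]]; exists q, s; split=> //.
  rewrite ez psiD; suff -> : psi n = 0 by rewrite addr0.
  by apply/psi_ker; exists 1; rewrite mul1r.
- exact: extensionT.
Qed.

Lemma contraction_prime P : is_prime P ->
  [/\ is_prime (contraction P), N `<=` contraction P & contraction P `<=` M].
Proof.
move=> [IP P1 PM]; have IC := ideal_contraction IP; split.
- split=> //; first by rewrite /is_proper /contraction /mkset psi1.
  by move=> x y; rewrite /contraction /mkset psiM => /PM.
- move=> n Nn; rewrite /contraction /mkset; suff ->
    : psi n = 0 by exact: ideal0.
  by apply/psi_ker; exists 1; rewrite mul1r.
- move=> p Pp; apply: contrapT => np; apply: P1.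
  by apply: (psi_cancel IP np); rewrite mul1r.
Qed.

Lemma extension_prime P : is_prime P -> N `<=` P -> P `<=` M ->
  is_prime (extension P) /\ contraction (extension P) = P.
Proof.
move=> [IP P1 PM] NP PsM.
have cE : contraction (extension P) = P.
  apply/seteqP; split=> p; last exact: psi_extension.
  by move=> /(extensionP IP NP)[s ns /PM[/PsM|]].
split=> //; split; [exact: ideal_extension|exact: extension_proper|].
move=> y z Eyz; have [p [s [ns ep]]] := psi_frac y; have [q [t [nt eq]]] :=
  psi_frac z.
have : contraction (extension P) (p * q).
  rewrite /contraction /mkset psiM -ep -eq mulrACA.
  exact: (idealMr _ (ideal_extension IP)).
by rewrite cE => /PM[Pp|Pq]; [left; exists p, s|right; exists q, t].
Qed.

Lemma krull_dim_extension d : prime_chain_between N M d ->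
  (forall j, prime_chain_between N M j -> (j <= d)%N) -> is_krull_dim L d.
Proof.
move=> Cd maxd; split=> [|j [P [PP PS]]].
  have [P [PP PS NP PM]] := Cd.
  have NPi i : (i <= d)%N -> N `<=` P i.
    by move=> id; apply: subset_trans NP _; apply: (strict_chain_sub PS).
  have PiM i : (i <= d)%N -> P i `<=` M.
    by move=> id; apply: subset_trans PM; apply: (strict_chain_sub PS).
  exists (fun i => extension (P i)); split=> i id.
    by have [] := extension_prime (PP i id) (NPi i id) (PiM i id).
  have [_ c1] := extension_prime (PP i (ltnW id)) (NPi i (ltnW id)) (PiM i
    (ltnW id)).
  have [_ c2] := extension_prime (PP _ id) (NPi _ id) (PiM _ id).
  have [sP nP] := PS i id; split; first exact: extensionS.
  by move=> E; apply: nP; rewrite -c1 -c2 => p; apply: E.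
apply: maxd; exists (fun i => contraction (P i)); split.
- by move=> i ij; have [] := contraction_prime (PP i ij).
- move=> i ij; have [sP nP] := PS i ij; split; first by move=> p; apply: sP.
  have [I1 _ _] := PP _ (ltnW ij); have [I2 _ _] := PP _ ij.
  by move=> C; apply: nP; rewrite -(contractionK I1) -(contractionK I2);
    apply: extensionS.
- by have [] := contraction_prime (PP 0%N isT).
- by have [] := contraction_prime (PP j (leqnn j)).
Qed.

End LocalQuotient.

Lemma prime_chain_quot (R : comPzRingType) (S L : set R) k :
  prime_chain_between (ideal_gen S) L k -> prime_chain (ring_quot S) k.
Proof.
move=> [P [PP PS SP _]]; have IK := ideal_gen_is_ideal S.
have SPi i : (i <= k)%N -> ideal_gen S `<=` P i.
  by move=> ik; apply: subset_trans SP _; apply: (strict_chain_sub PS).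
have piP i x : (i <= k)%N -> quot_set S (P i) (\pi_(ring_quot S) x) -> P i x.
  move=> ik /quot_setP[y Py Kxy]; have [IP _ _] := PP i ik.
  by apply: (idealBr IP _ Py); apply: (SPi i ik).
exists (fun i => quot_set S (P i)); split=> i ik.
  have [IP P1 PM] := PP i ik; split; first exact: quot_ideal.
    by move=> /(piP i 1 ik).
  elim/quotW=> x; elim/quotW=> y; rewrite -quot_piM => /(piP _ _ ik)/PM[Px|Py].
    by left; exists x.
  by right; exists y.
have [sP nP] := PS i ik; split; first by move=> _ [x /sP Px <-]; exists x.
by move=> Q; apply: nP => x Px; apply: (piP i x (ltnW ik)); apply: Q; exists x.
Qed.

Section FiberConeLocal.
Variables (A : comNzRingType) (m J : set A) (F : filtration A).
Hypotheses (mloc : is_local m) (Jm : primary_to m J) (goodF : is_good F).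
Local Notation R := (rees F).
Local Notation M := (rees_max m (F := F)).
Local Notation N := (rees_fiber J (F := F)).
Local Notation L := (fiber_cone_local F m J).
Local Notation S := (~` fiber_cone_max (F := F) m (J := J)).
Implicit Types (p q s : R).
Let IN : is_ideal N := ideal_rees_fiber J goodF.
Let NM : N `<=` M := rees_fiber_sub_max Jm goodF.
Let Mmax : is_maximal M := rees_max_maximal mloc goodF.

Definition fiber_pi p : fiber_cone F J := \pi_(ring_quot N) p.

Lemma fiber_pi0 p : fiber_pi p = 0 <-> N p.
Proof. by apply: iff_trans (quot_pi0P _ _) _; rewrite ideal_gen_id. Qed.

Lemma fiber_cone_maxP p : fiber_cone_max (F := F) m (J :=
  J) (fiber_pi p) <-> M p.
Proof.
have [IM _ _] := Mmax; split=> [[q Mq /ring_quotP Nqp]|Mp]; last by exists p.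
rewrite (ideal_gen_id IN) in Nqp.
by apply: (idealBr IM (y := q)) => //; apply: NM; apply: (idealBC IN).
Qed.

(** [M] is prime and contains the kernel, so the complement is multiplicatively closed already. *)
Lemma fiber_denominatorsP (d : fiber_cone F J) :
  denominators S d <-> exists2 s, ~ M s & d = fiber_pi s.
Proof.
have [IM M1 MM] := maximal_prime Mmax; split; last first.
  by move=> [s ns ->]; apply: sub_gen_smallest => /fiber_cone_maxP.
move: d; apply: (@smallest_sub _ _ _ [set d | exists2 s, ~ M s & d = fiber_pi
  s]).
  split; first by exists 1.
  move=> _ _ [s ns ->] [t nt ->]; exists (s * t); first by move=> /MM[].
  by rewrite /fiber_pi quot_piM.
by elim/quotW=> s ns; exists s => // Ms; apply: ns; apply/fiber_cone_maxP.
Qed.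

Definition fiber_frac (x d : fiber_cone F J) (Dd : denominators S d) : L :=
  \pi_(localization S) (mk_frac x Dd).

(** The map from the Rees algebra to the localized fiber cone; the lemmas below check for it what
    was assumed of [psi]. *)
Definition fiber_loc p : L := fiber_frac (fiber_pi p) (@denominators1 _ S).

Lemma fiber_locD p q : fiber_loc (p + q) = fiber_loc p + fiber_loc q.
Proof.
rewrite /fiber_loc /fiber_frac /fiber_pi quot_piD.
apply: etrans (esym (loc_pi_add _ _)); apply: eq_frac.
by rewrite /pre_add /mk_frac /num /den /=; ring.
Qed.

Lemma fiber_locM p q : fiber_loc (p * q) = fiber_loc p * fiber_loc q.
Proof.
rewrite /fiber_loc /fiber_frac /fiber_pi quot_piM.
apply: etrans (esym (loc_pi_mul _ _)); apply: eq_frac.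
by rewrite /pre_mul /mk_frac /num /den /=; ring.
Qed.

Lemma fiber_loc1 : fiber_loc 1 = 1.
Proof. by []. Qed.

Lemma fiber_loc_unit s : ~ M s -> exists u, u * fiber_loc s = 1.
Proof.
move=> ns; have Ds : denominators S (fiber_pi s) by apply/fiber_denominatorsP;
  exists s.
exists (fiber_frac 1 Ds); apply: etrans (loc_pi_mul _ _) _; apply: eq_frac.
by rewrite /pre_mul /mk_frac /num /den /= !mulr1 !mul1r.
Qed.

Lemma fiber_loc_frac z : exists p s, ~ M s /\ z * fiber_loc s = fiber_loc p.
Proof.
elim/quotW: z => -[[x d] Dd]; have := asboolW Dd => /= /fiber_denominatorsP[s
  ns ds].
elim/quotW: x Dd => p Dd; exists p, s; split=> //.
apply: etrans (loc_pi_mul _ _) _; apply: eq_frac.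
by rewrite /pre_mul /mk_frac /num /den /= ds !mulr1.
Qed.

Lemma fiber_loc_ker p : fiber_loc p = 0 <-> exists s, ~ M s /\ N (s * p).
Proof.
apply: iff_trans (localizationP _ _) _; split.
  move=> [u /fiber_denominatorsP[s ns ->]];
    rewrite /num /den /= mulr1 mul0r mulr0.
  by rewrite -quot_piM => /fiber_pi0 Nsp; exists s.
move=> [s [ns /fiber_pi0 e]]; exists (fiber_pi s).
  by apply/fiber_denominatorsP; exists s.
by rewrite /num /den /= mulr1 mul0r mulr0 -quot_piM.
Qed.

Lemma fiber_cone_local_max : is_local (extension fiber_loc M M).
Proof.
exact: (extension_local fiber_locD fiber_locM fiber_loc1 Mmax NM
  fiber_loc_unit fiber_loc_frac fiber_loc_ker).
Qed.

Lemma is_length_fiber_cone_local k e :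
  is_length setT (ideal_add (ideal_pow M k) N) e ->
  is_length setT (ideal_pow (extension fiber_loc M M) k) e.
Proof.
exact: (is_length_extension fiber_locD fiber_locM fiber_loc1 Mmax IN
  fiber_loc_unit fiber_loc_frac fiber_loc_ker).
Qed.

Lemma krull_dim_fiber_cone_local d : prime_chain_between N M d ->
  (forall j, prime_chain_between N M j -> (j <= d)%N) ->
  is_krull_dim (fiber_cone_local F m J) d.
Proof.
exact: (krull_dim_extension fiber_locD fiber_locM fiber_loc1 Mmax
  fiber_loc_unit fiber_loc_frac fiber_loc_ker).
Qed.

(** A power of [m] lies in [J], so a prime containing all J F_n t^n contains [m] in degree 0, hence
    all m F_n t^n. This links the analytic spread, defined through [m], with the fiber cone of
    [J]. *)
Lemma prime_chain_fiber_cone k : noetherian A -> prime_chain_between N M k ->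
  prime_chain (fiber_cone F m) k.
Proof.
move=> NA [P [PP PS NP PM]]; apply: (prime_chain_quot (L := M)).
have Im := local_ideal mloc.
exists P; split=> //; rewrite ideal_gen_id; last exact: ideal_rees_fiber.
have [IP P1 PMul] := PP 0%N isT; have [c Hc] := primary_pow NA mloc Jm.
have F0 a : F 0%N a by rewrite (good_filt0 goodF).
have mP a : m a -> P 0%N (rees_mono F 0 a).
  move=> ma; apply: (prime_exp (n := c) (PP 0%N isT)); apply: NP.
  rewrite rees_mono_exp // mul0n.
  apply/(comp_ideal_mono goodF (fun n => ideal_ideal_mul J (F n)) (F0 _)).
  rewrite (good_filt0 goodF) ideal_mulIT; last by case: Jm => -[].
  by apply: Hc; apply: mem_ideal_pow.
move=> p Np; apply: (rees_ideal_sum goodF) => // n.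
have IF := good_ideal goodF n.
suff : ideal_mul m (F n) `<=` [set a | F n a /\ P 0%N (rees_mono F n a)].
  by move=> /(_ _ (Np n))[].
apply: ideal_mul_sub => [|a b ma Fb]; last first.
  split; first exact: idealM.
  by rewrite -[n]add0n rees_monoM //; apply: idealMr => //; apply: mP.
split=> [|a b [Fa Pa] [Fb Pb]|a b [Fb Pb]].
- by split; [exact: (ideal0 IF)|rewrite rees_mono0 //; apply: (ideal0 IP)].
- by split; [exact: (idealD IF)|rewrite rees_monoD //; apply: (idealD IP)].
- split; first exact: (idealM _ IF).
  by rewrite -[n]add0n rees_monoM //; apply: (idealM _ IP).
Qed.

End FiberConeLocal.

(** * Multiplicity *)

(** One stable index yields a least one, so [xget] does not fall back on its default 0. *)
Lemma reduction_number_stable (A : comPzRingType) (I : set A) (F : nat ->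
  set A) :
  (exists n, stable_from I F n) -> stable_from I F (reduction_number I F).
Proof.
move=> exn; have exb : exists n, `[< stable_from I F n >].
  by have [n Sn] := exn; exists n; apply/asboolP.
rewrite /reduction_number; case: xgetP => [r _ []//|none].
have [r /asboolP Sr minr] := ex_minnP exb.
by case: (none r); split=> // s /asboolP; apply: minr.
Qed.

(** * Hilbert polynomials along the sequence *)

Section HilbertFunction.
Variables (A : comNzRingType) (m J : set A) (F : nat -> set A) (xs : seq A).
Hypotheses (NA : noetherian A) (mloc : is_local m) (Jm : primary_to m J).
Hypotheses (goodF : is_good F) (FCxs : weak_FC_sequence J F xs).
Local Notation D := (fc_fiber J F xs).
Variable H : nat -> nat -> nat.
Hypothesis HP : forall i n, is_length (F n) (D i n) (H i n).

Lemma fc_hilbert_succ i : (i < size xs)%N -> exists n0, forall n, (n0 <= n)%N ->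
  H i n.+1 = (H i.+1 n.+1 + H i n)%N.
Proof.
move=> ilt; have [n1 H1] := fc_fiber_succ Jm goodF FCxs ilt.
have [n2 H2] := fc_fiber_regular NA Jm goodF FCxs ilt.
exists (maxn n1 n2) => n; rewrite geq_max => /andP[/H1{}H1 /H2{}H2].
have IF := good_ideal goodF; have ID j k := ideal_fc_fiber J xs goodF j k.
have DD : D i n.+1 `<=` D i.+1 n.+1.
  by rewrite H1; apply: sub_ideal_addr; apply: ideal_image_scale.
have [a [b [la lb ->]]] := is_length_split (HP i n.+1) (ID _ _) DD
  (fc_fiber_sub (J := J) (xs := xs) goodF (i := i.+1) (n := n.+1)).
rewrite (is_length_uniq la (HP _ _)); congr (_ + _)%N.
apply: is_length_uniq (HP i n).
exact/(is_length_scale b (IF n) (ID i n.+1) H1 H2).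
Qed.

(** Each of the [i] summations leading from H_i down to H_0 raises the degree by one and divides the
    leading coefficient by the new degree, whence the factorial. *)
Lemma fc_hilbert_polynomial e i : size xs = i.+1 -> (0 < e)%N ->
  (exists n0, forall n, (n0 <= n)%N -> H i n = e) ->
  exists p : {poly rat}, [/\ exists n0, forall n, (n0 <= n)%N ->
    (H 0 n)%:R = p.[n%:R],
    size p = i.+1 & lead_coef p * i`!%:R = e%:R].
Proof.
move=> sxs e0 [n0 Hn0].
suff claim j : (j <= i)%N -> exists p : {poly rat},
    [/\ exists n0, forall n, (n0 <= n)%N -> (H (i - j) n)%:R = p.[n%:R],
    size p = j.+1 & lead_coef p * j`!%:R = e%:R].
  by have := claim i (leqnn i); rewrite subnn.
elim: j => [_|j IHj ji].
  exists e%:R%:P; rewrite subn0 size_polyC lead_coefC mulr1 pnatr_eq0 -lt0n e0.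
  by split=> //; exists n0 => n /Hn0 ->; rewrite hornerC.
have [p [[n1 Hp] sp lp]] := IHj (ltnW ji).
have [|n2 Hs] := @fc_hilbert_succ (i - j.+1); first by lia.
(* The shift is needed because H_i(n+1) - H_i(n) is the value of H_(i+1) at n + 1, not at n. *)
have [|q [Hq]] := @evpoly_antidifference (fun k => (H (i - j.+1) k)%:R)
    (p \Po ('X + 1%:P)) (maxn n1 n2).
  move=> k; rewrite geq_max => /andP[n1k /Hs ->];
    rewrite natrD addrK horner_shift.
  by rewrite natr1 -Hp ?leqW // subnSK.
rewrite -size_poly_eq0 size_shift lead_coef_shift sp => /(_ isT)[sq lq].
exists q; split=> //; first by exists (maxn n1 n2).
by rewrite factS natrM mulrA lq.
Qed.

End HilbertFunction.

Theorem theorem3p3 (A : comNzRingType) (m J : set A) (F : filtration A)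
    (l : nat) (xs : l.-tuple A) :
  noetherian A -> is_local m -> infinite_set [set: ring_quot m] ->
  primary_to m J ->
  is_good F -> is_analytic_spread F m l -> (0 < l)%N ->
  weak_FC_sequence J F xs ->
  let r := reduction_number (ideal_gen [set` xs]) F in
  let Q := ideal_gen [set` take l.-1 xs] in
  exists e : nat,
    is_fiber_cone_multiplicity F m J e /\
    forall n, (r <= n)%N ->
      is_length (F n)
        (ideal_add (saturation Q (F 1%N) `&` F n) (ideal_mul J (F n))) e.
Proof.
move=> NA mloc _ Jm goodF [_ maxl] l0 FCxs r Q.
have sxs : size xs = l by apply: size_tuple.
have eQ : Q = fc_ideal xs l.-1 by [].
have eI : ideal_gen [set` xs] = fc_ideal xs l by rewrite /fc_ideal
  take_oversize ?sxs.
have ilt : (l.-1 < size xs)%N by rewrite sxs prednK.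
have IF := good_ideal goodF; have ID i n := ideal_fc_fiber J xs goodF i n.
have DN : fc_rees_ideal (F := F) J xs 0 = rees_fiber J (F := F).
  by apply/seteqP; split=> p Dp n; have := Dp n; rewrite fc_fiber0.
have bound k : prime_chain_between (fc_rees_ideal (F := F) J xs 0)
    (rees_max m (F := F)) k -> (k <= l)%N.
  by rewrite DN => /(prime_chain_fiber_cone mloc Jm goodF NA); apply: maxl.
have nontriv : ~ exists n0, forall n, (n0 <= n)%N ->
  F n `<=` fc_fiber J F xs l.-1 n.
  by move=> /(fc_nakayama NA mloc Jm goodF);
    apply: fc_nonnilpotent goodF FCxs _ ilt.
have red : stable_from (fc_ideal xs l) F r.
  rewrite /r eI; apply: reduction_number_stable.
  have := fc_reduction NA mloc Jm goodF FCxs; rewrite sxs; apply.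
  apply: (fc_chain_trivial NA mloc goodF) => k.
  have ll : (l <= size xs)%N by rewrite sxs.
  move=> /(fc_chain_bound NA mloc Jm goodF FCxs ll (leqnn l) bound).
  by rewrite subnn leqn0 => /eqP.
(* If all chains were shorter than l, then l - 1 elements of the sequence would leave only chains of
   length 0, and the fiber cone of F / K_(l-1) would vanish in large degrees. *)
have Cl : prime_chain_between (rees_fiber J (F := F)) (rees_max m (F := F)) l.
  rewrite -DN; apply: contrapT => nCl; apply: nontriv.
  apply: (fc_chain_trivial NA mloc goodF) => k Ck; apply/eqP;
    rewrite -leqn0 -(subnn l.-1).
  apply: (fc_chain_bound NA mloc Jm goodF FCxs (ltnW ilt) (leqnn _)) Ck => j Cj.
  have := bound j Cj; rewrite leq_eqVlt => /predU1P[e|];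
    first by rewrite e in Cj.
  by lia.
have dimL : is_krull_dim (fiber_cone_local F m J) l.
  by apply: (krull_dim_fiber_cone_local mloc Jm goodF) => // j; rewrite -DN;
    apply: bound.
have [e He] : exists e, forall n, (r <= n)%N -> is_length (F n)
    (ideal_add (saturation Q (F 1%N) `&` F n) (ideal_mul J (F n))) e.
  apply: (fc_saturation_length NA mloc Jm goodF FCxs ilt);
    first by rewrite prednK.
  by rewrite prednK.
exists e; split=> //.
have /choice[h hP] : forall i, exists hi : nat -> nat, forall n,
    is_length (F n) (fc_fiber J F xs i n) (hi n).
  move=> i; have /choice[hi Hi] := fun n => fc_fiber_length xs NA mloc Jm goodF
    i n.
  by exists hi.
have [n1 he] : exists n1, forall n, (n1 <= n)%N -> h l.-1 n = e.
  have [n1 E] := fc_saturation_eq J NA goodF ilt.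
  exists (maxn r n1) => n; rewrite geq_max => /andP[/He{}He /E{}E].
  by apply: is_length_uniq (hP _ _) _; rewrite -E -eQ.
(* Length 0 would also make that fiber cone vanish in large degrees. *)
have e0 : (0 < e)%N.
  rewrite lt0n; apply/eqP => ee; apply: nontriv; exists n1 => n /he hn.
  have [C _] := hP l.-1 n; rewrite hn ee in C.
  by rewrite {1}(ideal_chain0_eq C).
have [p [[n2 hp] sp lp]] := fc_hilbert_polynomial NA Jm goodF FCxs hP
  (etrans sxs (esym (prednK l0))) e0 (ex_intro _ n1 he).
(* The length of the part of degree below k of the fiber cone; it is eventually a polynomial [s] of
   degree l with leading coefficient e / l!. *)
pose Sh k := (\sum_(n < k) h 0%N n)%N.
have [|s [Hs]] := @evpoly_antidifference (fun k => (Sh k)%:R) p n2.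
  by move=> k /hp <-; rewrite /Sh big_ord_recr natrD /= addrC addKr.
rewrite -size_poly_eq0 sp => /(_ isT)[]; rewrite prednK // => ss ls.
have h0 n : is_length (F n) (ideal_mul J (F n)) (h 0%N n).
  by have := hP 0%N n; rewrite fc_fiber0.
have lenT k := is_length_rees_trunc goodF k h0.
have /choice[la laP] : forall k, exists e', is_length setT (ideal_add
    (ideal_pow (rees_max m (F := F)) k) (rees_fiber J (F := F))) e'.
  by move=> k; apply: (is_length_rees_pow J NA mloc goodF k).
have [IM _ _] := rees_max_maximal mloc goodF.
have [P [n3 HPla]] := hilbert_samuel (noetherian_rees goodF NA) IM
  (ideal_rees_fiber J goodF) laP.
have [c1 Hc1] := rees_trunc_sub J mloc goodF.
have [c2 Hc2] := rees_sub_trunc NA mloc Jm goodF.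
have up k : (la k <= Sh (k + c1))%N.
  by apply: is_length_le (lenT _) (laP k) _; apply: Hc1.
have down k : (Sh k <= la (k + c2))%N.
  by apply: is_length_le (laP _) (lenT k) _; apply: Hc2.
have ls0 : 0 < lead_coef s.
  have l0' : (0 : rat) < l%:R by rewrite ltr0n.
  rewrite -(pmulr_lgt0 _ l0') ls.
  have f0 : (0 : rat) < (l.-1)`!%:R by rewrite ltr0n fact_gt0.
  by rewrite -(pmulr_lgt0 _ f0) lp ltr0n.
(* The threshold n2 + c2 keeps k - c2 in the range where [s] computes [Sh]. *)
have [|||k|sP lP] := @poly_squeeze (s \Po ('X + (- c2%:R)%:P)) P
    (s \Po ('X + c1%:R%:P)) (maxn n3 (n2 + c2)).
- by rewrite !size_shift.
- by rewrite !lead_coef_shift.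
- by rewrite lead_coef_shift.
- rewrite geq_max => /andP[n3k n2k]; rewrite !horner_shift -HPla //.
  have c2k : (c2 <= k)%N := leq_trans (leq_addl n2 c2) n2k.
  rewrite -natrB // -natrD -!Hs ?ler_nat; try lia.
  by rewrite up andbT -{2}(subnK c2k) down.
rewrite size_shift ss in sP; rewrite lead_coef_shift in lP.
exists (extension (fiber_loc (F := F) m J) (rees_max m (F := F))
  (rees_max m (F := F))), l, P; split=> //.
- exact: fiber_cone_local_max.
- exists n3 => k /HPla ek; exists (la k); last by rewrite ek.
  by apply: is_length_fiber_cone_local.
- rewrite lP -lp -ls -mulrA -natrM mulrC; congr (_%:R * _).
  by case: (l) l0 => // k _; rewrite factS.
Qed.
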